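(* Let $\epsilon>0$, let $\mathcal{I}$ be an instance of (unit demand or splittable) CVRP on an $n$-node rooted tree $T$ with depot $r$ at the root, capacity $Q$, and height at most $h=\delta\log^2 n/\epsilon$ for a fixed constant $\delta>0$, and let $\mathrm{opt}$ be its optimum cost. Let $\alpha\ge\max\{1,12\delta\}$ be a constant. Then one can build an instance $\mathcal{I}'$ on the same tree $T$, obtained from $\mathcal{I}$ by adding tokens at nodes, such that each node has at least one token, and with high probability there exists a solution $\mathrm{OPT}'$ of $\mathcal{I}'$ of cost at most $(1+4\epsilon)\mathrm{opt}$ with the following property: for every node $v$, the partial tours of $\mathrm{OPT}'$ going down the subtree $T_v$ have one of $O((\log Q\log^3 n)/\epsilon^3)$ possible sizes. More specifically, for every node $v$ and bucket index $i$, either (a) bucket $b_i$ at $v$ is small, i.e. at most $\alpha\log^3 n/\epsilon^2$ partial tours of $T_v$ have size in $[\sigma_i,\sigma_{i+1})$, or (b) bucket $b_i$ at $v$ is big, in which case there are $g=(2\delta\log n)/\epsilon^2$ values $\sigma_i\le h^{v,\max}_{i,1}\le\dots\le h^{v,\max}_{i,g}<\sigma_{i+1}$ such that every partial tour of $T_v$ with size in bucket $b_i$ has size equal to one of these values.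
   Context: CVRP instances are viewed as token instances: each node $v$ carries $d(v)$ tokens, a solution is a collection of tours from the depot $r$, each picking up at most $Q$ tokens in total, such that every token is picked up by some tour; cost is the total edge weight traversed. Adding tokens at nodes gives an instance $\mathcal{I}'$ any solution of which is also a solution of $\mathcal{I}$ of no larger cost. For a node $v$, $T_v$ is the subtree rooted at $v$; a partial tour of a tour at $v$ is the portion of the tour inside $T_v$, and its size (coverage) is the number of tokens the tour picks up in $T_v$. Threshold values $\sigma_1,\dots,\sigma_\tau$: $\sigma_i=i$ for $1\le i\le\lceil1/\epsilon\rceil$, $\sigma_i=\lceil\sigma_{i-1}(1+\epsilon)\rceil$ for larger $i$, and $\sigma_\tau=Q$, so $\tau=O(\log Q/\epsilon)$. Bucket $b_i$ at $v$ consists of the partial tours at $v$ whose size lies in $[\sigma_i,\sigma_{i+1})$. ''With high probability'' refers to a randomized construction (probability $1-O(1/n)$).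
   Formalization: Every node other than the depot is assumed to carry at least one token in I; the bound on the number of possible sizes is claimed for Q ≥ 2 (log 1 = 0); the hidden constants may depend on δ, α and an arbitrary upper bound on ε. *)

(* Defs.v *)
From HB Require Import structures.
From mathcomp Require Import all_boot all_order all_algebra.
From mathcomp Require Import boolp classical_sets reals exp.

Set Implicit Arguments.
Unset Strict Implicit.
Unset Printing Implicit Defensive.

Import Order.TTheory GRing.Theory Num.Theory.

Local Open Scope ring_scope.

(* A rooted tree with edge weights on the vertex set V, given by its parent map;
   the depot is the root.  The edges are the pairs {v, parent v} with
   v != depot, of weight [weight v] (the value at the depot is not used).
   [fconnect parent v a] says that iterating parent from v reaches a, i.e.
   that a is v or an ancestor of v; reachability of the depot excludes
   cycles. *)
Record wtree (R : realType) (V : finType) := WTree {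
  depot : V;
  parent : V -> V;
  weight : V -> R;
  parent_depot : parent depot = depot;
  depot_reachable : forall v, fconnect parent v depot;
  weight_ge0 : forall v, 0 <= weight v
}.

Section CVRP.
Variables (R : realType) (V : finType) (T : wtree R V).

Definition adj : rel V := fun u v =>
  ((u != depot T) && (v == parent T u)) || ((v != depot T) && (u == parent T v)).

(* Only meaningful for adjacent u and v. *)
Definition edge_weight (u v : V) : R :=
  if (u != depot T) && (v == parent T u) then weight T u else weight T v.

(* [findex f x y] is the least k with iter k f x = y; heights count edges. *)
Definition depth (v : V) : nat := findex (parent T) v (depot T).
Definition height : nat := \max_(v : V) depth v.

Definition in_subtree (v u : V) : bool := fconnect (parent T) u v.

(* A tour leaves the depot, visits [walk] in this order (the starting depot is
   not listed) and picks up [pick v] of the tokens of each node v. *)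
Record tour := Tour { walk : seq V; pick : V -> nat }.

Definition stops (t : tour) : seq V := depot T :: walk t.

Definition is_tour (Q : nat) (t : tour) : bool :=
  [&& path adj (depot T) (walk t),
      last (depot T) (walk t) == depot T,
      [forall v, (0 < pick t v)%N ==> (v \in stops t)]
    & (\sum_(v : V) pick t v <= Q)%N].

Definition tour_cost (t : tour) : R :=
  \sum_(x <- pairmap edge_weight (depot T) (walk t)) x.

(* Demands are splittable: the tokens of a node may be shared between several
   tours; unit demands are the case d v = 1.  Each token is picked up by
   exactly one tour. *)
Definition is_solution (Q : nat) (d : V -> nat) (S : seq tour) : Prop :=
  all (is_tour Q) S /\ (forall v, (\sum_(t <- S) pick t v)%N = d v).

Definition cost (S : seq tour) : R := \sum_(t <- S) tour_cost t.

Definition is_opt (Q : nat) (d : V -> nat) (opt : R) : Prop :=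
  (exists2 S, is_solution Q d S & cost S = opt) /\
  (forall S, is_solution Q d S -> opt <= cost S).

Definition coverage (t : tour) (v : V) : nat :=
  (\sum_(u | in_subtree v u) pick t u)%N.

(* Sizes, with multiplicity, of the partial tours of S at v: one for each tour
   entering the subtree T_v. *)
Definition partial_sizes (S : seq tour) (v : V) : seq nat :=
  [seq coverage t v | t <- S & has (in_subtree v) (stops t)].

End CVRP.

Definition natceil (R : realType) (x : R) : nat := `|Num.ceil x|%N.

(* The thresholds before truncation at the capacity. *)
Fixpoint raw_sigma (R : realType) (eps : R) (i : nat) : nat :=
  if i is j.+1 then
    if (j.+1 <= natceil eps^-1)%N then j.+1
    else natceil ((raw_sigma eps j)%:R * (1 + eps))
  else 0%N.

(* The least i >= 1 with Q <= raw_sigma eps i; as raw_sigma is strictly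
   increasing, it is at most Q (for Q >= 1), so the search succeeds. *)
Definition tau (R : realType) (eps : R) (Q : nat) : nat :=
  (find (fun i => (Q <= raw_sigma eps i)%N) (iota 1 Q)).+1.

(* sigma_1 < ... < sigma_tau = Q; the value Q + 1 beyond tau makes the last
   bucket {Q}, so that the buckets b_1, ..., b_tau partition {1, ..., Q}. *)
Definition sigma (R : realType) (eps : R) (Q i : nat) : nat :=
  if (i <= tau eps Q)%N then minn (raw_sigma eps i) Q else Q.+1.

Definition in_bucket (R : realType) (eps : R) (Q i s : nat) : bool :=
  (sigma eps Q i <= s < sigma eps Q i.+1)%N.

Record finprob (R : realType) (Omega : finType) := FinProb {
  pmf : Omega -> R;
  pmf_ge0 : forall w, 0 <= pmf w;
  pmf_sum1 : \sum_w pmf w = 1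
}.

Definition Pr (R : realType) (Omega : finType) (P : finprob R Omega)
    (E : set Omega) : R :=
  \sum_(w | `[< E w >]) pmf P w.

Section Structure.
Variables (R : realType) (V : finType) (T : wtree R V).
Variables (delta alpha eps : R) (Q : nat) (S : seq (tour V)).

Let logn : R := ln #|V|%:R.

Definition bucket_card (v : V) (i : nat) : nat :=
  count (in_bucket eps Q i) (partial_sizes T S v).

Definition small_bucket (v : V) (i : nat) : Prop :=
  (bucket_card v i)%:R <= alpha * logn ^+ 3 / eps ^+ 2.

(* The real number g is rounded up. *)
Definition num_groups : nat := natceil (2 * delta * logn / eps ^+ 2).

(* [m] lists the values h_(i,1) <= ... <= h_(i,g). *)
Definition few_sizes (v : V) (i : nat) : Prop :=
  exists m : num_groups.-tuple nat,
    [/\ sorted leq m, all (in_bucket eps Q i) m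
      & forall s, s \in partial_sizes T S v -> in_bucket eps Q i s -> s \in m].

Definition structured : Prop :=
  forall (v : V) (i : nat), (1 <= i <= tau eps Q)%N ->
    small_bucket v i \/ (~ small_bucket v i /\ few_sizes v i).

Definition num_sizes (v : V) : nat := size (undup (partial_sizes T S v)).

(* For Q = 1 the bound log Q is zero, so the claim is made for Q >= 2. *)
Definition few_sizes_overall (K : R) : Prop :=
  (1 < Q)%N -> forall v : V,
    (num_sizes v)%:R <= K * (ln Q%:R * logn ^+ 3 / eps ^+ 3).

End Structure.

(* Main.v *)
(* No randomness is needed. Up to an Euler walk, the cost of a tour is twice the weight of the edges
   above the subtrees in which it picks up tokens, so it suffices to redistribute the picks among
   new tours such that the edge above each node v is crossed at most 1 + 4 eps times as often as in
   an optimal solution. The constant C takes care of the instances with few nodes.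

   Where few tours cross the edge above v, all buckets at v are small, and the partial tours there
   are left unchanged: a visit of a maximal such subtree is one item, and so are the picks of a
   tour at any other node. Items smaller than about eps Q / 6 are first bundled along a depth-first
   order; the bundles are assigned to the tours by rounding a fractional assignment, and at most
   one bundle per tour is lost. Afterwards, the load of a tour changes only O(1 / eps) times along
   a path to the root.

   Then the tours exchange their partial tours at certain checkpoints, by linear grouping in each
   bucket: each group of partial tours, filled up with new tokens to a common size, moves to the
   tours of the next larger group, and the largest group is dropped. Exchanging at every node would drop too much, as the height
   is of order ln^2 n / eps. With b of order ln n, all tours exchange at the depths divisible by
   b^2, and elsewhere a tour exchanges only close to the changes of its load. The nearest
   checkpoint above v is then among few nodes, so 2 g_1 + 4 b g_2 sizes per bucket suffice for
   groupings into g_1 and g_2 groups, and the dropped tokens are a fraction of order eps.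

   The dropped items are finally pooled in depth-first order into tours of about Q / 3 tokens,
   which are filled up to Q tokens where they are complete, so that they add few sizes. *)

(* The budget of about [2 * delta * ln n / eps ^ 2] sizes per bucket fixes the two scales. With a
   spacing [b] of order [ln n] it allows [g1] of order [ln n / eps ^ 2] and [g2] of order
   [1 / eps ^ 2]. A token passes about [h / b ^ 2], hence [O(1 / eps)], major checkpoints, and
   [O(1 / eps)] other exchanges because each change of the load is at least about [eps * Q / 6];
   this is what bundling the small items is for. The fractions dropped are then of order
   [eps / ln n] and [eps].

   A new tour enters the construction only through its coverage function. Any function that
   dominates, at each node, the picks there plus its values at the children is realised by adding
   tokens, so exchanging, dropping and filling up are all justified by this one local inequality.

   In the factor [1 + 4 * eps], one [eps] pays for dropped partial tours, one for bundles lost in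
   the rounding, and two for an additive constant of 10 tours per edge. The constant is affordable
   only where at least [5 / eps] tours cross, so sparse subtrees have to be exempted. *)
Require Import Defs.
From mathcomp Require Import all_boot all_order all_algebra.
From mathcomp Require Import boolp zify.

Set Implicit Arguments.
Unset Strict Implicit.
Unset Printing Implicit Defensive.

(** * Rooted trees *)

Section Tree.
Variables (V : finType) (par : V -> V) (r : V).
Hypotheses (par_r : par r = r) (reach : forall v, fconnect par v r).

Definition sub y x := fconnect par x y.
Definition dep v := findex par v r.
Definition child y c := (c != r) && (par c == y).

Lemma sub_refl y : sub y y. Proof. exact: connect0. Qed.

Lemma sub_trans y x z : sub z y -> sub y x -> sub z x.
Proof. by move=> zy yx; apply: connect_trans yx zy. Qed.

Lemma sub_root x : sub r x. Proof. exact: reach. Qed.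

Lemma sub_par x : sub (par x) x. Proof. exact: fconnect1. Qed.

Lemma sub_iter k x : sub (iter k par x) x. Proof. exact: fconnect_iter. Qed.

Lemma iter_r k : iter k par r = r.
Proof. by elim: k => //= k ->. Qed.

Lemma iter_dep v : iter (dep v) par v = r.
Proof. exact: iter_findex. Qed.

Lemma dep_r : dep r = 0. Proof. exact: findex0. Qed.

Lemma dep_min v k : iter k par v = r -> dep v <= k.
Proof.
move=> e; rewrite leqNgt; apply/negP => lt.
have := before_find => _.
have kO : k < order par v.
  by apply: ltn_trans lt _; apply: findex_max; exact: reach.
by have := findex_iter kO; rewrite e -/(dep v) => e'; rewrite e' ltnn in lt.
Qed.

Lemma dep_par x : x != r -> dep x = (dep (par x)).+1.
Proof.
move=> xr; apply/eqP; rewrite eqn_leq; apply/andP; split.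
  by apply: dep_min; rewrite iterSr iter_dep.
case e: (dep x) => [|k]; first by move: (iter_dep x) xr; rewrite e /= => ->; rewrite eqxx.
by rewrite ltnS; apply: dep_min; rewrite -iterSr -e iter_dep.
Qed.

Lemma dep0 x : dep x = 0 -> x = r.
Proof. by move=> e; have := iter_dep x; rewrite e. Qed.

Lemma sub_cases y x : sub y x -> y = x \/ x != r /\ sub y (par x).
Proof.
move/iter_findex; move: (findex par x y) => k <-{y}.
case: k => [|k]; first by left.
case: (eqVneq x r) => [->|xr]; first by rewrite iter_r; left.
by right; split=> //; rewrite iterSr; apply: sub_iter.
Qed.

Lemma sub_iterP y x : sub y x -> exists2 k, k <= dep x & y = iter k par x.
Proof.
elim: {x}(dep x) {-2}x (erefl (dep x)) => [|n IH] x ex.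
  move/dep0: ex => -> /sub_cases[->|[]]; last by rewrite eqxx.
  by exists 0.
move=> /sub_cases[->|[xr]]; first by exists 0.
have ep : dep (par x) = n by move: ex; rewrite (dep_par xr) => -[].
by move=> /(IH _ ep)[k kn ->]; exists k.+1; rewrite ?iterSr // (dep_par xr).
Qed.

Lemma dep_iter k x : dep (iter k par x) = dep x - k.
Proof.
elim: k => [|k IH]; first by rewrite subn0.
rewrite iterS; case: (eqVneq (iter k par x) r) => [e|ne].
  by rewrite e par_r dep_r; move: IH; rewrite e dep_r; lia.
by move: (dep_par ne); rewrite IH; lia.
Qed.

Lemma sub_dep y x : sub y x -> y = iter (dep x - dep y) par x /\ dep y <= dep x.
Proof.
case/sub_iterP => k kx ->; rewrite dep_iter; split; last lia.
by congr iter; lia.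
Qed.

Lemma sub_dep_eq y z x : sub y x -> sub z x -> dep y = dep z -> y = z.
Proof. by move=> /sub_dep[ey _] /sub_dep[ez _] e; rewrite ey e -ez. Qed.

Lemma sub_comp y z x : sub y x -> sub z x -> dep y <= dep z -> sub y z.
Proof.
move=> /sub_dep[ey _] /sub_dep[ez ?] le.
suff -> : y = iter (dep z - dep y) par z by apply: sub_iter.
rewrite ez -iterD {1}ey dep_iter; congr iter; lia.
Qed.

Lemma sub_anti y z : sub y z -> sub z y -> y = z.
Proof.
move=> yz zy; apply: (sub_dep_eq (x := z)) => //; first exact: sub_refl.
by have [_ ?] := sub_dep yz; have [_ ?] := sub_dep zy; lia.
Qed.

Lemma sub_strict y x : sub y x -> y != x -> x != r /\ sub y (par x).
Proof. by move=> /sub_cases[->|//]; rewrite eqxx. Qed.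

Lemma child_sub y c : child y c -> sub y c.
Proof. by case/andP=> _ /eqP <-; apply: sub_par. Qed.

Lemma child_dep y c : child y c -> dep c = (dep y).+1.
Proof. by case/andP=> cr /eqP <-; apply: dep_par. Qed.

Lemma child_uniq y c1 c2 x : child y c1 -> child y c2 -> sub c1 x -> sub c2 x -> c1 = c2.
Proof. by move=> /child_dep d1 /child_dep d2 s1 s2; apply: (sub_dep_eq s1 s2); rewrite d1 d2. Qed.

Lemma child_exists y x : sub y x -> y != x -> exists2 c, child y c & sub c x.
Proof.
elim: {x}(dep x) {-2}x (erefl (dep x)) => [|n IH] x ex yx ne.
  by move/dep0: ex => e; have [] := sub_strict yx ne; rewrite e eqxx.
have [xr ypx] := sub_strict yx ne.
case: (eqVneq y (par x)) => [e|ne'].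
  by exists x; [rewrite /child xr e eqxx | apply: sub_refl].
have ep : dep (par x) = n by move: ex; rewrite (dep_par xr) => -[].
have [c cy cx] := IH _ ep ypx ne'; exists c => //.
exact: sub_trans cx (sub_par x).
Qed.

Lemma child_nsub y c : child y c -> ~~ sub c y.
Proof.
move=> cy; apply/negP => /sub_dep[_]; rewrite (child_dep cy); lia.
Qed.

Lemma tree_ind (P : V -> Prop) :
  (forall y, (forall c, child y c -> P c) -> P y) -> forall y, P y.
Proof.
move=> H y; pose m := \max_v dep v.
elim: {y}(m - dep y) {-2}y (leqnn (m - dep y)) => [|n IH] y ly; apply: H => c cy.
  by have := leq_bigmax (F := dep) c; have := child_dep cy; rewrite -/m; lia.
apply: IH; have := leq_bigmax (F := dep) c; have := child_dep cy; rewrite -/m; lia.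
Qed.

Lemma up_ind (P : V -> Prop) : P r -> (forall y, y != r -> P (par y) -> P y) -> forall y, P y.
Proof.
move=> Pr IH y; elim: {y}(dep y) {-2}y (erefl (dep y)) => [|n IHn] y ey.
  by rewrite (dep0 ey).
case: (eqVneq y r) => [->//|yr]; apply: IH => //; apply: IHn.
by move: ey; rewrite (dep_par yr) => -[].
Qed.

(** A position strictly below [y] lies under exactly one child of [y]. The index type is kept apart
    from the nodes because most sums below run over items placed at nodes. *)
Lemma sum_subtree_dep (I : finType) (P : pred I) (l : I -> V) (F : I -> nat) y :
  \sum_(i | P i && sub y (l i)) F i =
  \sum_(i | P i && (l i == y)) F i +
  \sum_(c | child y c) \sum_(i | P i && sub c (l i)) F i.
Proof.
rewrite (bigID (fun i => l i == y)) /=; congr (_ + _).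
  apply: eq_bigl => i; case: eqP => [->|]; rewrite ?sub_refl ?andbT ?andbF //.
under [RHS]eq_bigr do rewrite big_mkcondr.
rewrite (exchange_big_dep P) //= [LHS](_ : _ = \sum_(i | P i) if sub y (l i) && (l i != y) then F i else 0); last first.
  by rewrite -big_mkcondr; apply: eq_bigl => i; rewrite andbA.
apply: eq_bigr => i Pi; rewrite -big_mkcondr /=.
case: ifP => [/andP[si ni]|].
  rewrite eq_sym in ni; have [c cy cl] := child_exists si ni.
  rewrite (bigD1 c) ?cy ?Pi ?cl //= big1 ?addn0 // => c' /andP[/andP[/andP[c'y _] c'l]].
  by rewrite (child_uniq c'y cy c'l cl) eqxx.
move=> nsi; rewrite big1 // => c /andP[/andP[cy _] cl]; move: nsi.
rewrite (sub_trans (child_sub cy) cl) /= => /negbFE/eqP e.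
by move: cl; rewrite e (negbTE (child_nsub cy)).
Qed.

Lemma sum_subtree (F : V -> nat) y :
  \sum_(u | sub y u) F u = F y + \sum_(c | child y c) \sum_(u | sub c u) F u.
Proof.
have := sum_subtree_dep predT id F y; rewrite /= => ->.
by congr (_ + _); rewrite (big_pred1 y).
Qed.

(** The hypothesis is the local inequality required of every coverage function; from the leaves
    upwards it adds up to the whole subtree. *)
Lemma sub_ge (q cov : V -> nat) y :
    (forall u, sub y u -> q u + \sum_(c | child u c) cov c <= cov u) ->
  \sum_(u | sub y u) q u <= cov y.
Proof.
elim/tree_ind: y => y IH H; rewrite sum_subtree.
apply: leq_trans (H y (sub_refl y)); rewrite leq_add2l.
apply: leq_sum => c cy; apply: IH => // u cu; apply: H.
exact: sub_trans (child_sub cy) cu.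
Qed.

(* The slack at each node is filled with new tokens. *)
Lemma pad_exact (q cov : V -> nat) :
    (forall u, q u + \sum_(c | child u c) cov c <= cov u) ->
  forall y,
  \sum_(u | sub y u) (q u + (cov u - (q u + \sum_(c | child u c) cov c))) = cov y.
Proof.
move=> H; elim/tree_ind => y IH; rewrite sum_subtree.
have -> : \sum_(c | child y c) \sum_(u | sub c u)
   (q u + (cov u - (q u + \sum_(c0 | child u c0) cov c0))) = \sum_(c | child y c) cov c.
  by apply: eq_bigr => c /IH.
by have := H y; lia.
Qed.

(** Take a deepest common ancestor [p]: the ancestors of a single [l i] form a chain, so all other
    common ancestors lie above [p]. *)
Lemma lca (I : finType) (P : pred I) (l : I -> V) (i0 : I) : P i0 ->
  exists p, forall y, sub y p = [forall (i | P i), sub y (l i)].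
Proof.
move=> Pi0; pose A := [pred y | [forall (i | P i), sub y (l i)]].
have Ar : A r by apply/forall_inP => i _; apply: sub_root.
case: (arg_maxnP dep Ar) => p Ap pmax; exists p => y.
apply/idP/idP => [yp|Ay].
  by apply/forall_inP => i Pi; apply: sub_trans yp _; exact: (forall_inP Ap).
apply: (@sub_comp _ _ (l i0)); [exact: (forall_inP Ay)|exact: (forall_inP Ap)|].
exact: pmax.
Qed.

End Tree.

(** * Pooling items in depth-first order *)

Section Blocks.
Variables (I : eqType) (a : I -> nat) (W : nat).
Hypothesis W0 : 0 < W.

(** Block [K] is the open one and stays below [W]. The item that brings it to [W] closes it; that
    item is itself below [W], whence the bound [2 * W.-1]. *)
Lemma greedy_blocks (s : seq I) : uniq s -> all (fun i => a i < W) s ->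
  exists (K : nat) (num : I -> nat),
  [/\ sorted (fun i j => num i <= num j) s,
      forall k, k < K -> W <= \sum_(i <- s | num i == k) a i,
      forall k, \sum_(i <- s | num i == k) a i <= 2 * W.-1,
      \sum_(i <- s | num i == K) a i <= W.-1
    & all (fun i => num i <= K) s].
Proof.
elim/last_ind: s => [|s x IH].
  by move=> _ _; exists 0, (fun=> 0); split=> // [k|]; rewrite big_nil.
rewrite rcons_uniq all_rcons => /andP[xs us] /andP[ax aS].
have [K [num [so ge le rest leK]]] := IH us aS.
pose num' := [eta num with x |-> K].
have num's i : i \in s -> num' i = num i.
  by move=> si; rewrite /= ; case: eqP si xs => // -> ->.
have num'x : num' x = K by rewrite /= eqxx.
move: num' num's num'x => num' num's num'x.
have sumE k : \sum_(i <- rcons s x | num' i == k) a i =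
    \sum_(i <- s | num i == k) a i + (if K == k then a x else 0).
  rewrite -cats1 big_cat /=; congr (_ + _); last first.
    by rewrite big_cons big_nil num'x; case: ifP => //; rewrite addn0.
  rewrite big_seq_cond [RHS]big_seq_cond; apply: eq_bigl => i.
  by case si : (i \in s) => //; rewrite num's.
have so' : sorted (fun i j => num' i <= num' j) (rcons s x).
  case: s so us aS xs leK num's {IH ge le rest sumE} => // y s /= so us aS xs leK num's.
  rewrite rcons_path; apply/andP; split.
    rewrite (@eq_in_path _ (mem (y :: s)) _ (fun i j => num i <= num j)) //.
      by move=> i j si sj; rewrite !num's.
    by apply/allP.
  have l : last y s \in y :: s by apply: mem_last.
  rewrite num'x (num's _ l); exact: (allP (leK : all (fun i => num i <= K) (y :: s))).
have all' : all (fun i => num' i <= K) (rcons s x).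
  rewrite all_rcons num'x leqnn /=; apply/allP => i si.
  by rewrite (num's _ si); apply: (allP leK).
case: (ltnP ((\sum_(i <- s | num i == K) a i) + a x) W) => lt.
  exists K, num'; split => //.
  - by move=> k kK; rewrite sumE; have := ge k kK; lia.
  - by move=> k; rewrite sumE; case: eqP => [<-|_]; [lia|have := le k; lia].
  - by rewrite sumE eqxx; lia.
exists K.+1, num'; split => //.
- move=> k; rewrite sumE ltnS leq_eqVlt; case: eqP => [->|_] /= kK; first by rewrite eqxx.
  by have := ge k kK; lia.
- by move=> k; rewrite sumE; case: eqP => [<-|_]; [lia|have := le k; lia].
- rewrite sumE; case: eqP => [|_]; first lia.
  rewrite addn0 big_seq_cond big1 // => i /andP[si /eqP e].
  by have := allP leK i si; rewrite e ltnn.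
- by apply: sub_all all' => i; apply: leqW.
Qed.
End Blocks.

Section Pool.
Variables (V : finType) (par : V -> V) (r : V).
Hypotheses (par_r : par r = r) (reach : forall v, fconnect par v r).
Notation sub := (sub par).
Notation dep := (dep par r).

(* Compared lexicographically, the paths from the root list the nodes in depth-first order. *)
Definition key (x : V) : seqlexi nat :=
  rev [seq nat_of_ord (enum_rank (iter k par x)) | k <- iota 0 (dep x).+1].

Lemma key_sub y x : sub y x -> exists t, key x = key y ++ t.
Proof.
move=> /(sub_dep par_r reach)[ey le]; rewrite /key.
have -> : (dep x).+1 = (dep x - dep y) + (dep y).+1 by lia.
rewrite iotaD map_cat rev_cat add0n.
set A := rev _; set B := rev _; set C := rev _.
suff -> : A = C by exists B.
rewrite /A /C; congr rev.
rewrite -{1}[dep x - dep y]addn0 iotaDl -map_comp; apply: eq_map => k /=.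
by rewrite addnC iterD -ey.
Qed.

Lemma key_prefix y x t : key x = key y ++ t -> sub y x.
Proof.
move=> e.
have : nat_of_ord (enum_rank y) \in key x.
  by rewrite e mem_cat /key mem_rev; apply/orP; left; rewrite /= mem_head.
rewrite /key mem_rev => /mapP[k _ /ord_inj/enum_rank_inj ->]; exact: sub_iter.
Qed.

(** Words with the prefix [w] form an interval of the lexicographic order; applied to paths from the
    root, this makes each subtree an interval of the depth-first order. *)
Lemma lexi_convex (w s t : seq nat) (z : seqlexi nat) :
    ((w ++ s : seqlexi nat) <= z)%O -> (z <= (w ++ t : seqlexi nat))%O ->
  exists u, z = w ++ u.
Proof.
elim: w z => [|c w IH] z; first by exists z.
case: z => [|d z] //.
rewrite /= !lexi_cons.
case/andP=> cd /implyP h1 /andP[dc /implyP h2].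
have e : c = d by apply: Order.POrderTheory.le_anti; rewrite cd dc.
have [u eu] := IH z (h1 dc) (h2 cd).
by exists u; rewrite e; congr (_ :: _).
Qed.

Lemma key_convex y x1 x2 x3 : sub y x1 -> sub y x3 ->
  (key x1 <= key x2)%O -> (key x2 <= key x3)%O -> sub y x2.
Proof.
move=> /key_sub[t1 e1] /key_sub[t3 e3]; rewrite e1 e3 => h1 h2.
by have [u /key_prefix] := lexi_convex h1 h2.
Qed.

(** Blocks and subtrees are both intervals of the depth-first order, so only the blocks of the first
    and of the last item inside [T_y] can also have items outside. [None] is the last, unfinished
    block. *)
Lemma pool (I : finType) (a : I -> nat) (loc : I -> V) (Z : pred I) (W : nat) :
    0 < W -> (forall i, Z i -> a i < W) ->
  exists (K : nat) (blk : I -> option 'I_K),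
  [/\ forall k, W <= \sum_(i | Z i && (blk i == Some k)) a i,
      forall k, \sum_(i | Z i && (blk i == k)) a i <= 2 * W.-1,
      \sum_(i | Z i && (blk i == None)) a i <= W.-1
    & forall y, exists k1 k2, forall i i', Z i -> Z i' -> blk i = blk i' ->
        sub y (loc i) -> ~~ sub y (loc i') -> blk i = k1 \/ blk i = k2].
Proof.
move=> W0 aW; pose leT i j := (key (loc i) <= key (loc j))%O.
have totT : total leT by move=> i j; apply: Order.TotalTheory.le_total.
have trT : transitive leT by move=> i j k; apply: Order.POrderTheory.le_trans.
pose s := sort leT (enum Z).
have sZ i : (i \in s) = Z i by rewrite mem_sort mem_enum.
have us : uniq s by rewrite sort_uniq enum_uniq.
have allW : all (fun i => a i < W) s by apply/allP => i; rewrite sZ => /aW.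
have [K [num [so ge le rest leK]]] := greedy_blocks W0 us allW.
have sumE P : \sum_(i <- s | P i) a i = \sum_(i | Z i && P i) a i.
  have -> : \sum_(i <- s | P i) a i = \sum_(i <- enum Z | P i) a i.
    by apply: perm_big; rewrite perm_sort.
  by rewrite big_enum_cond; apply: eq_bigl => i.
pose blk i : option 'I_K := insub (num i).
have blkS i (k : 'I_K) : (blk i == Some k) = (num i == k).
  rewrite /blk; case: insubP => [u lt e|ge'].
    by rewrite (inj_eq (@Some_inj _)) -val_eqE /= e.
  by rewrite /=; symmetry; apply/negbTE; apply: contra ge' => /eqP ->.
have blkN i : Z i -> (blk i == None) = (num i == K).
  rewrite -sZ => /(allP leK) li; rewrite /blk; case: insubP => [u lt e|ge'] /=.
    by symmetry; apply/negbTE; rewrite neq_ltn lt.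
  by symmetry; apply/eqP; rewrite -leqNgt in ge'; apply/eqP; rewrite eqn_leq li.
exists K, blk; split.
- move=> k; have := ge k (ltn_ord k); rewrite sumE.
  by congr (_ <= _); apply: eq_bigl => i; rewrite blkS.
- case=> [k|]; [have := le k | have := le K]; rewrite sumE;
  by congr (_ <= _); apply: eq_bigl => i; case Zi: (Z i) => //=; rewrite ?blkS ?blkN.
- by move: rest; rewrite sumE; congr (_ <= _); apply: eq_bigl => i; case Zi: (Z i) => //=; rewrite ?blkN.
move=> y; pose A := [pred i | Z i && sub y (loc i)].
case: (pickP A) => [i0 Ai0|A0]; last first.
  by exists None, None => i i' Zi _ _ si; have := A0 i; rewrite /= Zi si.
case: (arg_minnP (fun i => index i s) Ai0) => i1 /andP[Zi1 si1] min1.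
case: (arg_maxnP (fun i => index i s) Ai0) => i2 /andP[Zi2 si2] max2.
have mono i j : Z i -> Z j -> index i s <= index j s -> num i <= num j.
  move=> Zi Zj; rewrite leq_eqVlt => /orP[/eqP e|lt].
    by rewrite (_ : i = j) //; apply: (@index_inj _ i s); rewrite ?sZ.
  have tr : transitive (fun i j => num i <= num j) by move=> ? ? ?; apply: leq_trans.
  by apply: (sorted_ltn_index tr so); rewrite ?sZ.
have monoT i j : Z i -> Z j -> index i s <= index j s -> leT i j.
  move=> Zi Zj; rewrite leq_eqVlt => /orP[/eqP e|lt].
    rewrite (_ : i = j); first exact: Order.POrderTheory.lexx.
    by apply: (@index_inj _ i s); rewrite ?sZ.
  have so2 : sorted leT s := sort_sorted totT _.
  by apply: (sorted_ltn_index trT so2); rewrite ?sZ.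
exists (blk i1), (blk i2) => i i' Zi Zi' ebl si nsi'.
have enum' : num i = num i'.
  case e: (blk i) => [k|]; move: (e); rewrite ebl => e'; move/eqP: e; move/eqP: e'.
    by rewrite !blkS => /eqP -> /eqP ->.
  by rewrite !blkN // => /eqP -> /eqP ->.
have m1 : index i1 s <= index i s by apply: min1; rewrite /= Zi si.
have m2 : index i s <= index i2 s by apply: max2; rewrite /= Zi si.
(* Block numbers are monotone, so [i1] is squeezed between [i'] and [i], which share a block; the
   case of [i2] is symmetric. An [i'] between [i1] and [i2] would lie in the subtree. *)
case: (leqP (index i' s) (index i1 s)) => l1.
  left; rewrite /blk; congr insub; apply/eqP; rewrite eqn_leq [X in _ && X]mono // andbT.
  by rewrite enum' mono.
case: (leqP (index i2 s) (index i' s)) => l2.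
  right; rewrite /blk; congr insub; apply/eqP; rewrite eqn_leq mono //=.
  by rewrite enum' mono.
case/negP: nsi'; apply: (key_convex si1 si2); apply: monoT => //; exact: ltnW.
Qed.

End Pool.

(** * Rounding fractional assignments *)

Section Hall.
Variables (X Y : finType) (e : X -> Y -> bool).

Definition nbh (B : {set Y}) (A : {set X}) : {set Y} :=
  [set y in B | [exists x in A, e x y]].

(** Hall's theorem by the induction of Halmos and Vaughan: a proper nonempty subset with no more
    neighbours than elements splits the problem into two; if there is none, any edge may be fixed.
    The sets [A0] and [B0] make the statement inductive. *)
Lemma hall_set (A0 : {set X}) (B0 : {set Y}) :
    (forall A : {set X}, A \subset A0 -> #|A| <= #|nbh B0 A|) ->
  exists f : X -> option Y,
    (forall x, x \in A0 -> exists2 y, f x = Some y & (y \in B0) && e x y) /\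
    {in A0 &, injective f}.
Proof.
elim: {A0}#|A0| {-2}A0 (leqnn #|A0|) B0 => [|n IH] A0.
  rewrite leqn0 cards_eq0 => /eqP -> B0 _.
  by exists (fun=> None); split=> [x|x y]; rewrite inE.
move=> leA B0 H.
case: (set_0Vmem A0) => [->|[x0 x0A]].
  by exists (fun=> None); split=> [x|x y]; rewrite inE.
case: (boolP [exists A1 : {set X},
    [&& A1 \proper A0, A1 != set0 & #|nbh B0 A1| <= #|A1|]]).
  case/existsP=> A1 /and3P[pA1 nz leN].
  have sA1 := proper_sub pA1; have cA1 := proper_card pA1.
  have nbS B A : nbh B A \subset B by apply/subsetP => y; rewrite inE => /andP[].
  have nb1 (A : {set X}) : A \subset A1 -> nbh (nbh B0 A1) A = nbh B0 A.
    move=> sA; apply/setP => y; rewrite !inE; case: (y \in B0) => //=.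
    apply: andb_idl => /exists_inP[x xA exy]; apply/exists_inP; exists x => //.
    exact: (subsetP sA).
  have nb2 (A : {set X}) : nbh B0 (A :|: A1) \subset nbh (B0 :\: nbh B0 A1) A :|: nbh B0 A1.
    apply/subsetP => y; rewrite !inE => /andP[-> /exists_inP[x]]; rewrite inE !andbT /=.
    case: [exists x0 in A1, _] / exists_inP => [//|N] /=; rewrite ?orbT ?orbF //.
    case/orP=> [xA exy|xA exy]; first by apply/exists_inP; exists x.
    by case: N; exists x.
  have [|A sA|f1 [f1P f1I]] := IH A1 _ (nbh B0 A1); first lia.
    by rewrite nb1 //; apply: H; apply: subset_trans sA sA1.
  have [|A sA|f2 [f2P f2I]] := IH (A0 :\: A1) _ (B0 :\: nbh B0 A1).
  - have := cardsID A1 A0; rewrite (setIidPr sA1); move: nz; rewrite -card_gt0; lia.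
  - have := subset_leq_card (nb2 A).
    have dA : [disjoint A & A1].
      rewrite disjoint_subset; apply/subsetP => x /(subsetP sA).
      by rewrite !inE => /andP[].
    have := H (A :|: A1); rewrite cardsU (disjoint_setI0 dA) cards0 subn0.
    have -> : A :|: A1 \subset A0.
      by rewrite subUset sA1 andbT (subset_trans sA) // subsetDl.
    move=> /(_ isT) h1 h2.
    have [h3 _] := leq_card_setU (nbh (B0 :\: nbh B0 A1) A) (nbh B0 A1); lia.
  exists (fun x => if x \in A1 then f1 x else f2 x); split=> [x xA|x x' xA x'A].
    case: ifP => xA1.
      have [y fy /andP[yN exy]] := f1P x xA1; exists y; rewrite // exy andbT.
      by move: yN; rewrite inE => /andP[].
    have [|y fy /andP[yN exy]] := f2P x; first by rewrite inE xA1.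
    by exists y; rewrite // exy andbT; move: yN; rewrite inE => /andP[].
  case: ifP => xA1; case: ifP => x'A1.
  - exact: f1I.
  - have [y -> /andP[yN _]] := f1P x xA1; have [|y' -> /andP[]] := f2P x'; first by rewrite inE x'A1.
    by rewrite inE => /andP[+ _] _ [e1]; rewrite -e1 yN.
  - have [y' -> /andP[yN _]] := f1P x' x'A1; have [|y -> /andP[]] := f2P x; first by rewrite inE xA1.
    by rewrite inE => /andP[+ _] _ [e1]; rewrite e1 yN.
  - by apply: f2I; rewrite inE ?xA1 ?x'A1.
move/existsPn=> strict.
have sx : [set x0] \subset A0 by rewrite sub1set.
have := H _ sx; rewrite cards1 card_gt0 => /set0Pn[y0].
rewrite inE => /andP[y0B /exists_inP[x]]; rewrite inE => /eqP -> {x} e0.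
have [|A sA|f [fP fI]] := IH (A0 :\ x0) _ (B0 :\ y0).
- by have := cardsD1 x0 A0; rewrite x0A; lia.
- case: (set_0Vmem A) => [->|[x xA]]; first by rewrite cards0.
  have pA : A \proper A0 by apply: sub_proper_trans sA _; apply: properD1.
  have nzA : A != set0 by apply/set0Pn; exists x.
  have := strict A; rewrite pA nzA /= -ltnNge => lt.
  have -> : nbh (B0 :\ y0) A = nbh B0 A :\ y0.
    by apply/setP => y; rewrite !inE andbA.
  by have := cardsD1 y0 (nbh B0 A); move: lt; case: (_ \in _); lia.
exists (fun x => if x == x0 then Some y0 else f x); split=> [x xA|x x' xA x'A].
  case: eqP => [->|/eqP ne]; first by exists y0; rewrite // y0B.
  have [|y fy /andP[yB exy]] := fP x; first by rewrite !inE ne.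
  by exists y; rewrite // exy andbT; move: yB; rewrite inE => /andP[].
case: eqP => [->|/eqP ne]; case: eqP => [->//|/eqP ne'].
- have [|y -> /andP[yB _]] := fP x'; first by rewrite !inE ne'.
  by move=> [e1]; move: yB; rewrite e1 !inE eqxx.
- have [|y -> /andP[yB _]] := fP x; first by rewrite !inE ne.
  by move=> [e1]; move: yB; rewrite e1 !inE eqxx.
- by apply: fI; rewrite !inE ?ne ?ne'.
Qed.

End Hall.

(** Hall's condition follows by counting the weight between [A] and its neighbours by rows and by
    columns. *)
Lemma fractional_matching (X Y : finType) (w : X -> Y -> nat) (D : nat) :
    0 < D -> (forall x, \sum_y w x y = D) -> (forall y, \sum_x w x y <= D) ->
  exists2 f : X -> Y, (forall x, 0 < w x (f x)) & injective f.
Proof.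
move=> D0 row col.
have [|f [fP fI]] := @hall_set X Y (fun x y => 0 < w x y) setT setT.
  move=> A _; rewrite -(leq_pmul2r D0) -sum_nat_const -sum_nat_const.
  rewrite -(eq_bigr _ (fun x _ => row x)).
  apply: (@leq_trans (\sum_(y in nbh (fun x y => 0 < w x y) setT A) \sum_x w x y)); last exact: leq_sum.
  rewrite exchange_big [X in _ <= X]big_mkcond /=; apply: leq_sum => y _.
  case: ifP => yN; first by rewrite [X in _ <= X](bigID (mem A)) /= leq_addr.
  rewrite big1 // => x xA; apply/eqP; rewrite -leqn0 leqNgt; apply/negP => w0.
  by move/negP: yN; apply; rewrite !inE /=; apply/exists_inP; exists x.
have f' x : {y | f x = Some y & 0 < w x y}.
  case e: (f x) => [y|]; last by exfalso; have [y] := fP x (in_setT x); rewrite e.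
  by exists y => //; have [y'] := fP x (in_setT x); rewrite e => -[->] /andP[].
exists (fun x => s2val (f' x)) => [x|x x' exx]; first exact: s2valP' (f' x).
apply: fI; rewrite ?in_setT //.
by rewrite (s2valP (f' x)) exx -(s2valP (f' x')).
Qed.

Lemma sum_count_mem_fin (X : finType) (s : seq X) (F : X -> nat) :
  \sum_x count_mem x s * F x = \sum_(x <- s) F x.
Proof.
elim: s => [|y s IH]; first by rewrite big_nil big1.
rewrite big_cons -IH (bigD1 y) //= [in RHS](bigD1 y) //= eqxx.
rewrite (eq_bigr (fun x => count_mem x s * F x)); last first.
  by move=> x /negbTE; rewrite eq_sym => ->.
by rewrite mulnDl mul1n addnA.
Qed.

Lemma sum_count_chunk (T : Type) (p : pred T) (D M : nat) (s : seq T) :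
  \sum_(k < M) count p (take D (drop (k * D) s)) = count p (take (M * D) s).
Proof.
elim: M => [|M IH]; first by rewrite big_ord0 take0.
by rewrite big_ord_recr /= IH mulSnr takeD count_cat.
Qed.

Lemma sum_chunk (T : Type) (F : T -> nat) (D M : nat) (s : seq T) :
  \sum_(k < M) \sum_(x <- take D (drop (k * D) s)) F x = \sum_(x <- take (M * D) s) F x.
Proof.
elim: M => [|M IH]; first by rewrite big_ord0 take0 big_nil.
by rewrite big_ord_recr /= IH mulSnr takeD big_cat.
Qed.

Lemma leq_sum_inj (X Y : finType) (P : pred X) (phi : X -> Y) (G : Y -> nat) :
  {in P &, injective phi} -> \sum_(x | P x) G (phi x) <= \sum_y G y.
Proof.
move=> inj; rewrite -(big_imset G (h := phi) (A := P)) //=.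
by rewrite [X in _ <= X](bigID (mem (phi @: P))) /= leq_addr.
Qed.

(* The rounding of Shmoys and Tardos for generalized assignment: each machine lists its shares of
   jobs by decreasing size and cuts the list into unit slots; the job matched to a slot is no
   larger than any job of the preceding slot. *)
Lemma rounded_assignment (X Y : finType) (m : X -> Y -> nat) :
    (forall x, 0 < \sum_y m x y) ->
  exists (h : X -> Y) (dr : pred X),
  [/\ forall x, 0 < m x (h x),
      forall x x', dr x -> dr x' -> h x = h x' -> x = x'
    & forall y, \sum_(x | (h x == y) && ~~ dr x) \sum_z m x z <= \sum_x m x y].
Proof.
(* [D] is a common multiple of the job sizes [b x], so the fractional shares [m x y / b x] become
   integers [c x y] out of [D], and a unit slot is a run of [D] entries of the list [l y]. *)
move=> pos; pose b x := \sum_y m x y; pose D := \prod_x b x.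
have D0 : 0 < D by rewrite prodn_gt0.
have bD x : D %/ b x * b x = D by rewrite divnK // /D (bigD1 x) //= dvdn_mulr.
pose c x y := m x y * (D %/ b x).
have cb x y : c x y * b x = m x y * D by rewrite /c -mulnA bD.
have rowc x : \sum_y c x y = D by rewrite -big_distrl /= mulnC bD.
pose leT x y := b y <= b x.
have totT : total leT by move=> x y; rewrite /leT leq_total.
have trT : transitive leT by move=> x y z; rewrite /leT => ? /leq_trans; apply.
pose l y := sort leT (flatten [seq nseq (c x y) x | x <- enum X]).
have cnt x y : count_mem x (l y) = c x y.
  rewrite /l (permP (_ : perm_eq _ (flatten [seq nseq (c x y) x | x <- enum X]))); last by rewrite perm_sort.
  rewrite count_flatten -map_comp sumnE big_map big_enum /= (bigD1 x) //= count_nseq /= eqxx mul1n.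
  by rewrite big1 ?addn0 // => x' /negbTE ne; rewrite /= count_nseq /= ne.
have sl y : sorted leT (l y) := sort_sorted totT _.
have szl y : size (l y) <= #|X| * D.
  rewrite -sum1_size -(sum_count_mem_fin (l y) (fun=> 1)) -sum_nat_const.
  by apply: leq_sum => x _; rewrite muln1 cnt -(rowc x) (bigD1 y) //= leq_addr.
pose w x (ys : Y * 'I_#|X|) := count_mem x (take D (drop (ys.2 * D) (l ys.1))).
have [x|ys|F Fw Finj] := @fractional_matching X (Y * 'I_#|X|)%type w D D0.
- rewrite -(rowc x) -(pair_bigA _ (fun y (s : 'I_#|X|) => w x (y, s))) /=.
  apply: eq_bigr => y _; rewrite -[RHS]cnt -(take_oversize (szl y)) -sum_count_chunk.
  exact: eq_bigr.
- rewrite (eq_bigr (fun x => w x ys * 1)); last by move=> x _; rewrite muln1.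
  rewrite sum_count_mem_fin sum1_size size_take_min geq_minl //.
(* A job matched to slot 0 has no preceding slot to be charged to; these are the dropped jobs, one
   per machine at most. *)
exists (fun x => (F x).1), (fun x => (F x).2 == 0 :> nat); split.
- move=> x; have := Fw x; rewrite /w -has_count => /hasP[y]; move/mem_take/mem_drop.
  move=> yl /eqP e; subst y; move: yl; rewrite -has_pred1 has_count cnt /c.
  by case: (m x _).
- move=> x x' /eqP e /eqP e' e1; apply: Finj; move: e e' e1.
  by case: (F x) (F x') => [y s] [y' s'] /= e e' ->; congr (_, _); apply: val_inj; rewrite /= e e'.
move=> y; rewrite -(leq_pmul2l D0).
pose P := [pred x | ((F x).1 == y) && ((F x).2 != 0 :> nat)].
pose prev x : 'I_#|X| := insubd (F x).2 (F x).2.-1.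
have prevE x : prev x = (F x).2.-1 :> nat.
  by rewrite /prev val_insubd; case: ifP => // /negbT; have := ltn_ord (F x).2; lia.
(* The preceding slot is full, and its [D] entries come before an entry of [x] in the sorted
   list. *)
have key x : P x -> D * b x <= \sum_(z <- take D (drop (prev x * D) (l y))) b z.
  case/andP=> /eqP e1 s0; have := Fw x; rewrite /w -has_count e1 => /hasP[z].
  move=> zin /eqP ez; subst z; move/mem_take: zin => xin.
  have eS : (F x).2 * D = prev x * D + D by rewrite prevE -mulSnr prednK // lt0n.
  have szp : prev x * D + D <= size (l y).
    by rewrite leqNgt -eS; apply/negP => lt; move: xin; rewrite drop_oversize // ltnW.
  set ch := take D _.
  have szch : size ch = D by rewrite size_takel // size_drop; lia.
  rewrite -{1}szch -sum1_size big_distrl /= big_seq [X in _ <= X]big_seq.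
  apply: leq_sum => z zch; rewrite mul1n.
  move: (sl y); rewrite sorted_pairwise // -(cat_take_drop ((F x).2 * D) (l y)) pairwise_cat.
  case/and3P=> /allrelP ar _ _; apply: (ar z x) => //.
  by move: zch; rewrite /ch take_drop => /mem_drop; rewrite addnC eS.
apply: (@leq_trans (\sum_(x | P x) \sum_(z <- take D (drop (prev x * D) (l y))) b z)).
  rewrite big_distrr /=; exact: leq_sum key.
apply: (@leq_trans (\sum_(k < #|X|) \sum_(z <- take D (drop (k * D) (l y))) b z)).
  apply: (leq_sum_inj (phi := prev) (fun k : 'I_#|X| => \sum_(z <- take D (drop (k * D) (l y))) b z)).
  move=> x x' /andP[/eqP e1 s0] /andP[/eqP e1' s0'] epr; apply: Finj.
  have := congr1 val epr; rewrite /= !prevE => es.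
  move: e1 s0 e1' s0' es; case: (F x) (F x') => [z s] [z' s'] /= -> h -> h' es.
  by congr (_, _); apply: val_inj => /=; lia.
rewrite sum_chunk take_oversize // -sum_count_mem_fin.
rewrite big_distrr /= leq_eqVlt; apply/orP; left; apply/eqP.
by apply: eq_bigr => x _; rewrite cnt cb mulnC.
Qed.

(** * Regrouping at two scales *)

(** In increasing order of size, the groups are runs of [q = #|A| %/ gam] elements, [up] is the
    shift by [q] places and the last [q] elements are dropped. For [q > 0] there are at most
    [2 * gam] groups, since [#|A| < gam * (q + 1)]; for [q = 0] there are fewer than [gam] elements,
    and all can stay as they are. *)
Lemma linear_grouping (T : finType) (A : {set T}) (sz : T -> nat) (gam : nat) :
    0 < gam ->
  exists (up : T -> option T) (val : T -> nat) (vs : seq nat),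
  [/\ size vs <= 2 * gam,
      forall x, x \in A -> [/\ val x \in vs, sz x <= val x & exists2 y, y \in A & val x = sz y],
      forall x y, x \in A -> up x = Some y -> y \in A /\ val x <= sz y,
      forall x x' y, x \in A -> x' \in A -> up x = Some y -> up x' = Some y -> x = x'
    & gam * #|[set x in A | up x == None]| <= #|A|].
Proof.
move=> g0; case: (set_0Vmem A) => [->|[x0 x0A]].
  exists (fun=> None), (fun=> 0), [::]; split=> // [x|]; first by rewrite inE.
  by rewrite (_ : [set _ in _ | _] = set0) ?cards0 ?muln0 //; apply/setP => x; rewrite !inE.
pose leT x y := sz x <= sz y.
have totT : total leT by move=> x y; rewrite /leT leq_total.
have trT : transitive leT by move=> x y z; apply: leq_trans.
pose s := sort leT (enum A).
have sA x : (x \in s) = (x \in A) by rewrite mem_sort mem_enum.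
have szs : size s = #|A| by rewrite size_sort -cardE.
have us : uniq s by rewrite sort_uniq enum_uniq.
have ss : sorted leT s := sort_sorted totT _.
pose nt := nth x0 s; pose k := #|A|; pose q := k %/ gam.
have mono i j : i <= j -> j < k -> sz (nt i) <= sz (nt j).
  move=> ij jk; apply: (sorted_leq_nth trT _ _ ss) => //; rewrite ?inE ?szs ?(leq_ltn_trans ij) //.
  by move=> x; rewrite /leT.
have idx x : x \in A -> index x s < k by rewrite -sA -index_mem szs.
have ntI x : x \in A -> nt (index x s) = x by move=> xA; rewrite /nt nth_index ?sA.
have ntA i : i < k -> nt i \in A by move=> ik; rewrite -sA mem_nth ?szs.
case: (posnP q) => [q0|q0].
  exists Some, sz, (map sz s); split=> //.
  - rewrite size_map szs; move: q0; rewrite /q => /eqP; rewrite -leqn0 leqNgt divn_gt0 // -/k; lia.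
  - by move=> x xA; split=> //; [apply: map_f; rewrite sA | exists x].
  - by move=> x y xA [<-].
  - by move=> x x' y _ _ [->] [].
  - by rewrite (_ : [set _ in _ | _] = set0) ?cards0 ?muln0 //; apply/setP => x; rewrite !inE andbF.
(* The last group may be incomplete, hence the minimum. *)
pose top j := minn (q * j + q.-1) k.-1.
have k0 : 0 < k by apply/card_gt0P; exists x0.
have topk j : top j < k by rewrite /top; lia.
exists (fun x => if index x s + q < k then Some (nt (index x s + q)) else None),
  (fun x => sz (nt (top (index x s %/ q)))),
  [seq sz (nt (top j)) | j <- iota 0 (2 * gam)]; split.
- by rewrite size_map size_iota.
- move=> x xA; have ix := idx x xA; split.
  + apply/mapP; exists (index x s %/ q) => //; rewrite mem_iota add0n /= ltn_divLR //.
    apply: leq_trans ix _; have := ltn_ceil k g0; rewrite -/q; nia.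
  + rewrite -{1}(ntI x xA); apply: mono => //; rewrite /top leq_min; apply/andP; split; last lia.
    have := divn_eq (index x s) q; have := ltn_pmod (index x s) q0; lia.
  + by exists (nt (top (index x s %/ q))) => //; apply: ntA.
- move=> x y xA; case: ifP => // lt [<-]; split; first exact: ntA.
  by apply: mono => //; rewrite /top; have := leq_trunc_div (index x s) q; lia.
- move=> x x' y xA x'A; case: ifP => // lt [<-]; case: ifP => // lt' [/eqP].
  rewrite nth_uniq ?szs // => /eqP e.
  by rewrite -(ntI x xA) -(ntI x' x'A); congr nt; lia.
apply: (@leq_trans (gam * q)); last by rewrite mulnC leq_trunc_div.
rewrite leq_mul2l; apply/orP; right.
have szd : size (drop (k - q) s) = q.
  by rewrite size_drop szs -/k subKn // /q leq_div.
rewrite -[X in _ <= X]szd; apply: leq_trans (card_size _); apply: subset_leq_card; apply/subsetP => x.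
rewrite !inE; case/andP=> xA; case: ifP => // nlt _.
have -> : x = nth x0 (drop (k - q) s) (index x s - (k - q)).
  by rewrite nth_drop -{1}(ntI x xA); congr nth; have := idx x xA; lia.
rewrite mem_nth // size_drop szs -/k; have := idx x xA; lia.
Qed.

Lemma sum_jumps (f : nat -> nat) (U m : nat) :
    (forall j, f j != f j.+1 -> f j + U <= f j.+1) ->
  \sum_(j < m) (f j != f j.+1) * U + f 0 <= f m.
Proof.
move=> H; elim: m => [|m IH]; first by rewrite big_ord0.
rewrite big_ord_recr /=; have := H m; case: eqP => [<- _|_ /(_ isT) le] /=.
  by rewrite mul0n addn0.
by rewrite mul1n addnAC; apply: leq_trans le; rewrite leq_add2r.
Qed.

(** * Exchanging partial tours at checkpoints *)

Section Regroup.
Variables (V : finType) (par : V -> V) (r : V).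
Hypotheses (par_r : par r = r) (reach : forall v, fconnect par v r).
Notation sub := (sub par).
Notation dep := (dep par r).
Notation child := (child par r).

Variables (X Tt : finType) (kp : pred X) (b : X -> nat) (lc : X -> V) (te : X -> Tt).
Variables (U Q bb g1 g2 K0 : nat) (beta : nat -> nat).
Hypotheses (U0 : 0 < U) (kpU : forall e, kp e -> U <= b e).
Hypotheses (bb0 : 0 < bb) (g10 : 0 < g1) (g20 : 0 < g2).

Definition load t y := \sum_(e | (kp e && (te e == t)) && sub y (lc e)) b e.

Hypothesis loadQ : forall t, load t r <= Q.
Hypothesis betaK : forall x y, 0 < x <= Q -> 0 < y <= Q -> beta x = beta y -> y <= K0 * x.

Lemma load_mono t y z : sub z y -> load t y <= load t z.
Proof.
move=> zy; rewrite /load [X in _ <= X]big_mkcond [X in X <= _]big_mkcond; apply: leq_sum => e _.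
case: (kp e && _) => //=; case ye: (sub y (lc e)) => //.
by rewrite (sub_trans zy ye).
Qed.

Lemma load_le t y : load t y <= Q.
Proof. exact: leq_trans (load_mono t (sub_root reach y)) (loadQ t). Qed.

(** The load differs only if some kept item lies in [T_z] outside [T_y], and such an item has size
    at least [U]. *)
Lemma load_jump t y z : sub z y -> load t y != load t z -> load t y + U <= load t z.
Proof.
move=> zy ne.
case: (pickP [pred e | (kp e && (te e == t)) && (sub z (lc e) && ~~ sub y (lc e))]) => [e|no].
  case/andP=> /andP[ke te_e] /andP[ze nye].
  rewrite {2}/load (bigID (fun e => sub y (lc e))) /=; apply: leq_add.
    rewrite /load leq_eqVlt; apply/orP; left; apply/eqP; apply: eq_bigl => e'.
    case: (kp e' && _) => //=; case ye: (sub y (lc e')); rewrite ?andbF //.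
    by rewrite (sub_trans zy ye).
  rewrite (bigD1 e) /= ?ke ?te_e ?ze ?nye //; apply: leq_trans (leq_addr _ _); exact: kpU.
case/eqP: ne; apply: eq_bigl => e; have := no e => /=.
case: (kp e && _) => //=; case ye: (sub y (lc e)); first by rewrite (sub_trans zy ye).
by rewrite andbT => ->.
Qed.

Lemma load_children t y :
  load t y = \sum_(e | (kp e && (te e == t)) && (lc e == y)) b e + \sum_(c | child y c) load t c.
Proof. exact: (sum_subtree_dep par_r reach). Qed.

Definition major z := bb * bb %| dep z.

(* The nodes at which the partial tour of [t] is exchanged, at two scales of checkpoints: if tours
   exchanged only where the load changes, the exchange next above a node could be at any of too
   many ancestors, and exchanging at every node would lose too many tokens. *)
Definition reg t z := (0 < load t z) &&
  (major z || (if bb %| dep z then load t (iter bb par z) != load t z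
               else load t (par z) != load t z)).

(** The next exchange above a node can be at one major node or at up to [2 * (bb - 1)] others, so
    for the same number of sizes the grouping at major nodes can be much finer. *)
Definition gam z := if major z then g1 else g2.

Lemma gam0 z : 0 < gam z. Proof. by rewrite /gam; case: ifP. Qed.

Lemma reg_r t : 0 < load t r -> reg t r.
Proof. by move=> s0; rewrite /reg s0 /major dep_r dvdn0. Qed.

Lemma reg_load t z : reg t z -> 0 < load t z. Proof. by case/andP. Qed.

Lemma iter_sub k j y : j <= k -> sub (iter k par y) (iter j par y).
Proof. by move=> jk; rewrite -(subnK jk) iterD; apply: sub_iter. Qed.

(** The load is monotone along the path, so equality with the ancestor [bb] levels up includes
    equality with the parent. *)
Lemma nreg_load t y : 0 < load t y -> ~~ reg t y -> load t (par y) = load t y.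
Proof.
rewrite /reg => ->; rewrite /= negb_or => /andP[_].
case: ifP => _ /negPn/eqP // e; apply/eqP; rewrite eqn_leq (load_mono _ (sub_par _ _)) andbT -e.
exact: load_mono (@iter_sub bb 1 y bb0).
Qed.

(** Linear grouping is applied separately at each node and in each class of [beta]. Sizes in one
    class differ by at most the factor [K0], so a bound on the number of dropped partial tours is
    also one on their tokens. *)
Lemma regroup_maps : exists (up : V -> Tt -> option Tt) (val : V -> Tt -> nat)
    (vs : V -> nat -> seq nat),
  [/\ forall z i, size (vs z i) <= 2 * gam z,
      forall z t, reg t z -> [/\ val z t \in vs z (beta (val z t)), load t z <= val z t & val z t <= Q],
      forall z t a, reg t z -> up z t = Some a -> reg a z /\ val z t <= load a z,
      forall z t t' a, reg t z -> reg t' z -> up z t = Some a -> up z t' = Some a -> t = t'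
    & forall z, gam z * \sum_(t | reg t z && (up z t == None)) val z t
        <= K0 * \sum_(t | reg t z) load t z].
Proof.
pose A z i := [set t | reg t z && (beta (load t z) == i)].
pose GP (zi : V * nat) (g : (Tt -> option Tt) * (Tt -> nat) * seq nat) :=
  let A := A zi.1 zi.2 in let sz t := load t zi.1 in
  let up := g.1.1 in let val := g.1.2 in
  [/\ size g.2 <= 2 * gam zi.1,
      forall x, x \in A -> [/\ val x \in g.2, sz x <= val x & exists2 y, y \in A & val x = sz y],
      forall x y, x \in A -> up x = Some y -> y \in A /\ val x <= sz y,
      forall x x' y, x \in A -> x' \in A -> up x = Some y -> up x' = Some y -> x = x'
    & gam zi.1 * #|[set x in A | up x == None]| <= #|A|].
have [g gP] : {g & forall zi, GP zi (g zi)}.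
  apply: choice => -[z i].
  have [up [val [vs H]]] := linear_grouping (A z i) (fun t => load t z) (gam0 z).
  by exists (up, val, vs).
pose cl z t := (z, beta (load t z)).
have inA z t : reg t z -> t \in A z (beta (load t z)) by move=> rt; rewrite inE rt eqxx.
exists (fun z t => (g (cl z t)).1.1 t), (fun z t => (g (cl z t)).1.2 t), (fun z i => (g (z, i)).2); split.
- by move=> z i; have [] := gP (z, i).
- move=> z t rt; have [_ H _ _ _] := gP (cl z t).
  have [h1 h2 [y yA h3]] := H t (inA _ _ rt); split => //; last by rewrite h3 load_le.
  by move: yA; rewrite inE => /andP[_ /eqP]; rewrite /= {2}h3 => ->.
- move=> z t a rt ea; have [_ _ H _ _] := gP (cl z t).
  by have [] := H t a (inA _ _ rt) ea; rewrite inE => /andP[].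
- move=> z t t' a rt rt' et et'.
  have [_ _ H I _] := gP (cl z t); have [_ _ H' _ _] := gP (cl z t').
  have [] := H t a (inA _ _ rt) et; rewrite inE => /andP[_ /eqP e1] _.
  have [] := H' t' a (inA _ _ rt') et'; rewrite inE => /andP[_ /eqP e2] _.
  have cE : cl z t' = cl z t by rewrite /cl; congr pair; exact: (etrans (esym e2) e1).
  apply: (I t t' a) => //; first exact: inA; last by rewrite -cE.
  by rewrite -cE; apply: inA.
move=> z; pose M := (\max_t beta (load t z)).+1.
have part (P : pred Tt) F : \sum_(t | P t) F t = \sum_(i < M) \sum_(t | P t && (beta (load t z) == i)) F t.
  rewrite (partition_big (fun t => inord (beta (load t z)) : 'I_M) predT) //=.
  apply: eq_bigr => i _; apply: eq_bigl => t; congr (_ && _).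
  by rewrite -val_eqE /= inordK // ltnS (leq_bigmax (F := fun t => beta (load t z))).
rewrite part [X in _ <= _ * X]part !big_distrr /=; apply: leq_sum => i _.
have [_ H _ _ cd] := gP (z, i : nat).
pose mx := \max_(t in A z i) (g (z, i : nat)).1.2 t.
have mxK t : t \in A z i -> mx <= K0 * load t z.
  move=> tA; apply/bigmax_leqP => t' /H[_ _ [y yA ->]].
  move: tA yA; rewrite !inE => /andP[rt /eqP bt] /andP[ry /eqP by_].
  by apply: betaK; rewrite ?load_le ?andbT ?(reg_load rt) ?(reg_load ry) // bt.
apply: (@leq_trans (gam z * (#|[set x in A z i | (g (z, i : nat)).1.1 x == None]| * mx))).
  rewrite leq_mul2l; apply/orP; right.
  rewrite -sum_nat_const [X in X <= _]big_mkcond [X in _ <= X]big_mkcond; apply: leq_sum => t _.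
  case: ifP => //; case/andP=> /andP[rt un] /eqP bt.
  rewrite !inE rt bt eqxx /=; move: un; rewrite /cl bt => ->.
  by apply: leq_bigmax_cond; rewrite inE rt bt eqxx.
rewrite mulnA; apply: leq_trans (leq_mul cd (leqnn mx)) _.
rewrite -sum_nat_const big_distrr /= [X in X <= _]big_mkcond [X in _ <= X]big_mkcond.
apply: leq_sum => t _; case tA: (t \in A z i) => //; move: (tA); rewrite inE => /andP[-> ->].
exact: mxK.
Qed.

Section Maps.
Variables (up : V -> Tt -> option Tt) (val : V -> Tt -> nat) (vs : V -> nat -> seq nat).
Hypotheses
  (vs_size : forall z i, size (vs z i) <= 2 * gam z)
  (valP : forall z t, reg t z ->
     [/\ val z t \in vs z (beta (val z t)), load t z <= val z t & val z t <= Q])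
  (upP : forall z t a, reg t z -> up z t = Some a -> reg a z /\ val z t <= load a z)
  (up_inj : forall z t t' a, reg t z -> reg t' z ->
     up z t = Some a -> up z t' = Some a -> t = t')
  (val_drop : forall z, gam z * \sum_(t | reg t z && (up z t == None)) val z t
     <= K0 * \sum_(t | reg t z) load t z).

(* The final tour that receives what [t] holds at [y]: a tour, or the part dropped at some
   node [z] from the tour [t']. *)
Fixpoint out_rec n t y : Tt + V * Tt :=
  if reg t y then
    match up y t, n with
    | None, _ => inr (y, t)
    | Some a, 0 => inl a
    | Some a, n'.+1 => out_rec n' a (par y)
    end
  else if n is n'.+1 then out_rec n' t (par y) else inl t.
Definition out t y := out_rec (dep y) t y.

(** The new size of a partial tour is decided at the next exchange at or above [y]. A loaded tour
    always exchanges at the root, so the default 0 concerns unloaded tours only. *)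
Fixpoint size_rec n t y : nat :=
  if reg t y then val y t else if n is n'.+1 then size_rec n' t (par y) else 0.
Definition rsize t y := size_rec (dep y) t y.

Lemma out_up t y a : reg t y -> up y t = Some a ->
  out t y = if y == r then inl a else out a (par y).
Proof.
move=> ry ua; rewrite /out; case: (eqVneq y r) => [e|yr]; first by rewrite e dep_r /= -e ry ua.
by rewrite (dep_par reach yr) /= ry ua.
Qed.

Lemma out_drop t y : reg t y -> up y t = None -> out t y = inr (y, t).
Proof. by move=> ry ua; rewrite /out; case: (dep y) => [|n] /=; rewrite ry ua. Qed.

Lemma nreg_r t y : 0 < load t y -> ~~ reg t y -> y != r.
Proof. by move=> ly; apply: contra => /eqP e; move: ly; rewrite e; apply: reg_r. Qed.

Lemma out_nreg t y : 0 < load t y -> ~~ reg t y -> out t y = out t (par y).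
Proof.
move=> ly nr; have yr := nreg_r ly nr.
by rewrite /out (dep_par reach yr) /= (negbTE nr).
Qed.

Lemma rsize_reg t y : reg t y -> rsize t y = val y t.
Proof. by move=> ry; rewrite /rsize; case: (dep y) => [|n] /=; rewrite ry. Qed.

Lemma rsize_nreg t y : 0 < load t y -> ~~ reg t y -> rsize t y = rsize t (par y).
Proof.
move=> ly nr; have yr := nreg_r ly nr.
by rewrite /rsize (dep_par reach yr) /= (negbTE nr).
Qed.

(** Going up from [y], the load stays constant until an exchange is met, at the root at the
    latest. *)
Lemma next_reg t y : 0 < load t y ->
  exists z, [/\ sub z y, reg t z, load t z = load t y, rsize t y = val z t
    & forall x, sub x y -> sub z x -> x != z -> ~~ reg t x].
Proof.
elim/(up_ind reach): y => [|y yr IH] ly.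
  have ry := reg_r ly.
  exists r; split; rewrite ?sub_refl ?(rsize_reg ry) // => x xr _ /eqP[].
  by apply: (sub_anti par_r reach) => //; apply: sub_root.
case: (boolP (reg t y)) => ry.
  exists y; split; rewrite ?sub_refl ?(rsize_reg ry) // => x xy yx /eqP[].
  exact: (sub_anti par_r reach).
have lp := nreg_load ly ry.
have [|z [zy rz lz ez nz]] := IH; first by rewrite lp.
exists z; split=> //; first exact: sub_trans zy (sub_par _ _).
- by rewrite lz lp.
- by rewrite (rsize_nreg ly ry).
move=> x /(sub_cases par_r)[-> //|[_ xp]]; exact: nz.
Qed.

Lemma rsize_ge t y : 0 < load t y -> load t y <= rsize t y.
Proof. by move=> /next_reg[z [_ rz <- -> _]]; have [] := valP rz. Qed.

Lemma rsize_le t y : 0 < load t y -> rsize t y <= Q.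
Proof. by move=> /next_reg[z [_ rz _ -> _]]; have [] := valP rz. Qed.

Lemma load_par t y : 0 < load t y -> 0 < load t (par y).
Proof. by move/leq_trans; apply; apply/load_mono/sub_par. Qed.

Lemma out_dropP t y z t' : 0 < load t y -> out t y = inr (z, t') ->
  [/\ sub z y, reg t' z & up z t' = None].
Proof.
elim/(up_ind reach): y t => [|y yr IH] t ly.
  have ry := reg_r ly; case ua: (up r t) => [a|]; first by rewrite (out_up ry ua) eqxx.
  by rewrite (out_drop ry ua) => -[<- <-]; rewrite sub_refl.
case: (boolP (reg t y)) => ry.
  case ua: (up y t) => [a|]; last by rewrite (out_drop ry ua) => -[<- <-]; rewrite sub_refl.
  rewrite (out_up ry ua) (negbTE yr) => /IH[|zy rz uz].
    by apply/load_par/reg_load; have [] := upP ry ua.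
  by split=> //; apply: sub_trans zy (sub_par _ _).
rewrite (out_nreg ly ry) => /IH[|zy rz uz]; first exact: load_par.
by split=> //; apply: sub_trans zy (sub_par _ _).
Qed.

Lemma out_above t y z t' : y != r -> 0 < load t (par y) -> out t (par y) = inr (z, t') -> z != y.
Proof.
move=> yr lp /(out_dropP lp)[zp _ _]; apply/eqP => e; subst z.
have cy : child (par y) y by rewrite /child yr eqxx.
by have := child_nsub par_r reach cy; rewrite zp.
Qed.

(** Partial tours never merge: [up] is injective, its targets are tours that exchange at the node
    themselves and so vacate their place, and a dropped part is named by its node and tour. *)
Lemma out_inj t t' y : 0 < load t y -> 0 < load t' y -> out t y = out t' y -> t = t'.
Proof.
have loada y0 t0 a0 : reg t0 y0 -> up y0 t0 = Some a0 -> 0 < load a0 y0.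
  by move=> r0 u0; apply: reg_load; have [] := upP r0 u0.
elim/(up_ind reach): y t t' => [|y yr IH] t t' ly ly'.
  have ry := reg_r ly; have ry' := reg_r ly'.
  case ua: (up r t) => [a|]; case ua': (up r t') => [a'|];
    rewrite ?(out_up ry ua) ?(out_up ry' ua') ?(out_drop ry ua) ?(out_drop ry' ua') ?eqxx //.
    by case=> e; subst a'; apply: up_inj ua ua'.
  by case.
have drop_ne t0 t1 : reg t0 y -> up y t0 = None -> 0 < load t1 (par y) ->
    out t0 y <> out t1 (par y).
  by move=> r0 u0 l1; rewrite (out_drop r0 u0) => /esym/(out_above yr l1); rewrite eqxx.
case: (boolP (reg t y)) => ry; case: (boolP (reg t' y)) => ry'.
- case ua: (up y t) => [a|]; case ua': (up y t') => [a'|].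
  + rewrite (out_up ry ua) (out_up ry' ua') (negbTE yr) => e.
    have ea : a = a'.
      by apply: IH e; apply: load_par; [exact: loada ry ua | exact: loada ry' ua'].
    by apply: up_inj ry ry' ua _; rewrite ua' ea.
  + rewrite (out_up ry ua) (negbTE yr) => /esym/(drop_ne _ _ ry' ua')[].
    exact/load_par/(loada _ _ _ ry ua).
  + rewrite (out_up ry' ua') (negbTE yr) => /(drop_ne _ _ ry ua)[].
    exact/load_par/(loada _ _ _ ry' ua').
  + by rewrite (out_drop ry ua) (out_drop ry' ua') => -[].
- rewrite (out_nreg ly' ry'); case ua: (up y t) => [a|].
    rewrite (out_up ry ua) (negbTE yr) => e.
    have [ra va] := upP ry ua; have ea : a = t'.
      by apply: IH e; apply: load_par => //; apply: reg_load.
    by subst a; rewrite ra in ry'.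
  by move=> /(drop_ne _ _ ry ua)[]; apply: load_par.
- rewrite (out_nreg ly ry); case ua: (up y t') => [a|].
    rewrite (out_up ry' ua) (negbTE yr) => e.
    have [ra va] := upP ry' ua; have ea : t = a.
      by apply: IH e; apply: load_par => //; apply: reg_load.
    by subst a; rewrite ra in ry.
  by move=> /esym/(drop_ne _ _ ry' ua)[]; apply: load_par.
rewrite (out_nreg ly ry) (out_nreg ly' ry'); apply: IH; exact: load_par.
Qed.

(** The coverage of the final tour [o] at [y]; by [out_inj] at most one [t] qualifies. *)
Definition dsize (o : Tt + V * Tt) y :=
  if [pick t | (0 < load t y) && (out t y == o)] is Some t then rsize t y else 0.

Lemma dsizeE t y : 0 < load t y -> dsize (out t y) y = rsize t y.
Proof.
move=> ly; rewrite /dsize; case: pickP => [t' /andP[l' /eqP e]|/(_ t)]; last by rewrite ly eqxx.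
by rewrite (out_inj l' ly e).
Qed.

Lemma dsize_gt0 o y : 0 < dsize o y -> exists2 t, 0 < load t y & out t y = o.
Proof. by rewrite /dsize; case: pickP => // t /andP[l' /eqP e] _; exists t. Qed.

Lemma dsize_le o y : dsize o y <= Q.
Proof. by rewrite /dsize; case: pickP => // t /andP[/rsize_le]. Qed.

(** Strictly above the node of the drop, a dropped part belongs to no regrouped tour; its way to the
    depot is accounted for during repacking. *)
Definition above (o : Tt + V * Tt) y := if o is inr (z, _) then sub y z && (y != z) else false.

Lemma dsize_child o y c : child y c -> ~~ above o y -> 0 < dsize o c ->
  exists2 t, 0 < load t y & out t y = o /\ (dsize o c <= load t c \/ [/\ dsize o c = rsize t y, load t c = load t y & 0 < load t c]).
Proof.
move=> cy nab dc; have [t lc' ot] := dsize_gt0 dc; have [cr /eqP pc] := andP cy.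
have ds : dsize o c = rsize t c by rewrite -ot dsizeE.
case: (boolP (reg t c)) => rc; last first.
  exists t; first by rewrite -pc load_par.
  rewrite -{1}pc -(out_nreg lc' rc); split=> //; right; split=> //.
    by rewrite ds (rsize_nreg lc' rc) pc.
  by rewrite -pc nreg_load.
case ua: (up c t) => [a|]; last first.
  case/negP: nab; rewrite -ot (out_drop rc ua) /= (child_sub cy); apply/eqP => e.
  by have := child_nsub par_r reach cy; rewrite e sub_refl.
have [ra va] := upP rc ua; exists a; first by rewrite -pc; apply/load_par/reg_load.
by move: (out_up rc ua); rewrite (negbTE cr) pc ot => <-; split=> //; left; rewrite ds rsize_reg.
Qed.

(** If every child fits into the load of [t] there, the sum is at most [load t y], hence at most the
    new size. Otherwise some child was passed without exchange and carries the whole load of [t] at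
    [y]; nothing else is left at [y], and the size is handed on unchanged. *)
Lemma dsize_super o y : ~~ above o y ->
  \sum_(e | (kp e && (out (te e) (lc e) == o)) && (lc e == y)) b e
    + \sum_(c | child y c) dsize o c <= dsize o y.
Proof.
move=> nab.
have lte e : kp e -> 0 < load (te e) (lc e).
  move=> ke; rewrite /load (bigD1 e) /= ?ke ?eqxx ?sub_refl //.
  by apply: ltn_addr; apply: leq_trans U0 (kpU ke).
case: (pickP [pred t | (0 < load t y) && (out t y == o)]) => [t /andP[lt /eqP ot]|no]; last first.
  rewrite !big1 // => [c cy|e /andP[/andP[ke oe] /eqP ee]].
    apply/eqP; rewrite -leqn0 leqNgt; apply/negP => dc.
    have [t lt [ot _]] := dsize_child cy nab dc.
    by have := no t; rewrite /= lt ot eqxx.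
  by have := no (te e); rewrite /= -ee lte // oe.
have -> : dsize o y = rsize t y by rewrite -ot dsizeE.
have dch c : child y c -> 0 < dsize o c -> dsize o c <= load t c \/
    [/\ dsize o c = rsize t y, load t c = load t y & 0 < load t c].
  move=> cy dc; have [t' lt' [ot' H]] := dsize_child cy nab dc.
  by rewrite (out_inj lt lt' _) // ot ot'.
have itemsE : \sum_(e | (kp e && (out (te e) (lc e) == o)) && (lc e == y)) b e
    <= \sum_(e | (kp e && (te e == t)) && (lc e == y)) b e.
  rewrite big_mkcond [X in _ <= X]big_mkcond; apply: leq_sum => e _.
  case: ifP => // /andP[/andP[ke /eqP oe] /eqP ee]; rewrite ke ee eqxx andbT.
  case: eqP => // -[]; move: (lte e ke) oe; rewrite ee => le oe.
  by apply: (out_inj le lt); rewrite oe ot.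
case: (pickP [pred c | child y c && (load t c < dsize o c)]) => [c0 /andP[cy0 lt0]|all].
  have [h|[d0 e0 l0]] := dch c0 cy0 (leq_ltn_trans (leq0n _) lt0); first by move: lt0; rewrite ltnNge h.
  have := load_children t y; rewrite (bigD1 c0) //= -e0 => eL.
  have i0 : \sum_(e | (kp e && (te e == t)) && (lc e == y)) b e = 0 by lia.
  have z0 : \sum_(c | child y c && (c != c0)) load t c = 0 by lia.
  rewrite (bigD1 c0) //= d0 [X in _ + (_ + X)]big1 ?addn0; first by lia.
  move=> c /andP[cy ne]; apply/eqP; rewrite -leqn0 leqNgt; apply/negP => dc.
  have lc0 : load t c = 0.
    by apply/eqP; move/eqP: z0; rewrite sum_nat_eq0 => /forall_inP; apply; rewrite cy.
  by have [|[_ _]] := dch c cy dc; rewrite lc0 // leqNgt dc.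
apply: leq_trans (rsize_ge lt); rewrite load_children; apply: leq_add itemsE _.
by apply: leq_sum => c cy; have := all c; rewrite /= cy /= => /negbT; rewrite -leqNgt.
Qed.

Lemma dsize_card y : #|[set o | 0 < dsize o y]| <= #|[set t | 0 < load t y]|.
Proof.
apply: leq_trans (leq_imset_card (fun t => out t y) _); apply: subset_leq_card.
apply/subsetP => o; rewrite inE => /dsize_gt0[t lt <-]; apply: imset_f; by rewrite inE.
Qed.

Lemma dsize_drop z : \sum_t dsize (inr (z, t)) z = \sum_(t | reg t z && (up z t == None)) val z t.
Proof.
rewrite [RHS]big_mkcond; apply: eq_bigr => t _; case: ifP => [/andP[rt /eqP ut]|no].
  by rewrite -(out_drop rt ut) (dsizeE (reg_load rt)) rsize_reg.
apply/eqP; rewrite -leqn0 leqNgt; apply/negP => /dsize_gt0[t' lt' /(out_dropP lt')[_ rt ut]].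
by rewrite rt ut eqxx in no.
Qed.

Definition anc y d := iter (dep y - d) par y.

(** The possible places of the next exchange at or above [y]: the last major checkpoint, the depths
    divisible by [bb] after it, and all depths after the last multiple of [bb]. *)
Definition regions y : seq V :=
  let m1 := dep y %/ bb * bb in
  let m2 := dep y %/ (bb * bb) * (bb * bb) in
  anc y m2 ::
  [seq anc y (m2 + bb * j) | j <- iota 1 bb.-1 & m2 + bb * j <= dep y] ++
  [seq anc y (m1 + j) | j <- iota 1 bb.-1 & m1 + j <= dep y].

Lemma dep_anc y d : d <= dep y -> dep (anc y d) = d.
Proof. by move=> dy; rewrite (dep_iter par_r reach); lia. Qed.

Lemma sub_anc y d : sub (anc y d) y. Proof. exact: sub_iter. Qed.

Lemma anc_between y z d : sub z y -> dep z <= d <= dep y -> sub z (anc y d).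
Proof.
move=> zy /andP[zd dy]; apply: (sub_comp par_r reach zy (sub_anc y d)).
by rewrite dep_anc.
Qed.

Lemma ancE y z : sub z y -> z = anc y (dep z).
Proof. by move=> zy; have [] := sub_dep par_r reach zy. Qed.

Lemma next_reg_region t y z : sub z y -> reg t z -> 0 < load t y -> load t z = load t y ->
  (forall x, sub x y -> sub z x -> x != z -> ~~ reg t x) -> z \in regions y.
Proof.
move=> zy rz ly lz nreg.
have [_ dzy] := sub_dep par_r reach zy.
have bt d : dep z < d <= dep y -> ~~ reg t (anc y d) /\ load t (anc y d) = load t z.
  case/andP=> zd dy; have zx : sub z (anc y d) by rewrite anc_between // ltnW.
  split; first apply: nreg => //; rewrite ?sub_anc //.
    by apply/eqP => e; move: zd; rewrite -{1}e dep_anc // ltnn.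
  by apply/eqP; rewrite eqn_leq load_mono //= lz load_mono // sub_anc.
have nomaj d : dep z < d <= dep y -> ~~ (bb * bb %| d).
  move=> h; have [] := bt d h; rewrite /reg => /nandP[|/norP[+ _] _].
    by move=> h0 e; move: h0; rewrite e lz ly.
  by rewrite /major dep_anc //; case/andP: h.
set m1 := dep y %/ bb * bb; set m2 := dep y %/ (bb * bb) * (bb * bb).
have B0 : 0 < bb * bb by rewrite muln_gt0 bb0.
have m2y : m2 <= dep y by apply: leq_trunc_div.
have m1y : m1 <= dep y by apply: leq_trunc_div.
have m1b : dep y < m1 + bb by rewrite /m1 -mulSnr ltn_ceil.
have m2b : dep y < m2 + bb * bb by rewrite /m2 -mulSnr ltn_ceil.
have m2z : m2 <= dep z.
  by rewrite leqNgt; apply/negP => lt; have := nomaj m2; rewrite lt m2y /m2 dvdn_mull // => /(_ isT).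
rewrite /regions -/m1 -/m2 inE; case: (eqVneq z (anc y m2)) => //= ne.
have m2z' : m2 < dep z.
  by rewrite ltn_neqAle m2z andbT; apply: contraNneq ne => ->; rewrite -ancE.
rewrite mem_cat; case bz: (bb %| dep z).
  apply/orP; left; apply/mapP.
  have [j ej] : exists j, dep z = m2 + bb * j.
    have /dvdnP[j ej] : bb %| dep z - m2.
      by rewrite dvdn_sub // /m2 mulnA dvdn_mull.
    by exists j; rewrite mulnC; lia.
  exists j; last by rewrite -ej -ancE.
  rewrite mem_filter -ej dzy mem_iota /=.
  have : j * bb < bb * bb by rewrite mulnC; lia.
  rewrite ltn_mul2r => /andP[_ jb]; apply/andP; split; last lia.
  by case: j ej {jb} => // e; move: m2z'; rewrite e muln0 addn0 ltnn.
have m1z : m1 < dep z.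
  rewrite ltnNge leq_eqVlt; apply/negP => /orP[/eqP e|lt].
    by move: bz; rewrite e /m1 dvdn_mull.
  (* Otherwise the path from [z] down to [y] contains the next depth [m] divisible by [bb]. As [t]
     does not exchange there, its load is the same [bb] levels higher, which is above [z]; this
     contradicts the change of load at [z]. *)
  pose m := (dep z %/ bb).+1 * bb.
  have zm : dep z < m by apply: ltn_ceil.
  have mm1 : m <= m1 by rewrite /m /m1 leq_mul2r ltn_divLR // lt orbT.
  have my := leq_trans mm1 m1y.
  have [|nx lx] := bt m; first by rewrite zm.
  have dx : dep (anc y m) = m by apply: dep_anc.
  have l0 : 0 < load t (anc y m) by rewrite lx lz.
  move: nx; rewrite /reg l0 dx /m dvdn_mull // => /norP[_ /negPn/eqP e].
  have zr : z != r by apply: contraFneq bz => ->; rewrite dep_r dvdn0.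
  have [/andP[_ /orP[mz|]]] := (rz, I).
    by move: bz; rewrite (dvdn_trans _ mz) // dvdn_mulr.
  rewrite bz => /eqP[]; apply/eqP; rewrite eqn_leq [X in _ && X]load_mono ?sub_par // andbT.
  rewrite -lx -e; apply: load_mono; apply: (@sub_comp _ _ _ par_r reach _ _ y).
  - exact: sub_trans (sub_iter _ _ _) (sub_anc _ _).
  - exact: sub_trans (sub_par _ _) zy.
  rewrite (dep_iter par_r reach) dep_anc // /m mulSnr addnK.
  have dz := dep_par reach zr; have : dep z %/ bb * bb <= dep z by apply: leq_trunc_div.
  rewrite leq_eqVlt => /orP[/eqP e'|]; last by rewrite dz ltnS.
  by move: bz; rewrite -{1}e' dvdn_mull.
apply/orP; right; apply/mapP; exists (dep z - m1); last by rewrite subnKC -?ancE // ltnW.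
rewrite mem_filter mem_iota subnKC ?(ltnW m1z) // dzy /=; lia.
Qed.

Definition values y i : seq nat := flatten [seq vs z i | z <- regions y].

Lemma dsize_values o y : 0 < dsize o y -> dsize o y \in values y (beta (dsize o y)).
Proof.
case/dsize_gt0=> t ly <-; rewrite dsizeE //.
have [z [zy rz lz -> nreg]] := next_reg ly.
apply/flattenP; exists (vs z (beta (val z t))); last by have [] := valP rz.
by apply: map_f; apply: (next_reg_region (t := t)).
Qed.

Lemma size_flatten_le (T : Type) (m : nat) (ss : seq (seq T)) :
  all (fun s => size s <= m) ss -> size (flatten ss) <= size ss * m.
Proof. by elim: ss => //= s ss IH /andP[h /IH]; rewrite size_cat mulSn; apply: leq_add. Qed.

(** One major node contributes [2 * g1] values, and at most [2 * (bb - 1)] other nodes contribute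
    [2 * g2] each. *)
Lemma size_values y i : size (values y i) <= 2 * g1 + 4 * (bb * g2).
Proof.
have B0 : 0 < bb * bb by rewrite muln_gt0 bb0.
have small k l : (forall j, 0 < j < bb -> k + l * j <= dep y -> ~~ (bb * bb %| k + l * j)) ->
    size (flatten [seq vs z i | z <- [seq anc y (k + l * j) | j <- iota 1 bb.-1 & k + l * j <= dep y]])
    <= 2 * (bb * g2).
  move=> H; apply: leq_trans (size_flatten_le (m := 2 * g2) _) _.
    apply/allP => _ /mapP[_ /mapP[j jin ->] ->]; apply: leq_trans (vs_size _ _) _.
    move: jin; rewrite mem_filter mem_iota => /andP[le jb].
    rewrite /gam /major dep_anc // (negbTE (H j _ le)) //; lia.
  rewrite !size_map mulnCA leq_mul2l /= leq_mul2r; apply/orP; right.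
  by rewrite size_filter (leq_trans (count_size _ _)) // size_iota leq_pred.
rewrite /values /regions /= map_cat flatten_cat !size_cat.
set m1 := _ %/ bb * bb; set m2 := _ %/ (bb * bb) * _.
apply: (@leq_trans (2 * g1 + (2 * (bb * g2) + 2 * (bb * g2)))); last by lia.
apply: leq_add; first by apply: leq_trans (vs_size _ _) _; rewrite /gam /major dep_anc ?leq_trunc_div // dvdn_mull.
apply: leq_add.
  apply: small => j /andP[j0 jb] _; rewrite dvdn_addr ?(dvdn_mull _ (dvdnn _)) // gtnNdvd ?muln_gt0 ?bb0 //.
  by rewrite ltn_mul2l bb0.
have := small m1 1.
have -> : [seq anc y (m1 + 1 * j) | j <- iota 1 bb.-1 & m1 + 1 * j <= dep y] =
          [seq anc y (m1 + j) | j <- iota 1 bb.-1 & m1 + j <= dep y].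
  by under eq_map do rewrite mul1n; under eq_filter do rewrite mul1n.
apply.
move=> j /andP[j0 jb] _; rewrite mul1n.
suff : ~~ (bb %| m1 + j) by apply: contra; apply: dvdn_trans; rewrite dvdn_mulr.
by rewrite dvdn_addr ?(dvdn_mull _ (dvdnn _)) // gtnNdvd.
Qed.

Definition load_major y := \sum_(z | sub y z && major z) \sum_(t | reg t z) load t z.
Definition load_minor y := \sum_(z | sub y z && ~~ major z) \sum_(t | reg t z) load t z.

Lemma drop_major y :
  g1 * \sum_(z | sub y z && major z) \sum_t dsize (inr (z, t)) z <= K0 * load_major y.
Proof.
rewrite !big_distrr /=; apply: leq_sum => z /andP[_ mz]; rewrite dsize_drop.
by have := val_drop z; rewrite /gam mz.
Qed.

Lemma drop_minor y :
  g2 * \sum_(z | sub y z && ~~ major z) \sum_t dsize (inr (z, t)) z <= K0 * load_minor y.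
Proof.
rewrite !big_distrr /=; apply: leq_sum => z /andP[_ mz]; rewrite dsize_drop.
by have := val_drop z; rewrite /gam (negbTE mz).
Qed.

Lemma count_anc x (P : pred V) :
  #|[set z | sub z x && P z]| <= \sum_(k < (dep x).+1) P (iter k par x).
Proof.
have -> : \sum_(k < (dep x).+1) P (iter k par x) = #|[set k : 'I_(dep x).+1 | P (iter k par x)]|.
  by rewrite -sum1_card [in RHS]big_mkcond; apply: eq_bigr => k _; rewrite inE; case: (P _).
apply: leq_trans (leq_imset_card (fun k : 'I_(dep x).+1 => iter k par x) _).
apply: subset_leq_card; apply/subsetP => z; rewrite inE => /andP[zx Pz].
have [k kx ez] := sub_iterP par_r reach zx.
by apply/imsetP; exists (inord k); rewrite ?inE /= inordK // -ez.
Qed.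

Lemma count_jumps t x c l : 0 < l ->
  (\sum_(j < (dep x).+1) (load t (iter (c + l * j) par x) != load t (iter (c + l * j.+1) par x))) * U <= Q.
Proof.
move=> l0; rewrite big_distrl /=.
have := @sum_jumps (fun j => load t (iter (c + l * j) par x)) U (dep x).+1.
move=> /(_ _)H; apply: leq_trans (leq_trans (leq_addr _ _) (H _)) (load_le t _).
move=> j ne; apply: load_jump => //; apply: iter_sub; rewrite mulnS; lia.
Qed.

(** An exchange at a node that is not major is caused by a change of load over one edge or, at
    depths divisible by [bb], over [bb] levels. Along either chain of ancestors the load grows by at
    least [U] per change and never exceeds [Q]. *)
Lemma count_reg t x : #|[set z | sub z x && (~~ major z && reg t z)]| <= 2 * (Q %/ U).
Proof.
pose A1 := [set z | sub z x && ((bb %| dep z) && (load t (iter bb par z) != load t z))].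
pose A2 := [set z | sub z x && (load t (par z) != load t z)].
apply: (@leq_trans #|A1 :|: A2|).
  apply: subset_leq_card; apply/subsetP => z; rewrite !inE => /and3P[-> /negbTE mz].
  by rewrite /reg mz /= => /andP[_]; case: ifP => _ -> //; rewrite orbT.
apply: leq_trans (leq_card_setU _ _).1 _; rewrite mul2n -addnn; apply: leq_add; rewrite leq_divRL //.
  (* The offset [dep x %% bb] aligns the steps of length [bb] with the depths divisible by [bb]. *)
  apply: leq_trans _ (count_jumps t x (dep x %% bb) bb0); rewrite leq_mul2r; apply/orP; right.
  set F := fun j : 'I_(dep x).+1 => load t (iter (dep x %% bb + bb * j) par x) != load t (iter (dep x %% bb + bb * j.+1) par x).
  rewrite [X in _ <= X](_ : _ = #|[set j | F j]|); last first.
    by rewrite -sum1_card [in RHS]big_mkcond; apply: eq_bigr => k _; rewrite inE /F; case: (_ != _).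
  apply: leq_trans (leq_imset_card (fun j : 'I_(dep x).+1 => iter (dep x %% bb + bb * j) par x) _).
  apply: subset_leq_card; apply/subsetP => z; rewrite inE => /and3P[zx bz jz].
  have [k kx ez] := sub_iterP par_r reach zx.
  have dz : dep z = dep x - k by rewrite ez (dep_iter par_r reach).
  have ek : k = dep x %% bb + bb * (k %/ bb).
    rewrite {1}(divn_eq k bb) addnC [_ * bb]mulnC; congr (_ + _).
    by apply/eqP; rewrite eq_sym eqn_mod_dvd // -dz.
  have kb : k %/ bb < (dep x).+1 by rewrite ltnS (leq_trans (leq_div _ _)).
  apply/imsetP; exists (Ordinal kb); last by rewrite /= -ek.
  by rewrite inE /F /= mulnS addnCA -ek iterD -ez eq_sym.
apply: leq_trans _ (count_jumps t x 0 (ltn0Sn 0)); rewrite leq_mul2r; apply/orP; right.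
apply: leq_trans (count_anc x _) _; apply: leq_sum => k _.
by rewrite !add0n !mul1n iterS eq_sym.
Qed.

(** Exchange the sums: an item is counted only at nodes of its own path to the root, at most [m]
    times. *)
Lemma sum_load_le (P : V -> Tt -> bool) m y :
    (forall t x, #|[set z | sub z x && P z t]| <= m) ->
  \sum_(z | sub y z) \sum_(t | P z t) load t z <= m * \sum_t load t y.
Proof.
move=> H; rewrite (exchange_big_dep predT) //= big_distrr /=; apply: leq_sum => t _.
rewrite /load (exchange_big_dep (fun e => (kp e && (te e == t)) && sub y (lc e))) /=; last first.
  by move=> z e /andP[yz _] /andP[-> ze]; apply: sub_trans yz ze.
rewrite big_distrr /=; apply: leq_sum => e /andP[ke ye].
rewrite sum_nat_const leq_mul2r; apply/orP; right; apply: leq_trans (H t (lc e)).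
apply: subset_leq_card; apply/subsetP => z; rewrite !inE ke /=.
by case/andP=> /andP[_ ->] ->.
Qed.

Lemma load_major_le h y : (forall x, dep x <= h) ->
  load_major y <= (h %/ (bb * bb)).+1 * \sum_t load t y.
Proof.
move=> hP; have B0 : 0 < bb * bb by rewrite muln_gt0 bb0.
apply: leq_trans (@sum_load_le (fun z t => major z && reg t z) _ y _).
  rewrite /load_major big_mkcondr; apply: leq_sum => z _; case: (major z) => //=.
move=> t x.
apply: (@leq_trans #|[set anc x (j * (bb * bb)) | j : 'I_(h %/ (bb * bb)).+1]|); last first.
  by apply: leq_trans (leq_imset_card _ _) _; rewrite card_ord.
apply: subset_leq_card; apply/subsetP => z; rewrite inE => /and3P[zx mz _].
have jP : dep z %/ (bb * bb) < (h %/ (bb * bb)).+1 by rewrite ltnS leq_div2r.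
by apply/imsetP; exists (Ordinal jP) => //=; rewrite divnK // -ancE.
Qed.

Lemma load_minor_le y : load_minor y <= 2 * (Q %/ U) * \sum_t load t y.
Proof.
apply: leq_trans (@sum_load_le (fun z t => ~~ major z && reg t z) _ y (fun t x => count_reg t x)).
by rewrite /load_minor big_mkcondr; apply: leq_sum => z _; case: (major z).
Qed.

End Maps.

(** All that the repacking needs to know of the exchanges: [D o] is the coverage function of the
    final tour or dropped part [o], and [M1 y], [M2 y] count the tokens dropped inside [T_y] at
    major and at other nodes. *)
Lemma regroup (h : nat) : (forall x, dep x <= h) ->
  exists (out : X -> Tt + V * Tt) (D : Tt + V * Tt -> V -> nat)
         (vals : V -> nat -> seq nat) (M1 M2 : V -> nat),
  [/\ [/\ forall e, kp e -> 0 < D (out e) (lc e),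
      forall o y, ~~ above o y ->
        \sum_(e | (kp e && (out e == o)) && (lc e == y)) b e
          + \sum_(c | child y c) D o c <= D o y,
      forall o y, D o y <= Q,
      forall o y, 0 < D o y -> exists2 e, kp e & sub y (lc e)
    & forall y, #|[set o | 0 < D o y]| <= #|[set t | 0 < load t y]| ],
      (forall o y, 0 < D o y -> D o y \in vals y (beta (D o y))) /\
      (forall y i, size (vals y i) <= 2 * g1 + 4 * (bb * g2)),
      forall z t y, 0 < D (inr (z, t)) y -> sub z y,
      forall y, \sum_(z | sub y z) \sum_t D (inr (z, t)) z <= M1 y + M2 y
    & forall y, g1 * M1 y <= K0 * ((h %/ (bb * bb)).+1 * \sum_t load t y) /\
                g2 * M2 y <= K0 * (2 * (Q %/ U) * \sum_t load t y)].
Proof.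
move=> hP; have [up [val [vs [H1 H2 H3 H4 H5]]]] := regroup_maps.
exists (fun e => out up (te e) (lc e)), (dsize up val), (values vs).
exists (fun y => \sum_(z | sub y z && major z) \sum_t dsize up val (inr (z, t)) z).
exists (fun y => \sum_(z | sub y z && ~~ major z) \sum_t dsize up val (inr (z, t)) z).
have lte e : kp e -> 0 < load (te e) (lc e).
  move=> ke; rewrite /load (bigD1 e) /= ?ke ?eqxx ?sub_refl //.
  by apply: ltn_addr; apply: leq_trans U0 (kpU ke).
split; first split.
- move=> e /lte le.
  have ez : dsize up val (out up (te e) (lc e)) (lc e) = rsize val (te e) (lc e).
    by eapply dsizeE; eassumption.
  by rewrite ez; exact: leq_trans le (rsize_ge H2 le).
- by move=> o y nab; eapply dsize_super; eassumption.
- by move=> o y; eapply dsize_le; eassumption.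
- move=> o y /dsize_gt0[t lt _].
  have /existsP[e /andP[/andP[ke _] ye]] : [exists e, (kp e && (te e == t)) && sub y (lc e)].
    apply: contraTT lt => /existsPn no; rewrite -eqn0Ngt; apply/eqP.
    by apply: big_pred0 => e; apply/negbTE/no.
  by exists e.
- by move=> y; eapply dsize_card; eassumption.
- by split=> [o y d0|y i]; [eapply dsize_values | eapply size_values]; eassumption.
- by move=> z t y /dsize_gt0[t' lt' /(out_dropP H3 lt')[]].
- by move=> y; rewrite (bigID major).
- move=> y; split.
    eapply leq_trans; first by eapply drop_major; eassumption.
    by rewrite leq_mul2l (load_major_le _ hP) orbT.
  eapply leq_trans; first by eapply drop_minor; eassumption.
  by rewrite leq_mul2l load_minor_le orbT.
Qed.

End Regroup.

(** * Repacking the items *)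

Lemma sum_gt0 (I : finType) (P : pred I) (F : I -> nat) :
  0 < \sum_(i | P i) F i -> exists2 i, P i & 0 < F i.
Proof.
rewrite lt0n sum_nat_eq0 negb_forall_in => /exists_inP[i Pi]; rewrite -lt0n.
by exists i.
Qed.

Lemma leq_sumW (I : finType) (P P' : pred I) (F : I -> nat) :
  (forall i, P i -> 0 < F i -> P' i) -> \sum_(i | P i) F i <= \sum_(i | P' i) F i.
Proof.
move=> H; rewrite big_mkcond [X in _ <= X]big_mkcond; apply: leq_sum => i _.
case: ifP => // Pi; case: (posnP (F i)) => [->//|Fi]; by rewrite H.
Qed.

(** * Bundling the small items *)

Section Bundles.
Variables (V : finType) (par : V -> V) (r : V).
Hypotheses (par_r : par r = r) (reach : forall v, fconnect par v r).
Notation sub := (sub par).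
Notation dep := (dep par r).
Notation child := (child par r).
Variables (I Tt : finType) (a : I -> nat) (loc : I -> V) (tr : I -> Tt) (U : nat).
Hypothesis U0 : 0 < U.

Definition in_bundle K (blk : I -> option 'I_K) k i := (a i < U) && (blk i == Some k).

(** A bundle is placed at the lowest common ancestor [p k] of its items and given to a tour [hk k]
    that owns some of its tokens. The fractional assignment that is rounded divides each bundle
    among the owners of its items. [k1 y] and [k2 y] are the bundles that may have items on both
    sides of the edge above [y]. *)
Lemma bundles : exists (K : nat) (blk : I -> option 'I_K) (p : 'I_K -> V) (hk : 'I_K -> Tt)
   (dr : pred 'I_K) (k1 k2 : V -> option 'I_K),
  [/\ [/\ forall k, U <= \sum_(i | in_bundle blk k i) a i,
          forall k, \sum_(i | in_bundle blk k i) a i <= 2 * U.-1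
        & \sum_(i | (a i < U) && (blk i == None)) a i <= U.-1],
      forall y k, sub y (p k) = [forall (i | in_bundle blk k i), sub y (loc i)],
      forall k, exists i, [/\ in_bundle blk k i, tr i = hk k & 0 < a i],
      (forall k k', dr k -> dr k' -> hk k = hk k' -> k = k') /\
      (forall t, \sum_(k | (hk k == t) && ~~ dr k) \sum_(i | in_bundle blk k i) a i
          <= \sum_(i | (a i < U) && (tr i == t)) a i)
    & forall y k i, in_bundle blk k i -> sub y (loc i) -> ~~ sub y (p k) ->
        Some k = k1 y \/ Some k = k2 y].
Proof.
have [K [blk [geU leU lastU strad]]] :=
  pool par_r reach loc U0 (fun i (h : a i < U) => h).
have blkP k : exists i, in_bundle blk k i /\ 0 < a i.
  have /sum_gt0[i Pi ai] : 0 < \sum_(i | (a i < U) && (blk i == Some k)) a i.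
    exact: leq_trans U0 (geU k).
  by exists i.
have pEx k : exists p, forall y, sub y p = [forall (i | in_bundle blk k i), sub y (loc i)].
  by have [i [Pi _]] := blkP k; exact: (lca par_r reach loc Pi).
have [p pP] := choice pEx.
have sumt k : \sum_t \sum_(i | in_bundle blk k i && (tr i == t)) a i = \sum_(i | in_bundle blk k i) a i.
  by rewrite [RHS](partition_big tr predT).
have [hk [dr [hpos hinj hload]]] := rounded_assignment
  (m := fun k t => \sum_(i | in_bundle blk k i && (tr i == t)) a i)
  (fun k => leq_trans U0 (leq_trans (geU k) (eq_leq (esym (sumt k))))).
have [k1 k1P] := choice strad; have [k2 k2P] := choice k1P.
exists K, blk, p, hk, dr, k1, k2; split=> //.
- by split=> [k|k|]; [apply: geU | apply: leU |].
- move=> k; have /sum_gt0[i /andP[Pi /eqP ti] ai] := hpos k.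
  by exists i.
- split=> // t; have := hload t; under eq_bigr do rewrite sumt.
  move/leq_trans; apply; rewrite (exchange_big_dep (fun i => (a i < U) && (tr i == t))) /=; last first.
    by move=> k i _ /andP[/andP[-> _] ->].
  apply: leq_sum => i _; case e: (blk i) => [k0|]; last first.
    by rewrite big_pred0 // => k; rewrite /in_bundle e andbF.
  apply: leq_trans (leq_sumW (P' := pred1 k0) _) _; last by rewrite big_pred1_eq.
  by move=> k /andP[/andP[_]]; rewrite e => /eqP[->] /=.
- move=> y k i Pi yi nyp; have /forall_inPn[i' Pi' nyi'] : ~~ [forall (i | in_bundle blk k i), sub y (loc i)].
    by rewrite -pP.
  have [/andP[_ /eqP e] /andP[_ /eqP e']] := (Pi, Pi').
  by rewrite -e; apply: (k2P y) (yi) (nyi') => //; rewrite ?e ?e' //; [case/andP: Pi|case/andP: Pi'].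
Qed.
End Bundles.

(** * Final tours, dropped parts and pools *)

Section Core.
Variables (V : finType) (par : V -> V) (r : V).
Hypotheses (par_r : par r = r) (reach : forall v, fconnect par v r).
Notation sub := (sub par).
Notation dep := (dep par r).
Notation child := (child par r).
Variables (I Tt : finType) (a : I -> nat) (loc : I -> V) (tr : I -> Tt).
Variables (U W Q bb g1 g2 K0 h : nat) (beta : nat -> nat).
Hypotheses (U0 : 0 < U) (UW : U <= W) (WQ : 2 * W.-1 <= Q).
Hypotheses (bb0 : 0 < bb) (g10 : 0 < g1) (g20 : 0 < g2).

Definition oload t y := \sum_(i | (tr i == t) && sub y (loc i)) a i.

Hypothesis oloadQ : forall t, oload t r <= Q.
Hypothesis betaK : forall x y, 0 < x <= Q -> 0 < y <= Q -> beta x = beta y -> y <= K0 * x.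
Hypothesis depP : forall x, dep x <= h.

Definition visits y := #|[set t | 0 < oload t y]|.

Section Assembly.
Variables (K : nat) (blk : I -> option 'I_K) (p : 'I_K -> V) (hk : 'I_K -> Tt)
  (dr : pred 'I_K) (k1 k2 : V -> option 'I_K).
Notation inb := (in_bundle a U blk).
Notation mass k := (\sum_(i | inb k i) a i).
Hypotheses (massU : forall k, U <= mass k) (mass_le : forall k, mass k <= 2 * U.-1)
  (rest_le : \sum_(i | (a i < U) && (blk i == None)) a i <= U.-1)
  (pP : forall y k, sub y (p k) = [forall (i | inb k i), sub y (loc i)])
  (hkP : forall k, exists i, [/\ inb k i, tr i = hk k & 0 < a i])
  (dr_inj : forall k k', dr k -> dr k' -> hk k = hk k' -> k = k')
  (hk_load : forall t, \sum_(k | (hk k == t) && ~~ dr k) mass k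
          <= \sum_(i | (a i < U) && (tr i == t)) a i)
  (straddle : forall y k i, inb k i -> sub y (loc i) -> ~~ sub y (p k) ->
        Some k = k1 y \/ Some k = k2 y).

(* A super-item is an item of size at least [U] or a bundle that is not dropped. *)
Definition kp (e : I + 'I_K) := match e with inl i => U <= a i | inr k => ~~ dr k end.
Definition wt (e : I + 'I_K) := match e with inl i => a i | inr k => mass k end.
Definition lc (e : I + 'I_K) := match e with inl i => loc i | inr k => p k end.
Definition te (e : I + 'I_K) := match e with inl i => tr i | inr k => hk k end.

Lemma kp_wt e : kp e -> U <= wt e. Proof. by case: e => [i|k] //= _; apply: massU. Qed.

Lemma bundle_sub k i : inb k i -> sub (p k) (loc i).
Proof.
move=> Pi; have := sub_refl par (p k); rewrite pP => /forall_inP; exact.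
Qed.

Lemma item_below e : kp e -> exists2 i, sub (lc e) (loc i) & tr i = te e /\ 0 < a i.
Proof.
case: e => [i|k] /= ke; first by exists i; rewrite ?sub_refl; split=> //; apply: leq_trans ke.
have [i [Pi ti ai]] := hkP k; exists i => //; exact: bundle_sub.
Qed.

Notation load := (load par kp wt lc te).

Lemma loadE t y : load t y =
  \sum_(i | (U <= a i) && (tr i == t) && sub y (loc i)) a i +
  \sum_(k | ~~ dr k && (hk k == t) && sub y (p k)) mass k.
Proof. by rewrite /load big_sumType. Qed.

Lemma load_root t : load t r <= Q.
Proof.
apply: leq_trans (oloadQ t); rewrite loadE /oload [X in _ <= X](bigID (fun i => a i < U)) /= addnC.
apply: leq_add.
  apply: (leq_trans (leq_trans _ (hk_load t))); apply: leq_sumW.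
    by move=> k /andP[/andP[-> ->]].
  by move=> i /andP[au /eqP ti] _; rewrite au ti eqxx (sub_root reach).
by apply: leq_sumW => i /andP[/andP[au /eqP ti] _] _; rewrite -leqNgt au ti eqxx (sub_root reach).
Qed.

(** Each super-item assigned to [t] contains tokens that [t] already picked up below its place, so
    the assignment makes [t] cross no new edge. *)
Lemma load_oload t y : 0 < load t y -> 0 < oload t y.
Proof.
case/sum_gt0=> e /andP[/andP[ke /eqP te_] ye] _.
have [i ei [ti ai]] := item_below ke.
rewrite /oload (bigD1 i) /= ?ti ?te_ ?eqxx ?(sub_trans ye ei) //; exact: ltn_addr.
Qed.

Lemma load_card y : #|[set t | 0 < load t y]| <= visits y.
Proof.
by apply: subset_leq_card; apply/subsetP => t; rewrite !inE => /load_oload.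
Qed.

Lemma sum_load y : \sum_t load t y <= Q * visits y.
Proof.
rewrite mulnC; apply: (@leq_trans (\sum_(t in [set t | 0 < load t y]) Q)); last first.
  by rewrite sum_nat_const leq_mul2r load_card orbT.
rewrite [X in _ <= X]big_mkcond; apply: leq_sum => t _; rewrite inE; case: posnP => [->//|_].
exact: leq_trans (load_mono _ _ _ _ _ (sub_root reach y)) (load_root t).
Qed.

Section Packing.
Variables (out : I + 'I_K -> Tt + V * Tt) (D : Tt + V * Tt -> V -> nat)
  (vals : V -> nat -> seq nat) (M : V -> nat).
Hypotheses
  (D_item : forall e, kp e -> 0 < D (out e) (lc e))
  (D_super : forall o y, ~~ above par o y ->
        \sum_(e | (kp e && (out e == o)) && (lc e == y)) wt e
          + \sum_(c | child y c) D o c <= D o y)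
  (D_le : forall o y, D o y <= Q)
  (D_gt0 : forall o y, 0 < D o y -> exists2 e, kp e & sub y (lc e))
  (D_card : forall y, #|[set o | 0 < D o y]| <= visits y)
  (D_vals : forall o y, 0 < D o y -> D o y \in vals y (beta (D o y)))
  (D_drop : forall z t y, 0 < D (inr (z, t)) y -> sub z y)
  (D_sum : forall y, \sum_(z | sub y z) \sum_t D (inr (z, t)) z <= M y).

(** A dropped part with at least [W] tokens is worth a tour of its own; a smaller one goes to the
    pool. *)
Definition big_part (o : Tt + V * Tt) := if o is inr (z, _) then W <= D o z else true.

Definition src i : option (I + 'I_K) :=
  if U <= a i then Some (inl i) else
  if blk i is Some k then (if dr k then None else Some (inr k)) else None.

Definition dest i : option (Tt + V * Tt) :=
  if src i is Some e then (if big_part (out e) then Some (out e) else None) else None.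

Lemma above_anti z (t : Tt) y : sub z y -> ~~ above par (inr (z, t)) y.
Proof.
move=> zy; apply/negP => /andP[yz /eqP[]]; exact: (sub_anti par_r reach).
Qed.

Lemma parts_le o y : (forall u, sub y u -> ~~ above par o u) ->
  \sum_(e | (kp e && (out e == o)) && sub y (lc e)) wt e <= D o y.
Proof.
move=> nab; apply: leq_trans (sub_ge par_r reach
  (q := fun u => \sum_(e | (kp e && (out e == o)) && (lc e == u)) wt e) _); last first.
  by move=> u yu; apply: D_super; apply: nab.
rewrite (partition_big lc (sub y)) /=; last by move=> e /andP[].
apply: leq_sum => u yu; apply: leq_sumW => e /andP[/andP[-> _] ->] //.
Qed.

Lemma above_child (o : Tt + V * Tt) y c : child y c -> ~~ above par o y -> ~~ above par o c.
Proof.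
case: o => [//|[z t]] cy; apply: contra => /andP[cz ne].
rewrite /= (sub_trans (child_sub cy) cz) /=; apply/eqP => e; subst z.
by have := child_nsub par_r reach cy; rewrite cz.
Qed.

Lemma part_sub e z t : kp e -> out e = inr (z, t) -> sub z (lc e).
Proof. by move=> ke oe; apply: (D_drop (t := t)); rewrite -oe; apply: D_item. Qed.

Lemma parts_drop z t : \sum_(e | kp e && (out e == inr (z, t))) wt e <= D (inr (z, t)) z.
Proof.
apply: leq_trans (parts_le (o := inr (z, t)) (y := z) _).
  by apply: leq_sumW => e /andP[ke /eqP oe] _; rewrite ke oe eqxx (part_sub ke oe).
by move=> u zu; apply: above_anti.
Qed.

Lemma srcP i e : src i = Some e -> [/\ kp e, sub (lc e) (loc i) & a i <= wt e].
Proof.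
rewrite /src; case: leqP => Ui; first by case=> <-; rewrite /= sub_refl.
case eb: (blk i) => [k|//]; case dk: (dr k) => // -[<-].
have Pi : inb k i by rewrite /in_bundle Ui eb eqxx.
by split; rewrite /= ?dk ?bundle_sub // (bigD1 i) //= leq_addr.
Qed.

Definition pooled i := dest i == None.

(** Pooling with threshold [W] needs items below [W]: an item of a small dropped part is bounded by
    that part, any other pooled item by [U]. *)
Lemma pooled_lt i : pooled i -> a i < W.
Proof.
rewrite /pooled /dest; case es: (src i) => [e|].
  have [ke _ ai] := srcP es; case eo: (out e) => [t|[z t]] //=.
  rewrite leqNgt; case: ltnP => //= lt _; apply: leq_ltn_trans lt.
  apply: leq_trans ai (leq_trans _ (parts_drop z t)).
  by rewrite (bigD1 e) /= ?ke ?eo ?eqxx // leq_addr.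
by move: es; rewrite /src; case: (leqP U (a i)) => // lt _ _; apply: leq_trans lt UW.
Qed.

Definition mu k y := \sum_(i | inb k i && sub y (loc i)) a i.

(* Regrouping sees the bundle [k] as a single item at [p k]; strictly below [p k] its items have
   to be counted separately. *)
Definition piece k y := if sub y (p k) then 0 else mu k y.

Lemma mu_mass k y : mu k y <= mass k.
Proof. by apply: leq_sumW => i /andP[]. Qed.

Lemma piece_straddle k y : 0 < piece k y -> Some k = k1 y \/ Some k = k2 y.
Proof.
rewrite /piece; case: ifP => // /negbT nyp /sum_gt0[i /andP[Pi yi] _]; exact: (straddle Pi yi nyp).
Qed.

(** At [p k] the full mass of the bundle enters as a super-item and covers all its pieces. Strictly
    above [p k], every item of the bundle lies under the same child as [p k], so no piece is
    counted; elsewhere the pieces add up. *)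
Lemma piece_step k y :
  \sum_(i | inb k i && (loc i == y)) a i + \sum_(c | child y c) piece k c
    <= (if p k == y then mass k else 0) + piece k y.
Proof.
have muE : mu k y = \sum_(i | inb k i && (loc i == y)) a i + \sum_(c | child y c) mu k c.
  exact: (sum_subtree_dep par_r reach).
have le : \sum_(c | child y c) piece k c <= \sum_(c | child y c) mu k c.
  by apply: leq_sum => c _; rewrite /piece; case: ifP.
case: (eqVneq (p k) y) => [e|ne].
  by have := mu_mass k y; lia.
rewrite add0n; have -> : piece k y = if sub y (p k) then 0 else mu k y by [].
case: ifP => [yp|_]; last by lia.
rewrite eq_sym in ne; have [c0 cy cp] := child_exists par_r reach yp ne.
rewrite !big1 // => [c c_y|i /andP[Pi /eqP li]].
  rewrite /piece; case: ifP => // ncp; apply: big1 => i /andP[Pi ci].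
  by move: ncp; rewrite (child_uniq par_r reach c_y cy ci (sub_trans cp (bundle_sub Pi))) cp.
have := child_nsub par_r reach cy; rewrite -{1}li.
by rewrite (sub_trans cp (bundle_sub Pi)).
Qed.

Lemma sum_some_le (F : 'I_K -> nat) (x : option 'I_K) B :
  (forall k, F k <= B) -> \sum_(k | Some k == x) F k <= B.
Proof.
move=> H; case: x => [k0|]; last by rewrite big_pred0.
by rewrite (big_pred1 k0) // => k; rewrite /= (inj_eq (@Some_inj _)).
Qed.

Lemma sum_piece y : \sum_k piece k y <= 4 * U.-1.
Proof.
apply: (@leq_trans (\sum_(k | Some k == k1 y) piece k y + \sum_(k | Some k == k2 y) piece k y)).
  rewrite ![X in _ <= X + _]big_mkcond [X in _ <= _ + X]big_mkcond -big_split /=.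
  apply: leq_sum => k _; case: (posnP (piece k y)) => [->//|/piece_straddle[->|->]];
  by rewrite eqxx ?leq_addr ?leq_addl.
have le k : piece k y <= 2 * U.-1.
  by rewrite /piece; case: ifP => // _; apply: leq_trans (mu_mass k y) (mass_le k).
by have := sum_some_le (k1 y) le; have := sum_some_le (k2 y) le; lia.
Qed.

Definition pieces o y := \sum_(k | ~~ dr k && (out (inr k) == o)) piece k y.

Lemma items_le (P : pred V) o :
  \sum_(i | (dest i == Some o) && P (loc i)) a i <=
  \sum_(i | (U <= a i) && (out (inl i) == o) && P (loc i)) a i +
  \sum_(k | ~~ dr k && (out (inr k) == o)) \sum_(i | inb k i && P (loc i)) a i.
Proof.
rewrite (bigID (fun i => U <= a i)) /=; apply: leq_add.
  apply: leq_sumW => i /andP[/andP[/eqP di ->] ui] _; move: di.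
  by rewrite ui /dest /src ui; case: ifP => // _ [->]; rewrite eqxx.
rewrite (exchange_big_dep predT) //= [X in X <= _]big_mkcond; apply: leq_sum => i _.
case: ifP => // /andP[/andP[/eqP di Pi] nui]; move: di.
rewrite /dest /src (negbTE nui); case eb: (blk i) => [k|//]; case dk: (dr k) => //.
case: ifP => // _ [ok]; rewrite (bigD1 k) /= ?leq_addr //.
by rewrite dk ok eqxx /in_bundle ltnNge nui eb eqxx Pi.
Qed.

Lemma super_split (P : pred V) o :
  \sum_(e | (kp e && (out e == o)) && P (lc e)) wt e =
  \sum_(i | (U <= a i) && (out (inl i) == o) && P (loc i)) a i +
  \sum_(k | ~~ dr k && (out (inr k) == o) && P (p k)) mass k.
Proof. by rewrite big_sumType. Qed.

Lemma dest_big i o : dest i = Some o -> big_part o.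
Proof. by rewrite /dest; case: (src i) => // e; case: ifP => // be [<-]. Qed.

Lemma below_super o y : ~~ above par o y ->
  \sum_(i | (dest i == Some o) && (loc i == y)) a i
    + \sum_(c | child y c) (D o c + pieces o c) <= D o y + pieces o y.
Proof.
move=> nab; have H1 := D_super nab; have H2 := items_le (pred1 y) o.
rewrite (super_split (pred1 y)) /= in H1; rewrite /= in H2.
rewrite big_split /=.
have H3 : \sum_(k | ~~ dr k && (out (inr k) == o)) \sum_(i | inb k i && (loc i == y)) a i
   + \sum_(c | child y c) pieces o c <=
   \sum_(k | ~~ dr k && (out (inr k) == o) && (p k == y)) mass k + pieces o y.
  rewrite /pieces exchange_big /= -big_split /= [X in _ <= X + _]big_mkcondr -big_split /=.
  by apply: leq_sum => k _; apply: piece_step.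
apply: leq_trans (leq_add H1 (leqnn _)); rewrite addnCA addnC [X in _ <= X]addnAC leq_add2r.
by apply: leq_trans (leq_add H2 (leqnn _)) _; rewrite -!addnA leq_add2l.
Qed.

Lemma pieces_drop z t y : sub y z -> pieces (inr (z, t)) y = 0.
Proof.
move=> yz; apply: big1 => k /andP[dk /eqP ok]; rewrite /piece.
by rewrite (sub_trans yz (part_sub (e := inr k) dk ok)).
Qed.

Lemma pieces_gt0 o y : 0 < pieces o y -> exists k i,
  [/\ ~~ dr k, out (inr k) = o, inb k i, sub y (loc i) & 0 < piece k y].
Proof.
case/sum_gt0=> k /andP[dk /eqP ok] pk; move: (pk); rewrite /piece; case: ifP => // _.
by case/sum_gt0=> i /andP[Pi yi] _; exists k, i.
Qed.

(** A tour made from a dropped part is filled up to [Q] above the node of the drop, so that it shows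
    only the size [Q] there. *)
Definition cover_part o y :=
  if big_part o then (if above par o y then Q else D o y + pieces o y) else 0.

(** Strictly above the node [z] of a drop, the tour picks up no item, and the child towards [z] is
    the only one it covers. *)
Lemma cover_part_super o y :
  \sum_(i | (dest i == Some o) && (loc i == y)) a i
    + \sum_(c | child y c) cover_part o c <= cover_part o y.
Proof.
rewrite /cover_part; case bo: (big_part o); last first.
  by rewrite !big1 // => i /andP[/eqP/dest_big]; rewrite bo.
case: (boolP (above par o y)) => [ab|nab]; last first.
  apply: leq_trans (below_super nab); rewrite leq_add2l; apply: leq_sum => c cy.
  by rewrite (negbTE (above_child cy nab)).
case: o bo ab => // -[z t] bo /= /andP[yz ne].
have [c0 cy cz] := child_exists par_r reach yz ne.
have nzy : ~~ sub z y by apply: contra ne => zy; apply/eqP/(sub_anti par_r reach).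
rewrite big1 ?add0n; last first.
  move=> i /andP[di /eqP li]; exfalso; move: di; rewrite /dest.
  case es: (src i) => [e|] //; case: ifP => // _ /eqP[oe]; have [ke li' _] := srcP es.
  by case/negP: nzy; rewrite -li; apply: sub_trans (part_sub ke oe) li'.
rewrite (bigD1 c0) //= big1 ?addn0.
  case: ifP => // nab; case: (eqVneq c0 z) => [e|ne']; last by move: nab; rewrite cz ne'.
  by rewrite pieces_drop ?e ?sub_refl // addn0.
move=> c /andP[c_y ne']; have nc x : sub c x -> sub c0 x -> False.
  by move=> cx c0x; move: ne'; rewrite (child_uniq par_r reach c_y cy cx c0x) eqxx.
case: ifP => [/andP[/nc/(_ cz)]//|_].
have -> : D (inr (z, t)) c = 0.
  apply/eqP; rewrite -leqn0 leqNgt; apply/negP => /D_drop zc.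
  exact: nc (sub_refl _ _) (sub_trans cz zc).
apply/eqP; rewrite add0n -leqn0 leqNgt; apply/negP => /pieces_gt0[k [i [dk ok Pi ci _]]].
apply: nc ci (sub_trans cz _); apply: sub_trans (bundle_sub Pi).
exact: (part_sub (e := inr k) dk ok).
Qed.

Lemma cover_part_root o : cover_part o r <= Q.
Proof.
rewrite /cover_part; case: ifP => // _; case: ifP => // _.
by rewrite /pieces big1 ?addn0 // => k _; rewrite /piece (sub_root reach).
Qed.

Lemma cover_part_gt0 o y : 0 < cover_part o y -> exists i, sub y (loc i).
Proof.
have De u : 0 < D o u -> exists i, sub u (loc i).
  by case/D_gt0=> e ke ye; have [i ei _] := item_below ke; exists i; apply: sub_trans ei.
rewrite /cover_part; case: ifP => // bo; case: ifP => [|_].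
  case: o bo De => // -[z t] /= bz De /andP[yz _] _.
  have [|i zi] := De z; first by apply: leq_trans bz; apply: leq_trans UW.
  by exists i; apply: sub_trans zi.
case: (posnP (D o y)) => [->|/De//]; rewrite add0n => /pieces_gt0[k [i [_ _ _ yi _]]].
by exists i.
Qed.

Lemma mu_sum_ge (P : pred 'I_K) y :
  \sum_(i | (a i < U) && (if blk i is Some k then P k else false) && sub y (loc i)) a i
    <= \sum_(k | P k) mu k y.
Proof.
rewrite /mu (exchange_big_dep predT) //= [X in X <= _]big_mkcond; apply: leq_sum => i _.
case: ifP => // /andP[/andP[ai Pk] yi]; case eb: (blk i) Pk => [k|//] Pk.
by rewrite (bigD1 k) /= ?leq_addr // Pk /in_bundle ai eb eqxx.
Qed.

Definition small_parts y := [set o | ~~ big_part o && (0 < D o y)].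
Definition pool_mass y := \sum_(i | pooled i && sub y (loc i)) a i.

(** If [z] lies in [T_y], the part is charged to the tokens dropped there. If [y] lies below [z] and
    the part has items in [T_y], it crosses the edge above [y], and its weight is below [W]. *)
Lemma small_part_le z t y : ~~ big_part (inr (z, t)) ->
  \sum_(e | (kp e && (out e == inr (z, t))) && sub y (lc e)) wt e <=
  (if 0 < D (inr (z, t)) y then W else 0) + (if sub y z then D (inr (z, t)) z else 0).
Proof.
rewrite /= -ltnNge => small.
have le1 : \sum_(e | (kp e && (out e == inr (z, t))) && sub y (lc e)) wt e <= D (inr (z, t)) z.
  by apply: leq_trans (parts_drop z t); apply: leq_sumW => e /andP[].
case: (boolP (sub y z)) => [_|yz']; first by rewrite (leq_trans le1) ?leq_addl.
case: ifP => yz; first by rewrite addn0 (leq_trans le1) // ltnW.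
rewrite leqNgt; apply/negP => /sum_gt0[e /andP[/andP[ke /eqP oe] ye] we].
have ze := part_sub ke oe.
case: (leqP (dep y) (dep z)) => [|/ltnW] d; have sc := sub_comp par_r reach _ _ d.
  by rewrite (sc _ ye ze) in yz'.
have zy := sc _ ze ye; suff : 0 < D (inr (z, t)) y by rewrite yz.
apply: leq_trans we (leq_trans _ (parts_le (o := inr (z, t)) (y := y) _)).
  by rewrite (bigD1 e) /= ?ke ?oe ?eqxx ?ye // leq_addr.
by move=> u yu; apply/above_anti/sub_trans/yu.
Qed.

Lemma card_dropped y : #|[set k | dr k && sub y (p k)]| <= visits y.
Proof.
rewrite -(card_in_imset (f := hk)); last first.
  by move=> k k'; rewrite !inE => /andP[dk _] /andP[dk' _]; apply: dr_inj.
apply: subset_leq_card; apply/subsetP => t /imsetP[k]; rewrite !inE => /andP[_ yk] ->.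
have [i [Pi ti ai]] := hkP k; rewrite /oload (bigD1 i) /= ?ti ?eqxx ?ltn_addr //.
exact: sub_trans yk (bundle_sub Pi).
Qed.

Lemma drop_pairs y : \sum_(q | sub y q.1) D (inr q) q.1 <= M y.
Proof.
apply: leq_trans (D_sum y); rewrite (pair_big_dep _ (fun _ _ => true)) /=.
by apply/eq_leq/eq_big => [q|[z t]]; rewrite ?andbT.
Qed.

Lemma small_weight y :
  \sum_(e | (kp e && ~~ big_part (out e)) && sub y (lc e)) wt e <= #|small_parts y| * W + M y.
Proof.
rewrite (partition_big out (fun o => ~~ big_part o)) /=; last by move=> e /andP[/andP[_ ->]].
apply: (@leq_trans (\sum_(o | ~~ big_part o) ((if 0 < D o y then W else 0) +
    (if o is inr (z, t) then if sub y z then D o z else 0 else 0)))).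
  apply: leq_sum => -[//|[z t]] bo; apply: leq_trans (small_part_le y bo).
  by apply: leq_sumW => e /andP[/andP[/andP[-> _] ->] ->].
rewrite big_split /=; apply: leq_add.
  by rewrite -big_mkcondr -sum_nat_const; apply: leq_sumW => o; rewrite inE.
apply: leq_trans (drop_pairs y); rewrite big_mkcond big_sumType /= big1 // add0n [X in _ <= X]big_mkcond.
by apply: leq_sum => -[z t] _ /=; case: ifP => // _; case: ifP.
Qed.

(** The pool consists of the unbundled rest (at most [U.-1]), the dropped bundles (at most one of
    mass [2 * U.-1] per visiting tour) and the small dropped parts; the pieces of straddling bundles
    add at most [4 * U.-1]. *)
Lemma pool_mass_le y :
  pool_mass y <= 2 * visits y * U.-1 + 5 * U.-1 + (#|small_parts y| * W + M y).
Proof.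
have mu_le k : mu k y <= piece k y + (if sub y (p k) then mass k else 0).
  by rewrite /piece; case: ifP => _; rewrite ?mu_mass // addn0.
have drM : \sum_(k | dr k) (if sub y (p k) then mass k else 0) <= 2 * visits y * U.-1.
  rewrite -big_mkcondr; apply: (@leq_trans (\sum_(k in [set k | dr k && sub y (p k)]) 2 * U.-1)).
    by rewrite big_mkcond [X in _ <= X]big_mkcond; apply: leq_sum => k _; rewrite inE; case: ifP.
  by rewrite sum_nat_const mulnCA mulnA leq_mul2r leq_mul2l card_dropped !orbT.
have sw := small_weight y; rewrite big_sumType /= in sw.
apply: (@leq_trans (\sum_(i | (a i < U) && (blk i == None)) a i +
  \sum_(k | dr k) mu k y +
  (\sum_(i | (U <= a i) && ~~ big_part (out (inl i)) && sub y (loc i)) a i +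
   \sum_(k | ~~ dr k && ~~ big_part (out (inr k))) mu k y))).
  apply: leq_trans (leq_add (leq_add (leqnn _) (mu_sum_ge _ y)) (leq_add (leqnn _) (mu_sum_ge _ y))).
  rewrite /pool_mass ![X in _ <= X + _ + _]big_mkcond ![X in _ <= _ + X + _]big_mkcond.
  rewrite ![X in _ <= _ + (X + _)]big_mkcond ![X in _ <= _ + (_ + X)]big_mkcond.
  rewrite -!big_split /= [X in X <= _]big_mkcond; apply: leq_sum => i _.
  case: ifP => // /andP[]; rewrite /pooled /dest /src => + ->; rewrite !andbT.
  case: (leqP U (a i)) => ui /=; first by case: (big_part _) => //=; lia.
  case eb: (blk i) => [k|] /=; last by lia.
  by case: (dr k) => /=; [lia | case: (big_part _) => //=; lia].
have sP (P : pred 'I_K) : \sum_(k | P k) mu k y <=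
    \sum_(k | P k) piece k y + \sum_(k | P k && sub y (p k)) mass k.
  rewrite [X in _ <= _ + X]big_mkcondr -big_split; exact: leq_sum.
have pS : \sum_(k | dr k) piece k y + \sum_(k | ~~ dr k && ~~ big_part (out (inr k))) piece k y
    <= 4 * U.-1.
  apply: leq_trans (sum_piece y); rewrite [X in _ <= X](bigID dr) /= leq_add2l.
  by apply: leq_sumW => k /andP[].
rewrite -big_mkcondr in drM.
have H1 := sP dr; have H2 := sP (fun k => ~~ dr k && ~~ big_part (out (inr k))).
move: rest_le H1 H2 pS drM sw.
set x1 := \sum_(i | _) _; set x2 := \sum_(k | dr k) mu k y; set x3 := \sum_(k | dr k) piece k y.
set x4 := \sum_(k | dr k && _) _; set x5 := \sum_(k | ~~ dr k && _) mu k y.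
set x6 := \sum_(k | ~~ dr k && _) piece k y; set x7 := \sum_(i | _ && _ && _) a i.
set x8 := \sum_(k | _ && _) mass k.
move: (2 * visits y * U.-1) (#|small_parts y| * W + M y) => c1 c2; lia.
Qed.

Lemma straddle_card y : #|[set o | 0 < pieces o y]| <= 2.
Proof.
pose A := [set k | (Some k == k1 y) || (Some k == k2 y)].
apply: (@leq_trans #|(fun k => out (inr k)) @: A|).
  apply: subset_leq_card; apply/subsetP => o; rewrite inE.
  case/pieces_gt0=> k [i [_ <- _ _ /piece_straddle pk]]; apply: imset_f.
  by rewrite inE; case: pk => ->; rewrite eqxx ?orbT.
apply: leq_trans (leq_imset_card _ _) _.
have one (x : option 'I_K) : \sum_(k | Some k == x) 1 <= 1 by apply: (sum_some_le (F := fun=> 1)).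
apply: leq_trans (leq_add (one (k1 y)) (one (k2 y))).
rewrite -sum1_card [X in X <= _]big_mkcond [X in _ <= X + _]big_mkcond [X in _ <= _ + X]big_mkcond.
by rewrite -big_split; apply: leq_sum => k _; rewrite inE; case: eqP; case: eqP.
Qed.

(** A small dropped part that crosses into [T_y] no longer needs a tour of its own there. The
    vacated place is a credit of [W], which pays for the same part in [pool_mass_le]. *)
Lemma cover_part_card y :
  W * #|[set o | 0 < cover_part o y]| + #|small_parts y| * W <= W * (visits y + 2) + M y.
Proof.
pose Sa := [set o | big_part o && (0 < D o y)].
pose Sc := [set o : Tt + V * Tt | big_part o && above par o y].
have sub3 : [set o | 0 < cover_part o y] \subset Sa :|: [set o | 0 < pieces o y] :|: Sc.
  apply/subsetP => o; rewrite !inE /cover_part; case: (big_part o) => //=.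
  by case: (above par o y) => /=; rewrite ?orbT // addn_gt0 orbF.
have c3 := subset_leq_card sub3.
have [u1 _] := leq_card_setU (Sa :|: [set o | 0 < pieces o y]) Sc.
have [u2 _] := leq_card_setU Sa [set o | 0 < pieces o y].
have c2 := straddle_card y.
have ca : #|Sa| + #|small_parts y| <= visits y.
  apply: leq_trans (D_card y); rewrite -[X in _ <= X](cardsID [set o | big_part o]).
  by apply/eq_leq; congr (_ + _); apply: eq_card => o; rewrite !inE // andbC.
have cc : W * #|Sc| <= M y.
  apply: leq_trans (drop_pairs y); rewrite mulnC -sum_nat_const big_mkcond big_sumType /=.
  rewrite big1 ?add0n; last by move=> t _; rewrite inE andbF.
  rewrite [X in _ <= X]big_mkcond; apply: leq_sum => -[z t] _ /=.
  by rewrite inE /=; case: ifP => // /andP[le /andP[-> _]].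
by move: c3 u1 u2 c2 ca cc; nia.
Qed.

Section Pooled.
Variables (K2 : nat) (blk2 : I -> option 'I_K2) (q1 q2 : V -> option 'I_K2).
Notation tot k := (\sum_(i | pooled i && (blk2 i == k)) a i).
Hypotheses (tot_ge : forall k, W <= tot (Some k)) (tot_le : forall k, tot k <= 2 * W.-1)
  (straddle2 : forall y i i', pooled i -> pooled i' -> blk2 i = blk2 i' ->
     sub y (loc i) -> ~~ sub y (loc i') -> blk2 i = q1 y \/ blk2 i = q2 y).

Definition pm k y := \sum_(i | (pooled i && (blk2 i == k)) && sub y (loc i)) a i.

Definition cover_pool k y := if (0 < pm k y) && (pm k y == tot k) then Q else pm k y.

Lemma pm_le k y : pm k y <= tot k.
Proof. by apply: leq_sumW => i /andP[]. Qed.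

Lemma pm_Q k y : pm k y <= Q.
Proof. exact: leq_trans (pm_le k y) (leq_trans (tot_le k) WQ). Qed.

Lemma cover_pool_Q k y : cover_pool k y <= Q.
Proof. by rewrite /cover_pool; case: ifP => // _; apply: pm_Q. Qed.

Lemma pm_cover k y : pm k y <= cover_pool k y.
Proof. by rewrite /cover_pool; case: ifP => // _; apply: pm_Q. Qed.

(** If a child already contains the whole pool, nothing is left for the rest of [T_y] and the value
    [Q] passes up unchanged. *)
Lemma cover_pool_super k y :
  \sum_(i | (pooled i && (blk2 i == k)) && (loc i == y)) a i
    + \sum_(c | child y c) cover_pool k c <= cover_pool k y.
Proof.
have pmE := sum_subtree_dep par_r reach (fun i => pooled i && (blk2 i == k)) loc a y.
rewrite -/(pm k y) in pmE.
case: (pickP [pred c | child y c && ((0 < pm k c) && (pm k c == tot k))]) => [c0|no].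
  case/and3P=> cy pc /eqP ec; move: pmE; rewrite (bigD1 c0) //= -/(pm k c0) => pmE.
  have := pm_le k y => le.
  have i0 : \sum_(i | (pooled i && (blk2 i == k)) && (loc i == y)) a i = 0 by lia.
  have z0 : \sum_(c | child y c && (c != c0)) pm k c = 0 by rewrite /pm; lia.
  have ey : pm k y = tot k by lia.
  rewrite i0 (bigD1 c0) //= big1 ?addn0; last first.
    move=> c cc; have p0 : pm k c = 0.
      by apply/eqP; move/eqP: z0; rewrite sum_nat_eq0 => /forall_inP; apply.
    by rewrite /cover_pool p0.
  by rewrite add0n /cover_pool ey -ec pc eqxx.
apply: leq_trans (pm_cover k y); rewrite pmE leq_add2l; apply: leq_sum => c cy.
by have := no c; rewrite /= cy /= /cover_pool => ->.
Qed.

Lemma cover_pool_gt0 k y : 0 < cover_pool k y -> 0 < pm k y.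
Proof. by rewrite /cover_pool; case: ifP => // /andP[]. Qed.

Lemma pm_straddle k y : 0 < pm k y -> pm k y != tot k -> k = q1 y \/ k = q2 y.
Proof.
case/sum_gt0=> i /andP[/andP[Zi /eqP ei] yi] _ ne.
have : 0 < \sum_(i | (pooled i && (blk2 i == k)) && ~~ sub y (loc i)) a i.
  rewrite lt0n; apply: contra ne => /eqP e0; apply/eqP.
  by rewrite /pm [RHS](bigID (fun i => sub y (loc i))) /= e0 addn0.
case/sum_gt0=> i' /andP[/andP[Zi' /eqP ei'] nyi'] _; rewrite -{1 2}ei.
by apply: (straddle2 (y := y) Zi Zi') => //; rewrite ei ei'.
Qed.

(** A pool contained in [T_y] accounts for at least [W] of [pool_mass y]. The exceptions are the
    unfinished pool and the two straddling ones. *)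
Lemma cover_pool_card y : W * #|[set k | 0 < cover_pool k y]| <= 3 * W + pool_mass y.
Proof.
pose T := [set k | (0 < pm k y) && (pm k y == tot k)].
have subT : [set k | 0 < cover_pool k y] \subset T :|: [set q1 y; q2 y].
  apply/subsetP => k; rewrite !inE => /cover_pool_gt0 pk; rewrite pk /=.
  by case: eqP => //= /eqP /(pm_straddle pk)[->|->]; rewrite eqxx ?orbT.
have c1 := subset_leq_card subT; have [c2 _] := leq_card_setU T [set q1 y; q2 y].
have c3 : #|[set q1 y; q2 y]| <= 2 by rewrite cards2; case: (_ != _).
have cT : W * #|T| <= W + pool_mass y.
  have -> : pool_mass y = \sum_k pm k y.
    rewrite /pool_mass (partition_big blk2 predT) //=; apply: eq_bigr => k _.
    by apply: eq_bigl => i; rewrite andbAC.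
  rewrite mulnC -sum_nat_const big_mkcond (bigD1 (None : option 'I_K2)) //=.
  rewrite [X in _ <= _ + X](bigD1 (None : option 'I_K2)) //=; apply: leq_add; first by case: ifP.
  apply: leq_trans (leq_addl _ _); apply: leq_sum => -[k|//] _.
  by rewrite inE; case: ifP => // /andP[_ /eqP ->]; apply: tot_ge.
by move: c1 c2 c3 cT; nia.
Qed.

Definition assign i : (Tt + V * Tt) + option 'I_K2 :=
  if dest i is Some o then inl o else inr (blk2 i).

Definition cover (j : (Tt + V * Tt) + option 'I_K2) y :=
  match j with inl o => cover_part o y | inr k => cover_pool k y end.

Lemma cover_super j y :
  \sum_(i | (assign i == j) && (loc i == y)) a i + \sum_(c | child y c) cover j c <= cover j y.
Proof.
case: j => [o|k] /=; [move: (cover_part_super o y) | move: (cover_pool_super k y)];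
  apply: leq_trans; rewrite leq_add2r; apply: leq_sumW => i /andP[+ ->] _;
  rewrite andbT /assign /pooled; case: (dest i) => [o'|] //=.
Qed.

Lemma cover_root j : cover j r <= Q.
Proof. by case: j => [o|k]; [apply: cover_part_root | apply: cover_pool_Q]. Qed.

Lemma cover_gt0 j y : 0 < cover j y -> exists i, sub y (loc i).
Proof.
case: j => [o|k] /=; first exact: cover_part_gt0.
by move=> /cover_pool_gt0/sum_gt0[i /andP[_ yi] _]; exists i.
Qed.

(** The credits for small dropped parts cancel. The constant 10 is 2 for parts holding a straddling
    bundle, 3 for the exceptional pools and 5 for the terms [5 * U.-1], as [U <= W]. *)
Lemma cover_card y : W * #|[set j | 0 < cover j y]|
  <= W * (visits y + 10) + 2 * M y + 2 * visits y * U.-1.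
Proof.
have -> : #|[set j | 0 < cover j y]| = #|[set o | 0 < cover_part o y]| + #|[set k | 0 < cover_pool k y]|.
  by rewrite -!sum1_card big_sumType /=; congr (_ + _); apply: eq_bigl => x; rewrite !inE.
have h1 := cover_part_card y; have h2 := cover_pool_card y; have h3 := pool_mass_le y.
have u5 : 5 * U.-1 <= 5 * W by rewrite leq_mul2l /= (leq_trans (leq_pred _)).
move: h1 h2 h3 u5; rewrite !mulnDr.
move: (2 * visits y * U.-1) (#|small_parts y| * W) (W * visits y) => x1 x2 x3.
lia.
Qed.

Definition part_value (x : option 'I_K) y : seq nat :=
  if x is Some k then [:: cover_part (out (inr k)) y] else [::].

(** Besides the regrouped sizes there are at most five: [Q], two straddling pools, and the tours
    that hold the two straddling bundles. *)
Definition cover_vals y i : seq nat :=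
  [:: Q, cover_pool (q1 y) y, cover_pool (q2 y) y &
    part_value (k1 y) y ++ part_value (k2 y) y ++ vals y i].

Lemma cover_vals_size y i : size (cover_vals y i) <= size (vals y i) + 5.
Proof.
rewrite /= !size_cat; have s1 x : size (part_value x y) <= 1 by case: x.
by have := s1 (k1 y); have := s1 (k2 y); lia.
Qed.

Lemma cover_valsP j y : 0 < cover j y -> cover j y \in cover_vals y (beta (cover j y)).
Proof.
rewrite /cover_vals; case: j => [o|k] /=; last first.
  move=> /cover_pool_gt0 pk; rewrite {1}/cover_pool pk /=.
  case: eqP => [_|/eqP ne]; first by rewrite !inE eqxx.
  have -> : pm k y = cover_pool k y by rewrite /cover_pool (negbTE ne) andbF.
  by rewrite !inE; case: (pm_straddle pk ne) => <-; rewrite eqxx !orbT.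
case: (posnP (pieces o y)) => [p0|/pieces_gt0[k [i [_ ok _ _ /piece_straddle pk]]] _]; last first.
  have pv : cover_part o y \in part_value (Some k) y by rewrite /part_value ok inE.
  by rewrite !inE !mem_cat; case: pk => <-; rewrite pv !orbT.
rewrite /cover_part p0 addn0; case: ifP => // _; case: ifP => _; first by rewrite !inE eqxx.
by move=> /D_vals h0; rewrite !inE !mem_cat h0 !orbT.
Qed.
End Pooled.
End Packing.
End Assembly.

Theorem repacking : exists (J : finType) (f : I -> J) (cov : J -> V -> nat)
    (vals : V -> nat -> seq nat) (M1 M2 : V -> nat),
  [/\ forall j y, \sum_(i | (f i == j) && (loc i == y)) a i + \sum_(c | child y c) cov j c
        <= cov j y,
      (forall j, cov j r <= Q) /\ (forall j y, 0 < cov j y -> exists i, sub y (loc i)),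
      forall y, W * #|[set j | 0 < cov j y]|
        <= W * (visits y + 10) + 2 * (M1 y + M2 y) + 2 * visits y * U.-1,
      (forall j y, 0 < cov j y -> cov j y \in vals y (beta (cov j y))) /\
      (forall y i, size (vals y i) <= 2 * g1 + 4 * (bb * g2) + 5)
    & forall y, g1 * M1 y <= K0 * ((h %/ (bb * bb)).+1 * (Q * visits y)) /\
                g2 * M2 y <= K0 * (2 * (Q %/ U) * (Q * visits y))].
Proof.
have [K [blk [p [hk [dr [k1 [k2 [[mU mle rest] pP hkP [dri hkl] str]]]]]]]] :=
  bundles par_r reach a loc tr U0.
have [out [D [vals [M1 [M2 [[Di Ds Dle Dgt Dc] [Dv vsz] Dd DM MM]]]]]] :=
  regroup par_r reach (te := te hk) U0 (fun e => @kp_wt K blk dr mU e) bb0 g10 g20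
   (load_root p hkl) betaK depP.
have [K2 [blk2 [tot_ge tot_le _ str2]]] :=
  pool par_r reach loc (leq_trans U0 UW) (fun i (h : pooled blk dr out D i) => pooled_lt pP Di Ds Dd h).
have [q1 q1P] := choice str2; have [q2 q2P] := choice q1P.
have Dc' y : #|[set o | 0 < D o y]| <= visits y.
  by eapply leq_trans; [exact: Dc | eapply load_card; eassumption].
exists ((Tt + V * Tt) + option 'I_K2)%type, (assign blk dr out D blk2), (cover blk p dr out D blk2),
  (cover_vals blk p dr k1 k2 out D vals blk2 q1 q2), M1, M2; split.
- by move=> j y; eapply cover_super; eassumption.
- split=> [j|j y]; first by eapply cover_root; eassumption.
  by eapply cover_gt0; eassumption.
- move=> y; pose M y := M1 y + M2 y; rewrite -/(M y).
  by eapply cover_card; eassumption.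
- split=> [j y c0|y i]; first by eapply cover_valsP; eassumption.
  by eapply leq_trans; [eapply cover_vals_size | rewrite leq_add2r].
move=> y; have [h1 h2] := MM y; have sl : \sum_t load par (kp dr) (wt blk) (lc p) (te hk) t y <= Q * visits y.
  by eapply sum_load; eassumption.
split; [apply: leq_trans h1 _ | apply: leq_trans h2 _];
  by rewrite !leq_mul2l sl !orbT.
Qed.
End Core.

(** * Subtrees crossed by few tours *)

Section Shrink.
Variables (V : finType) (par : V -> V) (r : V).
Hypotheses (par_r : par r = r) (reach : forall v, fconnect par v r).
Notation sub := (sub par).
Notation dep := (dep par r).
Notation child := (child par r).
Variables (Tt : finType) (p : Tt -> V -> nat).
Variables (U W Q bb g1 g2 K0 h : nat) (beta : nat -> nat) (N0 : nat).
Hypotheses (U0 : 0 < U) (UW : U <= W) (WQ : 2 * W.-1 <= Q).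
Hypotheses (bb0 : 0 < bb) (g10 : 0 < g1) (g20 : 0 < g2).
Hypothesis betaK : forall x y, 0 < x <= Q -> 0 < y <= Q -> beta x = beta y -> y <= K0 * x.
Hypothesis depP : forall x, dep x <= h.

Definition coverage_of (q : V -> nat) v := \sum_(u | sub v u) q u.
Definition crossing (T0 : finType) (q : T0 -> V -> nat) v := #|[set t | 0 < coverage_of (q t) v]|.

Hypothesis p_le : forall t, coverage_of (p t) r <= Q.

Let n v := crossing p v.
Let B := [pred v | N0 < n v].

Hypothesis Br : r \in B.

Lemma crossing_mono y x : sub y x -> n x <= n y.
Proof.
move=> yx; apply: subset_leq_card; apply/subsetP => t; rewrite !inE => /sum_gt0[u xu pu].
by rewrite /coverage_of (bigD1 u) /= ?ltn_addr //; apply: sub_trans yx xu.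
Qed.

Lemma big_up y x : sub y x -> x \in B -> y \in B.
Proof. by move=> /crossing_mono yx; rewrite !inE => /leq_trans; apply. Qed.

(* [rho u] is the root of the maximal subtree with few tours containing [u], if there is one;
   tours visit such a subtree as in the given solution. *)
Lemma regions_exist : exists rho : V -> V, forall u,
  (u \in B -> rho u = u) /\ (u \notin B -> [/\ rho u \notin B, par (rho u) \in B & sub (rho u) u]).
Proof.
have ex u : exists x, (u \in B -> x = u) /\ (u \notin B -> [/\ x \notin B, par x \in B & sub x u]).
  elim/(up_ind reach): u => [|u ur [x [IH1 IH2]]].
    by exists r; split=> //; rewrite Br.
  case uB: (u \in B); first by exists u.
  case puB: (par u \in B).
    by exists u; split=> // _; rewrite uB puB sub_refl.
  exists x; split=> // _; have [|xB pxB xu] := IH2 _; first by rewrite puB.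
  by split=> //; apply: sub_trans xu (sub_par _ _).
by have [rho] := choice ex; exists rho.
Qed.

Theorem sparse_repacking : exists (J : finType) (q : J -> V -> nat) (vals : V -> nat -> seq nat)
    (M1 M2 : V -> nat),
  [/\ forall j, coverage_of (q j) r <= Q,
      forall u, \sum_t p t u <= \sum_j q j u,
      forall v, n v <= N0 -> crossing q v <= n v,
      forall v, N0 < n v ->
        [/\ W * crossing q v <= W * (n v + 10) + 2 * (M1 v + M2 v) + 2 * n v * U.-1,
            g1 * M1 v <= K0 * ((h %/ (bb * bb)).+1 * (Q * n v))
          & g2 * M2 v <= K0 * (2 * (Q %/ U) * (Q * n v))]
    & forall v, N0 < n v -> forall i,
        (forall j, 0 < coverage_of (q j) v ->
          coverage_of (q j) v \in vals v (beta (coverage_of (q j) v))) /\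
        size (vals v i) <= 2 * g1 + 4 * (bb * g2) + 5].
Proof.
have [rho rhoP] := regions_exist.
have rho_sub v u : v \notin B -> sub v u -> rho u = rho v.
  move=> vB vu; have uB : u \notin B by apply: contra vB; apply: big_up.
  have [[_ /(_ uB)[xB pxB xu]] [_ /(_ vB)[yB pyB yv]]] := (rhoP u, rhoP v).
  have yu := sub_trans yv vu.
  have anti x1 x2 : x1 \notin B -> par x2 \in B -> sub x1 x2 -> x1 = x2.
    move=> x1B px2 s12; apply/eqP; apply: contraNT x1B => ne.
    by have [_ s] := sub_strict par_r s12 ne; apply: big_up s px2.
  case: (leqP (dep (rho u)) (dep (rho v))) => [le|/ltnW le].
    exact: anti (sub_comp par_r reach xu yu le).
  by apply/esym/anti => //; apply: (sub_comp par_r reach yu xu le).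
(* A visit of a sparse subtree becomes an item at the parent of its root, the lowest node at which
   tours are rearranged. *)
pose lo u := if u \in B then u else par (rho u).
have loB u : lo u \in B.
  by rewrite /lo; case: ifP => // /negbT uB; have [_ /(_ uB)[]] := rhoP u.
have lo_rho u : lo (rho u) = lo u.
  rewrite /lo; case uB: (u \in B); first by have [/(_ uB) -> _] := rhoP u; rewrite uB.
  have [_ /(_ (negbT uB))[xB _ xu]] := rhoP u.
  by rewrite (negbTE xB) -(rho_sub _ _ xB xu).
have sub_lo y u : y \in B -> sub y u = sub y (lo u).
  rewrite /lo; case uB: (u \in B) => // yB.
  have [_ /(_ (negbT uB))[xB pxB xu]] := rhoP u.
  apply/idP/idP => [yu|ypx]; last first.
    exact: sub_trans ypx (sub_trans (sub_par _ _) xu).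
  have yx : sub y (rho u).
    case: (leqP (dep y) (dep (rho u))) => [le|/ltnW le]; first exact: (sub_comp par_r reach yu xu).
    by case/negP: xB; apply: big_up yB; apply: (sub_comp par_r reach xu yu).
  have [] // := sub_strict par_r yx _.
  by apply: contraTneq yB => ->.
pose a (i : Tt * V) := \sum_(u | rho u == i.2) p i.1 u.
pose loc (i : Tt * V) := lo i.2.
have sum_items (P : Tt * V -> bool) (L : pred V) :
   \sum_(i | P i && L (loc i)) a i = \sum_(u | L (lo u)) \sum_(t | P (t, rho u)) p t u.
  have -> : \sum_(i | P i && L (loc i)) a i = \sum_t \sum_(x | P (t, x) && L (lo x)) a (t, x).
    by rewrite [RHS]pair_big_dep; apply: eq_big => [[t x]|[t x]].
  rewrite (exchange_big_dep (fun x => L (lo x))) /=; last by move=> t x _ /andP[].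
  rewrite [RHS](partition_big rho (fun x => L (lo x))) /=; last by move=> u; rewrite lo_rho.
  apply: eq_bigr => x Lx; rewrite /a /=.
  rewrite [LHS](eq_bigl (fun t => P (t, x))); last by move=> t; rewrite Lx andbT.
  rewrite exchange_big /=; apply: eq_big => [u|u /eqP ->] //.
  by case: eqP => [e|]; rewrite ?andbF // -lo_rho e Lx.
have oloadE t y : y \in B -> oload par a loc fst t y = coverage_of (p t) y.
  move=> yB; rewrite /oload (sum_items (fun i => i.1 == t) (sub y)) /=.
  by apply: eq_big => [u|u _]; [rewrite -(sub_lo _ _ yB) | apply: big_pred1_eq].
have [|J [f [cv [vals [M1 [M2 [sup [cvQ cv0] cnt [valP vsz] MM]]]]]]] :=
  @repacking _ par r par_r reach _ _ a loc fst U W Q bb g1 g2 K0 h beta U0 UW WQ bb0 g10 g20 _ betaK depP.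
  by move=> t; rewrite oloadE.
have visE y : y \in B -> visits par a loc fst y = n y.
  by move=> yB; apply: eq_card => t; rewrite !inE oloadE.
pose it j u := \sum_(i | (f i == j) && (loc i == u)) a i.
pose pad j u := cv j u - (it j u + \sum_(c | child u c) cv j c).
(* The picks of a tour in a class of [rho] move together, and by [pad0] new tokens are added only at
   nodes of [B]. *)
pose q j u := \sum_(t | f (t, rho u) == j) p t u + pad j u.
have covE j y : y \in B -> coverage_of (q j) y = cv j y.
  move=> yB; rewrite -(pad_exact par_r reach (sup j) y) /coverage_of !big_split /=; congr (_ + _).
  rewrite (partition_big lo (sub y)) /=; last by move=> u; rewrite -sub_lo.
  apply: eq_bigr => x yx; rewrite (sum_items (fun i => f i == j) (pred1 x)) /=.
  by apply: eq_bigl => u; case: eqP => [e|]; rewrite ?andbF // andbT sub_lo // e yx.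
have pad0 j u : u \notin B -> pad j u = 0.
  move=> uB; suff c0 : cv j u = 0 by rewrite /pad c0.
  apply/eqP; rewrite -leqn0 leqNgt; apply: contra uB => /cv0[i ui].
  exact: big_up ui (loB _).
exists J, q, vals, M1, M2; split.
- by move=> j; rewrite covE.
- move=> u; rewrite /q big_split /=; apply: leq_trans (leq_addr _ _).
  by apply: eq_leq; rewrite [LHS](partition_big (fun t => f (t, rho u)) predT).
- move=> v vN; have vB : v \notin B by rewrite inE -leqNgt.
  (* Inside [T_v] the map [rho] is constant, so a new tour takes over whole visits of old tours and
     their number cannot grow. *)
  have cE j : coverage_of (q j) v = \sum_(t | f (t, rho v) == j) coverage_of (p t) v.
    rewrite exchange_big /=; apply: eq_bigr => u vu; rewrite /q (rho_sub _ _ vB vu) pad0 ?addn0 //.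
    by apply: contra vB; apply: big_up.
  apply: leq_trans (leq_imset_card (fun t => f (t, rho v)) _); apply: subset_leq_card.
  apply/subsetP => j; rewrite inE cE => /sum_gt0[t /eqP <- ct]; apply: imset_f.
  by rewrite inE.
- move=> v vB; have [m1 m2] := MM v; rewrite visE // in m1 m2; split=> //.
  have := cnt v; rewrite visE //; apply: leq_trans; rewrite leq_mul2l; apply/orP; right.
  by apply/eq_leq/eq_card => j; rewrite !inE covE.
move=> v vB i; split=> // j; rewrite covE //; exact: valP.
Qed.
End Shrink.

From mathcomp Require Import classical_sets reals exp ring lra.

Import Order.TTheory GRing.Theory Num.Theory.

Local Open Scope ring_scope.

(** * Walks and tours *)

Fixpoint changes (b : bool) (s : seq bool) : nat :=
  if s is c :: s' then ((b != c) + changes c s')%N else 0%N.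

Lemma changes_cat b s1 s2 : changes b (s1 ++ s2) = (changes b s1 + changes (last b s1) s2)%N.
Proof. by elim: s1 b => //= c s1 IH b; rewrite IH addnA. Qed.

Lemma changes_last b s : ((b != last b s) <= changes b s)%N.
Proof.
elim: s b => [|c s IH] b /=; first by rewrite eqxx.
by move: (IH c); case: b; case: c; case: (last _ _) => //=; lia.
Qed.

Lemma changes_ge2 s : true \in s -> last false s = false -> (2 <= changes false s)%N.
Proof.
case/splitPr=> s1 s2; rewrite last_cat changes_cat /= => l.
have h1 := changes_last false s1; have h2 := changes_last true s2.
by move: h1 h2; rewrite l; case: (last false s1) => /=; lia.
Qed.

Section Walks.
Variables (R : realType) (V : finType) (T : wtree R V).
Let r := depot T.
Let par := parent T.
Let par_r : par r = r := parent_depot T.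
Let reach : forall v, fconnect par v r := @depot_reachable _ _ T.

Lemma in_subtree_par v x : x != r -> v != x -> in_subtree T v x = in_subtree T v (par x).
Proof.
move=> xr vx; apply/idP/idP => [sx|sp]; last exact: sub_trans sp (sub_par _ _).
by have [_] := sub_strict par_r sx vx.
Qed.

Lemma par_nsub x : x != r -> ~~ in_subtree T x (par x).
Proof. by move=> xr; apply: (child_nsub par_r reach (y := par x)); rewrite /child xr eqxx. Qed.

Lemma edge_up x : x != r -> edge_weight T x (par x) = weight T x.
Proof. by move=> xr; rewrite /edge_weight -/r -/par xr eqxx. Qed.

Lemma edge_down x : x != r -> edge_weight T (par x) x = weight T x.
Proof.
move=> xr; rewrite /edge_weight -/r -/par; case: ifP => // /andP[pr /eqP e].
have := par_nsub xr; rewrite {1}e => /negP[]; exact: sub_par.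
Qed.

(** Moving along the edge above a node changes the membership in the subtree of that node and in no
    other, so the cost of a walk splits into one count of changes per node. *)
Lemma adj_crossing x y : adj T x y ->
  edge_weight T x y = \sum_v weight T v *+ (in_subtree T v x != in_subtree T v y).
Proof.
have up x' : x' != r ->
    \sum_v weight T v *+ (in_subtree T v x' != in_subtree T v (par x')) = weight T x'.
  move=> xr; rewrite (bigD1 x') //= (negbTE (par_nsub xr)) [in_subtree T x' x'](sub_refl par).
  rewrite big1 ?addr0 // => v vx.
  by rewrite in_subtree_par ?eqxx // eq_sym.
case/orP=> /andP[xr /eqP ->]; first by rewrite edge_up // up.
by rewrite edge_down // -{1}(up _ xr); apply: eq_bigr => v _; rewrite eq_sym.
Qed.

Lemma walk_cost x w : path (adj T) x w ->
  \sum_(c <- pairmap (edge_weight T) x w) c =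
  \sum_v weight T v *+ changes (in_subtree T v x) (map (in_subtree T v) w).
Proof.
elim: w x => [|y w IH] x /=; first by rewrite big_nil big1.
case/andP=> xy yw; rewrite big_cons (IH _ yw) (adj_crossing xy) -big_split.
by apply: eq_bigr => v _; rewrite /= mulrnDr.
Qed.

Lemma tour_cost_ge Q t : is_tour T Q t ->
  \sum_(v | (v != r) && (0 < coverage T t v)%N) weight T v *+ 2 <= tour_cost T t.
Proof.
case/and4P=> pt /eqP lt /forallP st _; rewrite /tour_cost walk_cost //.
rewrite big_mkcond; apply: ler_sum => v _; have w0 := weight_ge0 T v.
case: ifP => [/andP[vr /sum_gt0[u vu pu]]|_]; last exact: mulrn_wge0.
have nr : in_subtree T v r = false.
  apply/negP => vr'; case/eqP: vr; apply: (sub_anti par_r reach) => //; exact: sub_root.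
rewrite ler_wpMn2l // nr; apply: changes_ge2.
  have := st u; rewrite pu /stops inE => /orP[/eqP e|uw].
    by rewrite -[u]/(u) e -/r nr in vu.
  by apply/mapP; exists u.
by rewrite -[false]nr last_map lt.
Qed.

(** Remove a deepest node, walk through the rest, and insert a detour to it at a visit of its
    parent. *)
Lemma closed_walk (X : {set V}) : r \in X -> (forall v, v \in X -> v != r -> par v \in X) ->
  exists w, [/\ path (adj T) r w, last r w = r, forall v, (v \in r :: w) = (v \in X)
    & \sum_(c <- pairmap (edge_weight T) r w) c = \sum_(v in X | v != r) weight T v *+ 2].
Proof.
elim: {X}#|X| {-2}X (leqnn #|X|) => [|n IH] X.
  by rewrite leqn0 cards_eq0 => /eqP ->; rewrite inE.
move=> cX rX clX; case: (pickP [pred v | (v \in X) && (v != r)]) => [v0 v0X|none]; last first.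
  exists [::]; split=> // [v|]; last first.
    by rewrite big_nil big1 // => v; have := none v; rewrite /= => ->.
  rewrite inE; apply/eqP/idP => [->//|vX]; apply/eqP.
  by have := none v; rewrite /= vX => /negbT; rewrite negbK.
case: (arg_maxnP (dep par r) v0X) => v /andP[vX vr] vmax.
have dv := dep_par reach vr.
have pv : par v != v by apply: contraTneq (ltnSn (dep par r v)) => e; rewrite {1}dv e ltnn.
have pX : par v \in X :\ v by rewrite !inE pv clX.
have [||u|w [pw lw iw cw]] := IH (X :\ v).
- by have := cardsD1 v X; rewrite vX; lia.
- by rewrite !inE eq_sym vr.
- rewrite !inE => /andP[uv uX] ur; rewrite clX // andbT; apply/eqP => e.
  have := vmax u; rewrite /= uX ur => /(_ isT); have := dep_par reach ur; rewrite e /=; lia.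
move: pX; rewrite -iw => pX; case/splitPl: pX pw lw iw cw => p1 p2 lp pw lw iw cw.
move: pw; rewrite cat_path => /andP[pw1 pw2].
have av : adj T (par v) v by rewrite /adj -/r -/par vr eqxx orbT.
have va : adj T v (par v) by rewrite /adj -/r -/par vr eqxx.
exists (p1 ++ v :: par v :: p2); split.
- by rewrite cat_path pw1 lp /= av va /=; move: pw2; rewrite lp.
- by move: lw; rewrite !last_cat /= lp.
- move=> u; have := iw u; rewrite !inE !mem_cat !inE; case: (eqVneq u v) => [->|] /=.
    by rewrite !orbT vX.
  by case: (eqVneq u (par v)) => [->|//] /=; rewrite !orbT (clX v).
move: cw; rewrite !pairmap_cat !big_cat /= lp !big_cons edge_up // edge_down // => cw.
have -> : \sum_(u in X | u != r) weight T u *+ 2 =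
    weight T v *+ 2 + \sum_(u in X :\ v | u != r) weight T u *+ 2.
  rewrite (bigD1 v) /= ?vX //; congr (_ + _); apply: eq_bigl => u.
  by rewrite !inE andbC andbA.
by rewrite -cw mulr2n -addrA [LHS]addrCA; congr (_ + _); rewrite [LHS]addrCA; congr (_ + _).
Qed.

Local Notation cov := (coverage_of par).

(** The nodes with picks below them, together with the depot, are closed under parents; the Euler
    walk through them attains the lower bound of [tour_cost_ge]. *)
Lemma tour_of_pick Q (q : V -> nat) : (\sum_v q v <= Q)%N ->
  exists t, [/\ is_tour T Q t, Defs.pick t = q,
    tour_cost T t = \sum_(v | (v != r) && (0 < cov q v)%N) weight T v *+ 2
    & forall v, has (in_subtree T v) (stops T t) = (v == r) || (0 < cov q v)%N].
Proof.
move=> qQ; pose X := [set v | (v == r) || (0 < cov q v)%N].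
have cov_par u v : in_subtree T u v -> (0 < cov q v)%N -> (0 < cov q u)%N.
  move=> uv /sum_gt0[x vx qx]; rewrite /coverage_of (bigD1 x) /= ?ltn_addr //.
  exact: sub_trans uv vx.
have [||w [pw lw iw cw]] := @closed_walk X; first by rewrite inE eqxx.
  move=> v; rewrite !inE => /orP[/eqP -> /eqP//|cv _].
  by rewrite (cov_par _ v) ?orbT //; apply: sub_par.
exists (Tour w q); split=> //.
- apply/and4P; split=> //=; first by rewrite lw.
  apply/forallP => v; apply/implyP => qv; rewrite /stops iw inE.
  by rewrite /coverage_of (bigD1 v) /= ?ltn_addr ?orbT // (sub_refl par).
- rewrite /tour_cost cw; apply: eq_bigl => v; rewrite !inE.
  by case: (eqVneq v r) => //=; rewrite ?andbF ?andbT.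
move=> v; apply/hasP/idP => [[u]|vX]; last first.
  by exists v; rewrite ?iw ?inE //; apply: (sub_refl par).
rewrite /stops iw inE => /orP[/eqP ->|cu] vu.
  by apply/orP; left; apply/eqP/(sub_anti par_r reach) => //; apply: sub_root.
by rewrite (cov_par _ u) ?orbT.
Qed.

(** The condition on [b 0] is due to tours without picks: they still visit the depot and contribute
    a partial size 0 there. *)
Lemma solution_of_picks Q (J : finType) (P : J -> V -> nat) :
    (forall j, \sum_v P j v <= Q)%N ->
  exists S, [/\ is_solution T Q (fun v => \sum_j P j v)%N S,
    cost T S = \sum_(v | v != r) weight T v *+ (2 * #|[set j | 0 < cov (P j) v]|)%N,
    forall v (b : pred nat), b 0%N = false ->
      count b (partial_sizes T S v) = #|[set j | b (cov (P j) v)]|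
    & forall v s, s \in partial_sizes T S v -> (0 < s)%N -> exists j, s = cov (P j) v].
Proof.
move=> PQ; have [t tP] := choice (fun j => tour_of_pick (PQ j)).
pose S := [seq t j | j <- enum J].
have pk j : Defs.pick (t j) = P j by case: (tP j).
have cvE j v : coverage T (t j) v = cov (P j) v by rewrite /coverage /coverage_of pk.
exists S; split.
- split; first by rewrite /S all_map; apply/allP => j _ /=; have [] := tP j.
  by move=> v; rewrite /S big_map big_enum; apply: eq_bigr => j _; rewrite pk.
- rewrite /cost /S big_map big_enum /=.
  rewrite (eq_bigr (fun j => \sum_(v | v != r) (if (0 < cov (P j) v)%N then weight T v *+ 2 else 0))).
    rewrite exchange_big /=; apply: eq_bigr => v _.
    by rewrite -big_mkcond sumr_const mulrnA cardsE.
  by move=> j _; have [_ _ -> _] := tP j; rewrite big_mkcondr.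
- move=> v b b0; rewrite /partial_sizes /S filter_map -map_comp count_map count_filter.
  rewrite cardsE cardE size_filter -enumT; apply: eq_count => j.
  have [_ _ _ hv] := tP j; have := hv v; rewrite /= cvE => ->.
  case bj: (b _) => //=; case: (posnP (cov (P j) v)) => [e|]; last by rewrite orbT.
  by rewrite e b0 in bj.
- move=> v s; rewrite /partial_sizes /S filter_map -map_comp => /mapP[j _ ->] _.
  by exists j; rewrite /= cvE.
Qed.
End Walks.

(** * Thresholds and buckets *)

Section Natceil.
Variable R : realType.
Implicit Types x : R.

Lemma natceil_ge x : x <= (natceil x)%:R.
Proof. by apply: le_trans (ceil_ge x) _; rewrite -mulrz_nat ler_int natz lez_abs. Qed.

Lemma natceil_lt x m : 0 <= x -> (m < natceil x)%N -> m%:R < x.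
Proof.
move=> x0; rewrite ltNge; apply: contraTN; rewrite -leqNgt => xm.
have : Num.ceil x <= m by rewrite ceil_le_int.
have : 0 <= Num.ceil x by rewrite ceil_ge0; apply: lt_le_trans x0; rewrite oppr_lt0.
by rewrite /natceil; lia.
Qed.

Lemma natceil_gt0 x : 0 < x -> (0 < natceil x)%N.
Proof. by move=> x0; have := lt_le_trans x0 (natceil_ge x); rewrite ltr0n. Qed.

Lemma natceil_le x : 0 <= x -> (natceil x)%:R <= x + 1.
Proof.
move=> x0; case e: (natceil x) => [|m]; first by rewrite addr_ge0.
by rewrite -natr1 lerD2r ltW // natceil_lt // e.
Qed.
End Natceil.

Section Thresholds.
Variables (R : realType) (eps : R) (Q : nat).
Hypotheses (eps0 : 0 < eps) (Q0 : (0 < Q)%N).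
Let raw := raw_sigma eps.
Let sig := sigma eps Q.
Let tau := tau eps Q.
Let I0 := natceil eps^-1.

Lemma raw_small i : (i <= I0)%N -> raw i = i.
Proof. by case: i => [//|i] iI; rewrite /raw /= -/I0 iI. Qed.

Lemma raw_big i : (I0 < i.+1)%N -> raw i.+1 = natceil ((raw i)%:R * (1 + eps)).
Proof. by rewrite ltnNge /raw /= -/I0 => /negbTE ->. Qed.

Lemma I0_gt0 : (0 < I0)%N. Proof. by apply: natceil_gt0; rewrite invr_gt0. Qed.

Lemma raw_incr i : (raw i < raw i.+1)%N /\ (i <= raw i)%N.
Proof.
have step j : (j <= raw j)%N -> (raw j < raw j.+1)%N.
  move=> jr; case: (leqP j.+1 I0) => ij; first by rewrite !raw_small // ltnW.
  have j0 : (0 < raw j)%N by apply: leq_trans jr; apply: leq_trans I0_gt0 _.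
  rewrite raw_big // -(ltr_nat R); apply: lt_le_trans (natceil_ge _).
  by rewrite mulrDr mulr1 ltrDl mulr_gt0 // ltr0n.
suff ir : (i <= raw i)%N by split=> //; apply: step.
by elim: i => // i IH; apply: leq_ltn_trans IH (step _ IH).
Qed.

Lemma raw_ge i : (i <= raw i)%N. Proof. by case: (raw_incr i). Qed.

Lemma raw_mono i j : (i <= j)%N -> (raw i <= raw j)%N.
Proof.
move=> /subnK <-; elim: (j - i)%N => // k IH; apply: leq_trans IH _.
by rewrite addSn ltnW //; have [] := raw_incr (k + i).
Qed.

Lemma tauP : [/\ (0 < tau <= Q)%N, (Q <= raw tau)%N
  & forall i, (0 < i < tau)%N -> (raw i < Q)%N].
Proof.
pose P i := (Q <= raw i)%N.
have hP : has P (iota 1 Q).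
  by apply/hasP; exists Q; rewrite ?mem_iota ?Q0 ?add1n ?leqnn //; apply: raw_ge.
have lt : (find P (iota 1 Q) < Q)%N by have := hP; rewrite has_find size_iota.
split; first by rewrite /tau /Defs.tau /= lt.
  by have := nth_find 0%N hP; rewrite nth_iota // add1n.
move=> i /andP[i0 it].
have /(before_find 0%N) : (i.-1 < find P (iota 1 Q))%N by rewrite prednK // -ltnS prednK.
rewrite nth_iota; last by apply: leq_trans lt; move: it; rewrite /tau /Defs.tau -/P; lia.
by rewrite add1n prednK // /P leqNgt => /negbFE.
Qed.

Lemma sig_lt i : (i < tau)%N -> sig i = raw i.
Proof.
move=> it; rewrite /sig /sigma -/tau ltnW //; apply/minn_idPl.
case: i it => // i it; apply: ltnW; have [_ _ H] := tauP; exact: H.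
Qed.

Lemma sig_tau : sig tau = Q.
Proof. by rewrite /sig /sigma -/tau leqnn; apply/minn_idPr; have [] := tauP. Qed.

Lemma sig_gt i : (tau < i)%N -> sig i = Q.+1.
Proof. by move=> ti; rewrite /sig /sigma -/tau leqNgt ti. Qed.

Lemma sig_mono i j : (i <= j)%N -> (sig i <= sig j)%N.
Proof.
move=> ij; rewrite /sig /sigma -/tau; case: ifP => it; case: ifP => jt //.
- by rewrite leq_min geq_minr andbT; apply: leq_trans (geq_minl _ _) (raw_mono ij).
- by apply: leqW; apply: geq_minr.
- by move: (leq_trans ij jt); rewrite it.
Qed.

Lemma in_bucket_gt0 i s : (0 < i)%N -> in_bucket eps Q i s -> (0 < s)%N.
Proof.
move=> i0 /andP[le _]; apply: leq_trans le; rewrite -/(sig i).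
have [/andP[t0 _] _ _] := tauP; case: (ltngtP i tau) => it.
- by rewrite sig_lt // (leq_trans i0) // raw_ge.
- by rewrite sig_gt.
- by rewrite it sig_tau.
Qed.

(** An integer below a ceiling is below the number itself, so the rounding in the thresholds does
    not spoil the ratio [1 + eps]. The linear buckets and the last one hold a single size. *)
Lemma in_bucket_ratio K0 i s s' : 1 + eps <= K0%:R ->
  in_bucket eps Q i s -> in_bucket eps Q i s' -> (s' <= K0 * s)%N.
Proof.
move=> eK; have K1 : (0 < K0)%N.
  by rewrite -(ltr_nat R) (lt_le_trans _ eK) // addr_gt0.
have le_s x y : (x <= y)%N -> (x <= K0 * y)%N by move/leq_trans; apply; rewrite leq_pmull.
rewrite /in_bucket -/(sig i) -/(sig i.+1) => /andP[is_ si] /andP[is' si'].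
case: (ltngtP i tau) => it.
- rewrite sig_lt // in is_.
  have s'r : (s' < raw i.+1)%N.
    apply: leq_trans si' _; case: (ltngtP i.+1 tau) => it'; first by rewrite sig_lt.
      by move: it it'; lia.
    by rewrite it' sig_tau; have [] := tauP.
  case: (leqP i.+1 I0) => iI.
    by apply: le_s; move: s'r is_; rewrite !raw_small // ?(ltnW iI) //; lia.
  rewrite raw_big // in s'r; have := natceil_lt _ s'r.
  rewrite mulr_ge0 ?addr_ge0 ?(ltW eps0) // => /(_ isT) lt.
  rewrite -(ler_nat R) natrM mulrC; apply: le_trans (ltW lt) _.
  apply: ler_pM => //; first by rewrite addr_ge0 // ltW.
  by rewrite ler_nat.
- by move: (leq_ltn_trans is_ si); rewrite !sig_gt ?ltnn // ltnW.
- by apply: le_s; move: is_ si'; rewrite it sig_tau sig_gt //; lia.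
Qed.

(** This is the classification [beta] of the regrouping; the size 0 has index 0. *)
Definition bucket_of s : nat := find (fun i => (s < sig i.+1)%N) (iota 0 tau.+1).

Lemma bucket_ofP s : (s <= Q)%N -> in_bucket eps Q (bucket_of s) s /\ (bucket_of s <= tau)%N.
Proof.
move=> sQ; pose P i := (s < sig i.+1)%N.
have hP : has P (iota 0 tau.+1).
  by apply/hasP; exists tau; rewrite ?mem_iota //= /P sig_gt.
have lt : (bucket_of s < tau.+1)%N by have := hP; rewrite has_find size_iota.
split=> //; rewrite /in_bucket -/(sig _) -/(sig (bucket_of s).+1).
have := nth_find 0%N hP; rewrite -/(bucket_of s) nth_iota // add0n /P => ->; rewrite andbT.
case e: (bucket_of s) => [|i]; first by have [/andP[t0 _] _ _] := tauP; rewrite sig_lt.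
have /(before_find 0%N) : (i < find P (iota 0 tau.+1))%N.
  by rewrite -/(bucket_of s) e.
rewrite nth_iota; last by move: lt; rewrite e => /ltnW.
by rewrite add0n /P ltnNge => /negbFE.
Qed.

Lemma in_bucket_uniq i s : in_bucket eps Q i s -> bucket_of s = i.
Proof.
move=> /andP[le lt]; rewrite -/(sig i) in le; rewrite -/(sig i.+1) in lt.
have sQ : (s <= Q)%N.
  rewrite -ltnS; apply: leq_trans lt _; case: (leqP i.+1 tau) => it; last by rewrite sig_gt.
  by apply: leqW; rewrite -sig_tau sig_mono.
have [/andP[le' lt'] _] := bucket_ofP sQ; apply/eqP; rewrite eqn_leq; apply/andP; split.
  by rewrite leqNgt; apply/negP => h; have := leq_trans (leq_ltn_trans le' lt) (sig_mono h); rewrite ltnn.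
by rewrite leqNgt; apply/negP => h; have := leq_trans (leq_ltn_trans le lt') (sig_mono h); rewrite ltnn.
Qed.

Lemma raw_growth m : (1 + eps) ^+ m <= (raw (I0 + m))%:R.
Proof.
elim: m => [|m IH].
  by rewrite addn0 expr0 ler1n (leq_trans I0_gt0) // raw_ge.
rewrite addnS raw_big; last by lia.
apply: le_trans (natceil_ge _); rewrite exprSr ler_pM2r //; by rewrite addr_gt0.
Qed.

(** About [1 / eps] thresholds are linear, and after them they grow geometrically. The term
    [(ln 2)^-1] turns [1 / eps] into a multiple of [ln Q / eps], as [Q >= 2]; the bound [E] on [eps]
    keeps the constant uniform. *)
Lemma tau_le E : eps <= E -> (1 < Q)%N ->
  tau%:R <= 2 * (1 + E) * ((ln 2)^-1 + 1) * (ln Q%:R / eps).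
Proof.
move=> epsE Q1; have E0 : 0 < E by apply: lt_le_trans epsE.
have ln2 : 0 < ln (2 : R) by apply: ln_gt0; rewrite ltr1n.
have lnQ : ln (2 : R) <= ln Q%:R by rewrite ler_ln ?posrE ?ltr0n // ler_nat.
have lnQ0 := lt_le_trans ln2 lnQ.
have I0E : I0%:R + 1 <= 2 * (1 + E) / eps.
  have h1 : I0%:R <= eps^-1 + 1 by apply: natceil_le; rewrite invr_ge0 ltW.
  have h2 : 1 <= E / eps by rewrite ler_pdivlMr // mul1r.
  have h3 : 2 * (1 + E) / eps = 2 * eps^-1 + 2 * (E / eps) by ring.
  have h4 : 0 < eps^-1 by rewrite invr_gt0.
  lra.
(* Apply [ln (1 + x) <= x] to [x = - eps / (1 + eps)], where [1 + x] is the inverse of [1 + eps]. *)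
have lnd : eps / (1 + E) <= ln (1 + eps).
  have e1 : 0 < 1 + eps by rewrite addr_gt0.
  have h1 : ln (1 + eps)^-1 <= - (eps / (1 + eps)).
    have e : (1 + eps)^-1 = 1 + - (eps / (1 + eps)) by field; rewrite gt_eqF.
    rewrite {1}e; apply: le_ln1Dx; rewrite ltrN2 ltr_pdivrMr // mul1r ltrDr //.
  rewrite lnV ?posrE // lerN2 in h1; apply: le_trans h1.
  by rewrite ler_wpM2l ?(ltW eps0) // lef_pV2 ?posrE ?addr_gt0 // lerD2l.
pose m := (tau.-1 - I0)%N.
have tm : (tau <= I0 + 1 + m)%N by rewrite /m; lia.
have mE : m%:R <= (1 + E) * (ln Q%:R / eps).
  case: (posnP m) => [->|m0]; first by rewrite !mulr_ge0 ?invr_ge0 ?addr_ge0 // ltW.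
  have lt : (raw (I0 + m) < Q)%N by have [_ _] := tauP; apply; rewrite /m in m0 *; lia.
  have le : (1 + eps) ^+ m <= Q%:R.
    by apply: le_trans (raw_growth m) _; rewrite ler_nat ltnW.
  have e1 : 0 < 1 + eps by rewrite addr_gt0.
  have : ln ((1 + eps) ^+ m) <= ln Q%:R by rewrite ler_ln ?posrE ?exprn_gt0 ?ltr0n // ltnW.
  rewrite lnXn // -[ln _ *+ m]mulr_natl => h1.
  have h2 : m%:R * (eps / (1 + E)) <= ln Q%:R by apply: le_trans h1; rewrite ler_wpM2l.
  by rewrite mulrA ler_pdivlMr // [X in _ <= X]mulrC -ler_pdivrMr ?addr_gt0 // -mulrA.
have h1 : (tau%:R : R) <= I0%:R + 1 + m%:R by have := tm; rewrite -(ler_nat R) !natrD.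
have h2 : 1 <= (ln 2)^-1 * ln (Q%:R : R) by rewrite mulrC ler_pdivlMr // mul1r.
have h3 : 2 * (1 + E) / eps <= 2 * (1 + E) / eps * ((ln 2)^-1 * ln Q%:R).
  by apply: ler_peMr => //; rewrite !mulr_ge0 ?invr_ge0 ?addr_ge0 // ltW.
have h4 : 0 <= (1 + E) * (ln Q%:R / eps) by rewrite !mulr_ge0 ?invr_ge0 ?addr_ge0 // ltW.
have -> : 2 * (1 + E) * ((ln 2)^-1 + 1) * (ln Q%:R / eps) =
  2 * (1 + E) / eps * ((ln 2)^-1 * ln Q%:R) + 2 * ((1 + E) * (ln Q%:R / eps)) by ring.
lra.
Qed.
End Thresholds.

(** * Number of sizes over all buckets *)

Section Sizes.
Variables (R : realType) (V : finType) (T : wtree R V) (delta alpha eps : R) (Q : nat)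
  (S : seq (tour V)).
Hypotheses (eps0 : 0 < eps) (Q0 : (0 < Q)%N).

(** The tuple in [few_sizes] has exactly [num_groups] entries from the bucket, so the list is filled
    up with a size [s0] that occurs. *)
Lemma few_sizes_list v i (L : seq nat) :
    (size L <= num_groups V delta eps)%N -> (0 < bucket_card T eps Q S v i)%N ->
    (forall s, s \in partial_sizes T S v -> in_bucket eps Q i s -> s \in L) ->
  few_sizes T delta eps Q S v i.
Proof.
move=> sL; rewrite /bucket_card -has_count => /hasP[s0 s0P b0] inL.
pose L' := filter (in_bucket eps Q i) L.
have sL' : (size L' <= num_groups V delta eps)%N by apply: leq_trans sL; rewrite size_filter count_size.
pose m := sort leq (L' ++ nseq (num_groups V delta eps - size L') s0).
have sm : size m == num_groups V delta eps by rewrite size_sort size_cat size_nseq subnKC.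
exists (Tuple sm); split=> /=.
- by apply: sort_sorted; apply: leq_total.
- rewrite all_sort all_cat filter_all; apply/allP => x /nseqP[-> _] //.
- by move=> s sP sb; rewrite mem_sort mem_cat mem_filter sb inL.
Qed.

Let logn : R := ln #|V|%:R.

Lemma few_sizes_overall_structured E : eps <= E -> 1 <= logn -> 0 <= delta -> 0 <= alpha ->
    all (is_tour T Q) S -> structured T delta alpha eps Q S ->
  few_sizes_overall T eps Q S
    (4 * (1 + E) * ((ln 2)^-1 + 1) * (alpha + 2 * delta + E ^+ 2)).
Proof.
move=> epsE L1 d0 a0 tQ st Q1 v; rewrite /num_sizes.
set s := partial_sizes T S v; set u := undup s; set t := tau eps Q.
have E0 : 0 < E by apply: lt_le_trans epsE.
have sQ x : x \in s -> (x <= Q)%N.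
  rewrite /s /partial_sizes; elim: S tQ => //= y S' IH /andP[/and4P[_ _ _ yQ] tQ].
  case: ifP => _ //=; last exact: IH.
  rewrite inE => /orP[/eqP ->|]; last exact: IH.
  by apply: leq_trans yQ; rewrite /coverage big_mkcond; apply: leq_sum => w _; case: ifP.
have uE : size u = (\sum_(i < t.+1) count (fun x => bucket_of eps Q x == i) u)%N.
  rewrite -sum1_size (eq_bigr (fun i : 'I_t.+1 => \sum_(x <- u | bucket_of eps Q x == i) 1%N)); last first.
    by move=> i _; rewrite sum1_count.
  rewrite (exchange_big_dep predT) //= big_seq [RHS]big_seq; apply: eq_bigr => x.
  rewrite mem_undup => /sQ/(bucket_ofP eps0 Q0)[_ bt].
  by rewrite (big_pred1 (Ordinal (bt : (bucket_of eps Q x < t.+1)%N))) // => i; rewrite eq_sym.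
have cnt (p : pred nat) (L : seq nat) : (forall x, x \in s -> p x -> x \in L) ->
    (count p u <= size L)%N.
  move=> H; rewrite -size_filter; apply: uniq_leq_size; first by rewrite filter_uniq // undup_uniq.
  by move=> x; rewrite mem_filter mem_undup => /andP[px xs]; apply: H.
(* [Bd] serves for small and big buckets alike; its last summand covers the rounding of [num_groups]
   and the bucket of the size 0. *)
pose Bd : R := alpha * logn ^+ 3 / eps ^+ 2 + 2 * delta * logn / eps ^+ 2 + 1.
have L0 : 0 <= logn := le_trans ler01 L1.
have e2 : 0 < eps ^+ 2 by rewrite exprn_gt0.
have t1 : 0 <= alpha * logn ^+ 3 / eps ^+ 2 by rewrite !mulr_ge0 ?invr_ge0 ?exprn_ge0 // ltW.
have t2 : 0 <= 2 * delta * logn / eps ^+ 2 by rewrite !mulr_ge0 ?invr_ge0 ?exprn_ge0 // ltW.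
have bd (i : 'I_t.+1) : (count (fun x => bucket_of eps Q x == i) u)%:R <= Bd.
  case: (posnP i) => [i0|i0].
    have : (count (fun x => bucket_of eps Q x == i) u <= size [:: 0%N])%N.
      apply: cnt => x /sQ xQ /eqP e; have [] := bucket_ofP eps0 Q0 xQ; rewrite e i0 => /andP[_ x1] _.
      rewrite inE -leqn0 -ltnS; apply: leq_trans x1 _.
      have [_ Qt tmin] := tauP eps0 Q0.
      have r1 : raw_sigma eps 1 = 1%N by apply: raw_small; apply: I0_gt0.
      case: (ltngtP 1%N (tau eps Q)) => t1'; first by rewrite sig_lt // r1.
        by move: t1'; rewrite ltnNge; have [/andP[-> _] _ _] := tauP eps0 Q0.
      by move: Qt; rewrite -t1' r1 [X in sigma _ _ X]t1' sig_tau.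
    by rewrite -(ler_nat R) /Bd => /le_trans; apply; rewrite lerDr addr_ge0.
  have it : (1 <= i <= t)%N by rewrite i0 -ltnS ltn_ord.
  case: (st v i it) => [small|[_ [m [_ _ mP]]]].
    apply: (@le_trans _ _ (bucket_card T eps Q S v i)%:R).
      rewrite ler_nat /bucket_card -/s -!size_filter filter_undup.
      apply: leq_trans (size_undup _) _; rewrite !size_filter [X in (X <= _)%N](eq_in_count (a2 := in_bucket eps Q i)) //.
      move=> x /sQ xQ; apply/eqP/idP => [<-|]; first by have [] := bucket_ofP eps0 Q0 xQ.
      exact: in_bucket_uniq.
    by apply: le_trans small _; rewrite /Bd -addrA lerDl addr_ge0.
  have : (count (fun x => bucket_of eps Q x == i) u <= size m)%N.
    apply: cnt => x xs /eqP e; apply: mP => //.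
    by have [] := bucket_ofP eps0 Q0 (sQ x xs); rewrite e.
  rewrite size_tuple -(ler_nat R) => /le_trans; apply.
  by apply: le_trans (natceil_le t2) _; rewrite /Bd -addrA lerDr.
have tE : (size u)%:R <= (t.+1)%:R * Bd.
  rewrite uE natr_sum; apply: le_trans (ler_sum _ (fun i _ => bd i)) _.
  by rewrite sumr_const card_ord mulr_natl.
have L3 : logn <= logn ^+ 3.
  by rewrite exprS ler_peMr // exprn_ege1.
have Bd_le : Bd <= (alpha + 2 * delta + E ^+ 2) * (logn ^+ 3 / eps ^+ 2).
  rewrite /Bd; set A := logn ^+ 3 / eps ^+ 2.
  have -> : alpha * logn ^+ 3 / eps ^+ 2 = alpha * A by rewrite /A mulrA.
  have h1 : 2 * delta * logn / eps ^+ 2 <= 2 * delta * A.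
    by rewrite /A mulrA ler_pM2r ?invr_gt0 // ler_wpM2l // mulr_ge0.
  have h2 : 1 <= E ^+ 2 * A.
    rewrite /A mulrA ler_pdivlMr // mul1r -[X in X <= _]mulr1.
    apply: ler_pM; rewrite ?(ltW e2) ?ler01 ?exprn_ege1 //.
    by rewrite ler_pXn2r ?nnegrE ?(ltW eps0) ?(ltW E0).
  lra.
have tB := tau_le eps0 Q0 epsE Q1; rewrite -/t in tB.
have t1' : (1 : R) <= t%:R by rewrite ler1n; have [/andP[]] := tauP eps0 Q0.
set A := logn ^+ 3 / eps ^+ 2 in Bd_le; set c := alpha + 2 * delta + E ^+ 2 in Bd_le *.
set c' := 2 * (1 + E) * ((ln 2)^-1 + 1) in tB.
have -> : 4 * (1 + E) * ((ln 2)^-1 + 1) * c * (ln Q%:R * logn ^+ 3 / eps ^+ 3) =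
    2 * (c' * (ln Q%:R / eps)) * (c * A).
  by rewrite /c' /A; field; rewrite gt_eqF //= gt_eqF // ln_gt0 // ltr1n.
apply: le_trans tE _; apply: ler_pM => //; first by rewrite /Bd !addr_ge0.
rewrite -natr1; lra.
Qed.
End Sizes.

(** * Choice of the constants *)

Section Constants.
Variable R : realType.

(* [L / block_scale] is the spacing [b] of the minor checkpoints. *)
Definition block_scale (E delta K0 : R) := 6912 * E ^+ 2 * K0 / delta.

(** The two losses are at most [eps * F / 9] and [eps * F / 18]. The factor 144 is [9 * 16], with 16
    from [G <= 16 * ga1]. For the second loss, [X <= 6 / eps1] asks for
    [eps ^+ 2 * ga2 >= 216 * E ^+ 2 * K0], and [G <= 32 * b * ga2] turns this into the constant
    [6912 = 32 * 216] of [block_scale]. *)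
Lemma dropped_bound (E delta K0 L eps eps1 b h H G ga1 ga2 X F M1 M2 : R) :
    let C := block_scale E delta K0 in
    1 <= E -> 0 < delta -> 0 < K0 -> 0 < L -> 0 < eps <= E -> 0 < eps1 -> eps <= E * eps1 ->
    0 < b -> 0 <= H -> H * b ^+ 2 <= h -> h * eps <= delta * L ^+ 2 ->
    L <= b * C -> b * C <= 2 * L -> 2 * delta * L <= G * eps ^+ 2 ->
    G <= 16 * ga1 -> G <= 32 * b * ga2 -> 0 <= X -> X * eps1 <= 6 -> 0 <= F ->
    0 < ga1 -> 0 < ga2 ->
    ga1 * M1 <= K0 * ((H + 1) * F) -> ga2 * M2 <= K0 * (2 * X * F) ->
    144 * K0 * C ^+ 2 <= L -> 144 * K0 * E <= delta * L ->
  6 * (M1 + M2) <= eps * F.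
Proof.
move=> C E1 d0 K00 L0 /andP[e0 eE] e10 ee1 b0 H0 Hb he Lb bL GL G1 G2 X0 Xe F0 g10 g20 HM1 HM2 LC LE.
have CE : C * delta = 6912 * E ^+ 2 * K0 by rewrite /C /block_scale divfK // gt_eqF.
have C0 : 0 < C by rewrite /C /block_scale !mulr_gt0 ?invr_gt0 ?exprn_gt0 // (lt_le_trans _ E1).
have HE : H * eps <= delta * C ^+ 2.
  have L2 : L ^+ 2 <= b ^+ 2 * C ^+ 2 by rewrite -exprMn !expr2; apply: ler_pM; rewrite ?(ltW L0).
  have : H * eps * L ^+ 2 <= delta * C ^+ 2 * L ^+ 2.
    apply: (@le_trans _ _ (H * eps * (b ^+ 2 * C ^+ 2))).
      by rewrite ler_wpM2l // mulr_ge0 // ltW.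
    have -> : H * eps * (b ^+ 2 * C ^+ 2) = H * b ^+ 2 * eps * C ^+ 2 by ring.
    have -> : delta * C ^+ 2 * L ^+ 2 = delta * L ^+ 2 * C ^+ 2 by ring.
    rewrite ler_wpM2r ?exprn_ge0 ?(ltW C0) //; apply: le_trans he.
    by rewrite ler_wpM2r // ltW.
  by rewrite ler_pM2r ?exprn_gt0.
have K144 : 0 <= 144 * K0 := mulr_ge0 (ler0n _ 144) (ltW K00).
have A : 144 * K0 * (H + 1) <= eps * G.
  rewrite -(ler_pM2r e0).
  have h1 : 144 * K0 * (H * eps) <= delta * L.
    apply: (@le_trans _ _ (144 * K0 * (delta * C ^+ 2))); first by rewrite ler_wpM2l.
    have -> : 144 * K0 * (delta * C ^+ 2) = delta * (144 * K0 * C ^+ 2) by ring.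
    by rewrite ler_wpM2l // ltW.
  have h2 : 144 * K0 * eps <= delta * L by apply: le_trans LE; rewrite ler_wpM2l.
  have -> : 144 * K0 * (H + 1) * eps = 144 * K0 * (H * eps) + 144 * K0 * eps by ring.
  have -> : eps * G * eps = G * eps ^+ 2 by ring.
  by move: h1 h2 GL; clear; lra.
have M1E : 9 * M1 <= eps * F.
  rewrite -(ler_pM2l g10).
  have -> : ga1 * (9 * M1) = 9 * (ga1 * M1) by ring.
  apply: (@le_trans _ _ (9 * K0 * (H + 1) * F)); first by move: HM1; clear; lra.
  have -> : ga1 * (eps * F) = ga1 * eps * F by ring.
  rewrite ler_wpM2r //.
  have : eps * G <= eps * (16 * ga1) by rewrite ler_wpM2l // ltW.
  by move: A; clear; lra.
have g2E : 216 * E ^+ 2 * K0 <= eps ^+ 2 * ga2.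
  have e2 : 0 < eps ^+ 2 by rewrite exprn_gt0.
  have h1 : G * eps ^+ 2 <= 32 * b * ga2 * eps ^+ 2 by rewrite ler_wpM2r // ltW.
  have h2 : delta * (b * C) <= delta * (2 * L) by rewrite ler_wpM2l // ltW.
  have h3 : b * (216 * E ^+ 2 * K0) <= b * (eps ^+ 2 * ga2).
    have -> : b * (216 * E ^+ 2 * K0) = delta * (b * C) / 32.
      have -> : delta * (b * C) = b * (C * delta) by ring.
      by rewrite CE; field.
    have -> : b * (eps ^+ 2 * ga2) = 32 * b * ga2 * eps ^+ 2 / 32 by field.
    by move: h1 h2 GL; clear; lra.
  by rewrite ler_pM2l in h3.
have XE : 36 * K0 * X <= eps * ga2.
  rewrite -(ler_pM2l e0).
  have -> : eps * (eps * ga2) = eps ^+ 2 * ga2 by ring.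
  apply: le_trans g2E.
  have h1 : X * eps <= 6 * E.
    apply: (@le_trans _ _ (X * (E * eps1))); first by rewrite ler_wpM2l.
    have -> : X * (E * eps1) = X * eps1 * E by ring.
    by rewrite ler_wpM2r // (le_trans ler01).
  have -> : eps * (36 * K0 * X) = 36 * K0 * (X * eps) by ring.
  apply: (@le_trans _ _ (36 * K0 * (6 * E))).
    exact: ler_wpM2l (mulr_ge0 (ler0n _ 36) (ltW K00)) _ _ h1.
  have -> : 36 * K0 * (6 * E) = 216 * E * K0 by ring.
  rewrite ler_wpM2r ?(ltW K00) // ler_wpM2l // expr2 ler_peMr // (le_trans ler01) //.
have M2E : 18 * M2 <= eps * F.
  rewrite -(ler_pM2l g20).
  have -> : ga2 * (18 * M2) = 18 * (ga2 * M2) by ring.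
  apply: (@le_trans _ _ (36 * K0 * X * F)); first by move: HM2; clear; lra.
  have -> : ga2 * (eps * F) = eps * ga2 * F by ring.
  by rewrite ler_wpM2r.
by move: M1E M2E; clear; lra.
Qed.

(* [n'] tours cross an edge crossed by [n] tours of the given solution. *)
Lemma crossing_bound (eps eps1 Q W U1 n n' M : R) :
    0 < eps -> 0 <= eps1 <= eps -> 0 < Q -> 0 < W -> Q <= 3 * W -> 0 <= n -> 0 <= M -> 0 <= U1 ->
    W * n' <= W * (n + 10) + 2 * M + 2 * n * U1 ->
    6 * M <= eps * (Q * n) -> U1 * 6 <= eps1 * Q -> 10 <= 2 * eps * n ->
  n' <= (1 + 4 * eps) * n.
Proof.
move=> e0 /andP[e10 e1e] Q0 W0 QW n0 M0 U0 H HM HU H10.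
(* Of the surplus [4 * eps * n * W], one quarter bounds [2 * M], one quarter [2 * n * U1], and one
   half [10 * W]. *)
rewrite -(ler_pM2l W0); apply: le_trans H _.
have h1 : eps * (Q * n) <= eps * (3 * W * n).
  by rewrite ler_wpM2l ?(ltW e0) // ler_wpM2r.
have h2 : 2 * n * U1 <= eps * n * W.
  have h3 : n * (U1 * 6) <= n * (eps1 * Q) by rewrite ler_wpM2l.
  have h4 : n * (eps1 * Q) <= n * (eps * (3 * W)).
    by rewrite ler_wpM2l // ler_pM // ltW.
  have -> : 2 * n * U1 = n * (U1 * 6) / 3 by field.
  have -> : eps * n * W = n * (eps * (3 * W)) / 3 by field.
  lra.
have h5 : W * 10 <= W * (2 * eps * n) by rewrite ler_wpM2l // ltW.
have -> : W * ((1 + 4 * eps) * n) = W * n + W * (2 * eps * n) + 2 * (eps * n * W) by ring.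
have h6 : eps * (3 * W * n) = 3 * (eps * n * W) by ring.
rewrite h6 in h1; rewrite mulrDr; lra.
Qed.
End Constants.

(** * Assembling the structured solution *)

Section Structure.
Variables (R : realType) (V : finType) (T : wtree R V) (delta alpha eps E : R) (Q : nat).
Hypotheses (delta0 : 0 < delta) (alpha1 : 1 <= alpha) (E1 : 1 <= E) (epsE : 0 < eps <= E)
  (Q0 : (0 < Q)%N).
Let L : R := ln #|V|%:R.
Let K0 := natceil (1 + E).
Let C := block_scale E delta K0%:R.

Hypotheses (heightL : (height T)%:R <= delta * L ^+ 2 / eps)
  (L1 : 1 <= L) (LC : C <= L) (LK : 144 * K0%:R * C ^+ 2 <= L)
  (LE : 144 * K0%:R * E <= delta * L) (LG : 12 * E ^+ 2 <= 2 * delta * L)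
  (LN : E * (E + 5) <= L).

Let r := depot T.
Let par := parent T.
Let par_r : par r = r := parent_depot T.
Let reach : forall v, fconnect par v r := @depot_reachable _ _ T.
Let N : R := alpha * L ^+ 3 / eps ^+ 2.
Let G := num_groups V delta eps.

Lemma restructure (Tt : finType) (p : Tt -> V -> nat) :
    (forall t, coverage_of par (p t) r <= Q)%N ->
  exists (J : finType) (q : J -> V -> nat),
  [/\ forall j, (coverage_of par (q j) r <= Q)%N,
      forall u, (\sum_t p t u <= \sum_j q j u)%N,
      forall v, (crossing par q v)%:R <= (1 + 4 * eps) * (crossing par p v)%:R
    & forall v, (crossing par q v + 1)%:R <= N \/
        exists vals : nat -> seq nat, forall i, (size (vals i) + 1 <= G)%N /\
          forall j, (0 < coverage_of par (q j) v)%N ->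
            coverage_of par (q j) v \in vals (bucket_of eps Q (coverage_of par (q j) v))].
Proof.
move=> pQ; have [e0 eE] := andP epsE.
have E0 : 0 < E := lt_le_trans ltr01 E1.
have L0 : 0 < L := lt_le_trans ltr01 L1.
have e2 : 0 < eps ^+ 2 by rewrite exprn_gt0.
have K00 : 0 < K0%:R :> R by apply: lt_le_trans (natceil_ge _); rewrite addr_gt0.
have C0 : 0 < C by rewrite /C /block_scale !mulr_gt0 ?invr_gt0 ?exprn_gt0.
have a0 : 0 < alpha := lt_le_trans ltr01 alpha1.
have NE : E + 5 <= eps * N.
  have -> : eps * N = alpha * L ^+ 3 / eps by rewrite /N; field; rewrite gt_eqF.
  rewrite ler_pdivlMr //; apply: (@le_trans _ _ (E * (E + 5))).
    by rewrite mulrC ler_wpM2r // addr_ge0 // ltW.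
  apply: le_trans LN _; rewrite -[X in X <= _]mul1r; apply: ler_pM (ltW L0) alpha1 _ => //.
  by rewrite exprS ler_peMr ?exprn_ege1 // ltW.
(* Thus [N0 + 1 <= N < N0 + 2]: one place is reserved for the extra tour to the depot added in
   [structured_solution]. *)
pose N0 := (Num.trunc N).-1.
have N1 : 1 <= N by rewrite -(ler_pM2l e0) mulr1; lra.
have tN : (0 < Num.trunc N)%N by rewrite truncn_gt0.
have N0E : (N0 + 1)%:R <= N.
  by rewrite /N0 addn1 prednK // truncn_le (le_trans ler01).
have N0l : N < (N0 + 2)%:R.
  have -> : (N0 + 2 = (Num.trunc N).+1)%N by rewrite addn2; congr _.+1; exact: (prednK tN).
  by have /andP[_] := truncn_itv (le_trans ler01 N1).
case: (leqP (crossing par p r) N0) => [rsmall|rbig].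
  exists Tt, p; split=> // v.
    by rewrite ler_peMl ?ler0n // lerDl mulr_ge0 // ltW.
  left; apply: le_trans N0E; rewrite ler_nat leq_add2r; apply: leq_trans rsmall.
  exact/crossing_mono/sub_root.
pose eps1 : R := Num.min eps 1.
have e10 : 0 < eps1 by rewrite lt_min e0 ltr01.
have e11 : eps1 <= 1 by rewrite ge_min lexx orbT.
have e1e : eps1 <= eps by rewrite ge_min lexx.
have ee1 : eps <= E * eps1.
  rewrite /eps1; case: (leP eps 1) => h; last by rewrite mulr1.
  by rewrite ler_peMl // ltW.
pose kap := eps1 / 6.
have kap0 : 0 < kap by rewrite divr_gt0.
have QR : 0 < Q%:R :> R by rewrite ltr0n.
pose U := natceil (kap * Q%:R).
have U0 : (0 < U)%N by apply: natceil_gt0; rewrite mulr_gt0.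
have U1 : U.-1%:R * 6 <= eps1 * Q%:R.
  have : U.-1%:R < kap * Q%:R.
    by apply: natceil_lt; [exact/ltW/mulr_gt0 | rewrite ltn_predL].
  by rewrite /kap; lra.
pose W := ((Q + 2) %/ 3)%N.
have W3 : (Q <= 3 * W)%N by rewrite /W; clear; lia.
have W0 : (0 < W)%N by rewrite /W; clear -Q0; lia.
have UW : (U <= W)%N.
  have : (U.-1 * 6 <= Q)%N.
    rewrite -(ler_nat R) natrM; apply: le_trans U1 _.
    by rewrite -[X in _ <= X]mul1r ler_wpM2r.
  by rewrite /W; move: U U0 {U1}; clear -Q0; lia.
have WQ : (2 * W.-1 <= Q)%N by rewrite /W; clear -Q0; lia.
pose b := natceil (L / C).
have LC1 : 1 <= L / C by rewrite ler_pdivlMr // mul1r.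
have b0 : (0 < b)%N by apply: natceil_gt0; rewrite divr_gt0.
have bL : L <= b%:R * C by rewrite -ler_pdivrMr // natceil_ge.
have bL2 : b%:R * C <= 2 * L.
  have h : b%:R <= L / C + 1 by apply: natceil_le; rewrite divr_ge0 // ltW.
  have -> : 2 * L = (2 * (L / C)) * C by rewrite -mulrA divfK // gt_eqF.
  by rewrite ler_pM2r //; lra.
have Gge : 2 * delta * L <= G%:R * eps ^+ 2.
  by rewrite -ler_pdivrMr //; apply: natceil_ge.
have e2E : eps ^+ 2 <= E ^+ 2 by rewrite ler_pXn2r // nnegrE ltW.
have G12 : (12 <= G)%N.
  by rewrite -(ler_nat R) -(ler_pM2r e2); apply: le_trans Gge; apply: le_trans LG; rewrite ler_pM2l.
have G32 : (16 * b <= G)%N.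
  rewrite -(ler_nat R) natrM -(ler_pM2r e2); apply: le_trans Gge.
  apply: (@le_trans _ _ (delta * (b%:R * C))); last first.
    by rewrite (mulrC 2) -mulrA ler_wpM2l // ltW.
  have -> : delta * (b%:R * C) = 6912 * E ^+ 2 * K0%:R * b%:R.
    by rewrite /C /block_scale; field; rewrite gt_eqF.
  have K01 : 1 <= K0%:R :> R by rewrite ler1n -(ltr_nat R).
  have h1 : b%:R * eps ^+ 2 <= b%:R * E ^+ 2 by rewrite ler_wpM2l.
  have h2 : b%:R * E ^+ 2 <= b%:R * E ^+ 2 * K0%:R.
    by rewrite ler_peMr // mulr_ge0 // exprn_ge0 // ltW.
  have h3 : 0 <= b%:R * eps ^+ 2 by rewrite mulr_ge0 // ltW.
  have -> : 6912 * E ^+ 2 * K0%:R * b%:R = 6912 * (b%:R * E ^+ 2 * K0%:R) by ring.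
  by rewrite -mulrA; lra.
(* Each of [2 * g1] and [4 * b * g2] is at most [G / 4]. The other half of [G >= 12] leaves room for
   the five sizes of the repacking and the size of the depot tour. *)
pose g1 := (G %/ 8)%N; pose g2 := (G %/ (16 * b))%N.
have g10 : (0 < g1)%N by rewrite divn_gt0 //; apply: leq_trans G12.
have g20 : (0 < g2)%N by rewrite divn_gt0 // muln_gt0 b0.
have Gg1 : (G <= 16 * g1)%N by rewrite /g1; move: G12; clear; lia.
have Gg2 : (G <= 32 * b * g2)%N.
  have := ltn_ceil G (_ : 0 < 16 * b)%N; rewrite muln_gt0 b0 => /(_ isT); rewrite -/g2; move: G32 b0 g20; clear; nia.
have betaK x y : (0 < x <= Q)%N -> (0 < y <= Q)%N ->
    bucket_of eps Q x = bucket_of eps Q y -> (y <= K0 * x)%N.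
  move=> /andP[_ xQ] /andP[_ yQ] exy.
  have [bx _] := bucket_ofP e0 Q0 xQ; have [by_ _] := bucket_ofP e0 Q0 yQ.
  rewrite -exy in by_; apply: (in_bucket_ratio e0 Q0 _ bx by_).
  by apply: le_trans (natceil_ge _); rewrite lerD2l.
have depP x : (dep par r x <= height T)%N by apply: (leq_bigmax (F := depth T)).
have [J [q [vals [M1 [M2 [qQ pq qs qb qv]]]]]] :=
  sparse_repacking par_r reach U0 UW WQ b0 g10 g20 betaK depP pQ rbig.
exists J, q; split=> // v.
  case: (leqP (crossing par p v) N0) => [/qs le|big].
    apply: (@le_trans _ _ (crossing par p v)%:R); first by rewrite ler_nat.
    by rewrite ler_peMl ?ler0n // lerDl mulr_ge0 // ltW.
  have [cW cM1 cM2] := qb v big.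
  set n := crossing par p v in big cW cM1 cM2 *.
  have nN : 10 <= 2 * eps * n%:R.
    have : N <= n%:R + 1.
      apply: ltW; apply: lt_le_trans N0l _.
      by rewrite natr1 ler_nat addn2 ltnS.
    rewrite -(ler_pM2l e0) mulrDr mulr1; lra.
  apply: (@crossing_bound R eps eps1 Q%:R W%:R U.-1%:R n%:R _ ((M1 v)%:R + (M2 v)%:R)) => //;
    rewrite ?addr_ge0 ?ler0n ?ltr0n ?e1e ?(ltW e10) //.
  - by rewrite -natrM ler_nat.
  - by have := cW; rewrite -(ler_nat R) 2!natrD !natrM !natrD.
  apply: (@dropped_bound R E delta K0%:R L eps eps1 b%:R (height T)%:R
    (height T %/ (b * b))%:R G%:R g1%:R g2%:R (Q %/ U)%:R) => //; rewrite ?ler0n ?ltr0n ?mulr_ge0 //.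
  - by rewrite -natrX -natrM ler_nat -mulnn leq_trunc_div.
  - by rewrite -ler_pdivlMr.
  - by rewrite -natrM ler_nat.
  - by rewrite -!natrM ler_nat.
  - have QU : (Q %/ U)%:R * U%:R <= Q%:R :> R by rewrite -natrM ler_nat leq_trunc_div.
    have UQ : kap * Q%:R <= U%:R by apply: natceil_ge.
    rewrite -(ler_pM2r QR); apply: (@le_trans _ _ (6 * ((Q %/ U)%:R * (kap * Q%:R)))).
      by rewrite le_eqVlt; apply/orP; left; apply/eqP; rewrite /kap; field.
    by rewrite ler_pM2l //; apply: le_trans QU; rewrite ler_wpM2l.
  - by have := cM1; rewrite -(ler_nat R) !natrM -addn1 natrD.
  - by have := cM2; rewrite -(ler_nat R) !natrM.
case: (leqP (crossing par p v) N0) => [/[dup] le /qs le'|big].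
  left; apply: le_trans N0E; rewrite ler_nat leq_add2r; exact: leq_trans le' le.
right; exists (vals v) => i; have [H sz] := qv v big i; split=> //.
apply: leq_trans (leq_add sz (leqnn 1)) _.
have : (2 * g1 <= G %/ 4)%N by rewrite /g1; clear; lia.
have : (16 * b * g2 <= G)%N by rewrite mulnC leq_trunc_div.
by move: G12; clear; nia.
Qed.

Lemma structured_solution d opt : (forall v, v != depot T -> (0 < d v)%N) -> is_opt T Q d opt ->
  exists (d' : V -> nat) (S : seq (tour V)),
  [/\ forall v, (d v <= d' v)%N /\ (0 < d' v)%N, is_solution T Q d' S,
      cost T S <= (1 + 4 * eps) * opt & structured T delta alpha eps Q S].
Proof.
move=> d0 [[S0 [S0Q S0d] <-] _]; have [e0 _] := andP epsE.
pose Tt := 'I_(size S0); pose t0 (t : Tt) := tnth (in_tuple S0) t.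
pose p (t : Tt) := Defs.pick (t0 t).
have t0Q t : is_tour T Q (t0 t) by apply: (all_tnthP (t := in_tuple S0) S0Q).
have pQ t : (coverage_of par (p t) r <= Q)%N.
  have /and4P[_ _ _] := t0Q t; apply: leq_trans.
  by rewrite /coverage_of big_mkcond; apply: leq_sum => u _; case: ifP.
have [J [q [qQ pq cr vq]]] := restructure pQ.
(* The depot may have no demand, so an extra tour of cost 0 picks up one token there; it adds the
   size 1 at the root. *)
pose P (j : 'I_1 + J) := if j is inr j' then q j' else fun v => (v == r) : nat.
have covN o v : coverage_of par (P (inl o)) v = (v == r).
  case: (eqVneq v r) => [->|vr].
    rewrite /coverage_of (bigD1 r) ?sub_refl //= eqxx big1 // => u /andP[_ /negbTE ur].
    by rewrite /= ur.
  rewrite /coverage_of big1 // => u vu; rewrite /=; case: eqP => // ur.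
  case/eqP: vr; apply: (sub_anti par_r reach) => //; first by rewrite -[r]ur.
  exact: sub_root.
have total (f : V -> nat) : (\sum_v f v)%N = coverage_of par f r.
  by apply: eq_bigl => u; rewrite sub_root.
have PQ j : (\sum_v P j v <= Q)%N.
  by rewrite total; case: j => [o|j]; [rewrite covN eqxx | apply: qQ].
have [S [Ssol Scost Scount Ssize]] := solution_of_picks T PQ.
have crP v : (#|[set j | 0 < coverage_of par (P j) v]| = (v == r) + crossing par q v)%N.
  rewrite /crossing -!sum1dep_card big_sumType /= big_mkcond big_ord1 (covN ord0).
  by case: (v == r).
have scaled (c w : R) m n : 0 <= w -> m%:R <= c * n%:R -> w *+ (2 * (0 + m)) <= c * (w *+ (2 * n)).
  move=> w0 mn; rewrite add0n !mulrnA -[_ *+ m]mulr_natr -[_ *+ n]mulr_natr mulrCA.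
  by rewrite ler_wpM2l // mulrn_wge0.
exists (fun v => (\sum_j P j v)%N), S; split=> //.
- have dq v : (d v <= \sum_j q j v)%N.
    by rewrite -S0d big_tnth; apply: pq.
  move=> v; rewrite big_sumType big_ord1 /=; split; first by apply: leq_trans (dq v) (leq_addl _ _).
  case: (eqVneq v r) => // vr; rewrite add0n; apply: leq_trans (dq v); exact: d0.
- rewrite Scost; apply: (@le_trans _ _ ((1 + 4 * eps) *
    \sum_(v | v != r) weight T v *+ (2 * crossing par p v))).
    rewrite mulr_sumr; apply: ler_sum => v vr; rewrite (crP v) (negbTE vr).
    by apply: scaled; [exact: weight_ge0 | exact: cr].
  have f0 : 0 <= 1 + 4 * eps by rewrite addr_ge0 // mulr_ge0 // ltW.
  rewrite ler_wpM2l // /cost [X in _ <= X]big_tnth.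
  apply: (@le_trans _ _ (\sum_(t : Tt)
    \sum_(v | (v != r) && (0 < coverage_of par (p t) v)%N) weight T v *+ 2)); last first.
    by apply: ler_sum => t _; apply: (tour_cost_ge (t0Q t)).
  rewrite (eq_bigr (fun t => \sum_(v | v != r) (if (0 < coverage_of par (p t) v)%N then weight T v *+ 2 else 0))); last first.
    by move=> t _; rewrite big_mkcondr.
  rewrite exchange_big /=; apply: ler_sum => v _.
  by rewrite /crossing cardsE -big_mkcond sumr_const mulrnA.
move=> v i /andP[i0 it].
case: (leP (bucket_card T eps Q S v i)%:R N) => [small|big]; first by left.
right; split; first by rewrite /small_bucket => h; have := le_lt_trans h big; rewrite ltxx.
have b0 : in_bucket eps Q i 0 = false.
  by apply/negP => /(in_bucket_gt0 e0 Q0 i0).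
have cnt : (bucket_card T eps Q S v i <= crossing par q v + 1)%N.
  rewrite /bucket_card Scount //.
  apply: (@leq_trans #|[set j | 0 < coverage_of par (P j) v]|%N).
    by apply: subset_leq_card; apply/fintype.subsetP => j; rewrite !inE => /(in_bucket_gt0 e0 Q0 i0).
  by rewrite crP addnC leq_add2l leq_b1.
case: (vq v) => [few|[vals vP]].
  have : (bucket_card T eps Q S v i)%:R <= N by apply: le_trans few; rewrite ler_nat.
  by rewrite leNgt big.
apply: (few_sizes_list (L := 1%N :: vals i)).
- by rewrite /= -addn1; have [] := vP i.
- rewrite -(ltr_nat R); apply: le_lt_trans big.
  by rewrite /N !mulr_ge0 ?invr_ge0 ?exprn_ge0 // ?(le_trans ler01 L1) ?(le_trans ler01 alpha1) // ltW.
move=> s sS sb; have s0 := in_bucket_gt0 e0 Q0 i0 sb.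
have [[o|j] e] := Ssize v s sS s0.
  by move: e s0; rewrite covN inE => ->; case: (v == r).
have [_ H] := vP i; rewrite inE -(in_bucket_uniq e0 Q0 sb) e; apply/orP; right.
by apply: H; rewrite -[coverage_of _ _ _]e.
Qed.
End Structure.

(** * Constants uniform in the instance *)

Lemma unit_pmf_sum1 (R : realType) : \sum_(w : unit) (1 : R) = 1.
Proof. by rewrite sumr_const card_unit. Qed.

Definition point_mass (R : realType) : finprob R unit :=
  FinProb (fun=> ler01 : 0 <= 1) (unit_pmf_sum1 R).

Local Open Scope classical_set_scope.

Theorem theorem6 (R : realType) (delta alpha eps0 : R)
    (hdelta : 0 < delta) (halpha : Num.max 1 (12 * delta) <= alpha) :
  exists C K : R,
  forall (eps : R) (V : finType) (T : wtree R V) (Q : nat) (d : V -> nat)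
         (opt : R),
    0 < eps <= eps0 ->
    (0 < Q)%N ->
    (forall v, v != depot T -> (0 < d v)%N) ->
    (height T)%:R <= delta * ln #|V|%:R ^+ 2 / eps ->
    is_opt T Q d opt ->
  exists (Omega : finType) (P : finprob R Omega) (d' : Omega -> V -> nat),
    (forall w v, (d v <= d' w v)%N /\ (0 < d' w v)%N) /\
    1 - C / #|V|%:R <=
      Pr P [set w | exists OPT' : seq (tour V),
        [/\ is_solution T Q (d' w) OPT',
            cost T OPT' <= (1 + 4 * eps) * opt,
            structured T delta alpha eps Q OPT'
          & few_sizes_overall T eps Q OPT' K]].
Proof.
have [alpha1 _] : 1 <= alpha /\ 12 * delta <= alpha by apply/andP; rewrite -ge_max.
have a0 : 0 <= alpha := le_trans ler01 alpha1.
pose E := Num.max eps0 1.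
have E1 : 1 <= E by rewrite le_max lexx orbT.
have E0 : 0 < E := lt_le_trans ltr01 E1.
pose K0 : R := (natceil (1 + E))%:R.
have K00 : 0 < K0 by apply: lt_le_trans (natceil_ge _); rewrite addr_gt0.
pose c := block_scale E delta K0.
have c0 : 0 < c by rewrite /c /block_scale !mulr_gt0 ?invr_gt0 ?exprn_gt0.
(* Each of [c] and [a1] to [a4] is the lower bound on [ln #|V|] that one hypothesis of
   [structured_solution] requires; their sum exceeds them all. *)
pose a1 := 144 * K0 * c ^+ 2; pose a2 := 144 * K0 * E / delta.
pose a3 := 6 * E ^+ 2 / delta; pose a4 := E * (E + 5).
have a10 : 0 <= a1 by exact: mulr_ge0 (mulr_ge0 (ler0n _ 144) (ltW K00)) (exprn_ge0 2 (ltW c0)).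
have a20 : 0 <= a2 by exact: divr_ge0 (mulr_ge0 (mulr_ge0 (ler0n _ 144) (ltW K00)) (ltW E0)) (ltW hdelta).
have a30 : 0 <= a3 by exact: divr_ge0 (mulr_ge0 (ler0n _ 6) (exprn_ge0 2 (ltW E0))) (ltW hdelta).
have a40 : 0 <= a4 by exact: mulr_ge0 (ltW E0) (addr_ge0 (ltW E0) (ler0n _ 5)).
exists (sequences.expR (1 + c + a1 + a2 + a3 + a4)),
  (4 * (1 + E) * ((ln 2)^-1 + 1) * (alpha + 2 * delta + E ^+ 2)).
move=> eps V T Q d opt /andP[e0 ee] Q0 d0 hh hopt.
have eE : eps <= E by rewrite le_max ee.
have n0 : 0 < #|V|%:R :> R by rewrite ltr0n; apply/card_gt0P; exists (depot T).
exists unit, (point_mass R).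
case: (ltP #|V|%:R (sequences.expR (1 + c + a1 + a2 + a3 + a4))) => [small|big].
  exists (fun _ v => maxn (d v) 1); split; first by move=> _ v; rewrite leq_maxl leq_maxr.
  apply: (@le_trans _ _ 0); last by apply: sumr_ge0 => w _; apply: pmf_ge0.
  by rewrite subr_le0 ler_pdivlMr // mul1r ltW.
set L : R := ln #|V|%:R.
have LL : 1 + c + a1 + a2 + a3 + a4 <= L by rewrite -[X in X <= _]expRK ler_ln ?posrE ?expR_gt0.
have L1 : 1 <= L by lra.
have [||||||d' [S [d'P Ssol Scost Sst]]] :=
  @structured_solution R V T delta alpha eps E Q hdelta alpha1 E1 _ Q0 hh L1 _ _ _ _ _ d opt d0 hopt.
- by rewrite e0.
- by rewrite -/K0 -/c -/L; lra.
- by rewrite -/K0 -/c -/L -/a1; lra.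
- by rewrite -/K0 -/L [X in _ <= X]mulrC -ler_pdivrMr // -/a2; lra.
- rewrite -/L; have : a3 <= L by lra.
  by rewrite /a3 ler_pdivrMr //; lra.
- by rewrite -/a4 -/L; lra.
exists (fun=> d'); split=> [_|]; first exact: d'P.
apply: (@le_trans _ _ 1); first by rewrite gerBl divr_ge0 // ?expR_ge0 // ltW.
rewrite /Pr (eq_bigl predT) ?unit_pmf_sum1 // => w; apply/asboolP; exists S; split=> //.
by apply: (few_sizes_overall_structured e0 Q0 eE L1 (ltW hdelta) a0 _ Sst); case: Ssol.
Qed.
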